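(* Let $\{G_n\}_{n\in\mathbb{N}}$ be a sequence of Erased Configuration Model (ECM) graphs with $|V_n|=n$, with target in-degree variable $\gamma$ and target out-degree variable $\xi$, and let $\alpha,\beta\in\{+,-\}$. Then, as $n\to\infty$, $\rho_\alpha^\beta(G_n)\to0$ in probability and $\tau_\alpha^\beta(G_n)\to0$ in probability; and, the variables $\mathcal{D}^\alpha,\mathcal{D}^\beta$ (defined in the context) not being concentrated in a single point, $\overline{\rho}_\alpha^\beta(G_n)\to0$ in probability.
   Context: Bi-degree sequence. Let $\gamma$ (in-degree) and $\xi$ (out-degree) be random variables with values in $\{0,1,2,\dots\}$, $0<\mathbb{E}[\gamma]=\mathbb{E}[\xi]<\infty$, with $\mathbb{P}(\gamma>x)\le x^{-a}L_-(x)$ and $\mathbb{P}(\xi>x)\le x^{-b}L_+(x)$ for all $x>0$, where $a,b>1$ and $L_\pm$ are slowly varying. Set $\kappa=\min\{1-a^{-1},1-b^{-1},1/2\}$ and fix $0<\delta_0<\kappa$. For a vertex set $V_n$ with $|V_n|=n$: sample i.i.d. copies $(\gamma_v)_{v\in V_n}$ of $\gamma$ and, independently, i.i.d. copies $(\xi_v)_{v\in V_n}$ of $\xi$; put $\Delta_n=\sum_v\gamma_v-\sum_v\xi_v$; resample everything until $|\Delta_n|\le n^{1-\kappa+\delta_0}$; then choose $|\Delta_n|$ vertices uniformly without replacement and add $1$ to $\xi_v$ at the chosen vertices if $\Delta_n\ge0$, or to $\gamma_v$ at the chosen vertices if $\Delta_n<0$. The results are the numbers $\widehat{D}_n^-(v)$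 (from $\gamma_v$) of inbound stubs and $\widehat{D}_n^+(v)$ (from $\xi_v$) of outbound stubs, with equal totals. ECM. Match outbound stubs to inbound stubs by a uniformly random bijection, each matched pair giving a directed edge; then remove all self-loops and merge multiple edges (same source and target) into a single edge. The resulting simple graph is the ECM graph $G_n=(V_n,E_n)$. Limiting variables. For $\alpha,\beta\in\{+,-\}$, $\mathcal{D}^\alpha$ (source) and $\mathcal{D}^\beta$ (target) are independent integer valued random variables (separate variables even if $\alpha=\beta$): for the source, $\mathbb{P}(\mathcal{D}^\alpha=k)=k\mathbb{P}(\xi=k)/\mathbb{E}[\xi]$ if $\alpha=+$ and $\mathbb{P}(\gamma=k)$ if $\alpha=-$; for the target, $\mathbb{P}(\mathcal{D}^\beta=l)=\mathbb{P}(\xi=l)$ if $\beta=+$ and $l\,\mathbb{P}(\gamma=l)/\mathbb{E}[\gamma]$ if $\beta=-$. Rank correlations of a directed graph $G=(V,E)$. $D^+(v),D^-(v)$ are out- and in-degree; for an edge $e$, $\pi_\ast e$ is its source and $\pi^\ast e$ its target; $\pi$ is either projection. Let $U_e,W_e$, $e\in E$, be i.i.d. uniform on $[0,1)$, independent of $G$, and $R^\alpha\pi_\ast e=\sum_{f\in E}\mathbf{1}\{D^\alpha\pi_\ast f+U_f\ge D^\alpha\pi_\ast e+U_e\}$, $R^\beta\pi^\ast e=\sum_{f\in E}\mathbf{1}\{D^\beta\pi^\ast f+W_f\ge D^\beta\pi^\ast e+W_e\}$, $\overline{R}^\alpha\pi e=\frac12+\sum_{f\in E}\left(\mathbf{1}\{D^\alpha\pi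 f>D^\alpha\pi e\}+\frac12\mathbf{1}\{D^\alpha\pi f=D^\alpha\pi e\}\right)$. Then $$\rho_\alpha^\beta(G)=\frac{12\sum_{e\in E}R^\alpha\pi_\ast e\,R^\beta\pi^\ast e-3|E|(|E|+1)^2}{|E|^3-|E|},$$ $$\overline{\rho}_\alpha^\beta(G)=\frac{4\sum_{e\in E}\overline{R}^\alpha\pi_\ast e\,\overline{R}^\beta\pi^\ast e-|E|(|E|+1)^2}{\sqrt{4\sum_{e\in E}(\overline{R}^\alpha\pi_\ast e)^2-|E|(|E|+1)^2}\,\sqrt{4\sum_{e\in E}(\overline{R}^\beta\pi^\ast e)^2-|E|(|E|+1)^2}},$$ $\tau_\alpha^\beta(G)=\dfrac{2(\mathcal{N}_C-\mathcal{N}_D)}{|E|(|E|-1)}$, where $\mathcal{N}_C$ (resp. $\mathcal{N}_D$) is the number of unordered pairs $\{e,f\}$ of edges with $(D^\alpha\pi_\ast e-D^\alpha\pi_\ast f)(D^\beta\pi^\ast e-D^\beta\pi^\ast f)>0$ (resp. $<0$). Each quantity is set to $0$ when its denominator vanishes. *)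

(* Defs.v *)
From HB Require Import structures.
From mathcomp Require Import all_boot all_order all_algebra finmap.
From mathcomp Require Import all_classical all_reals all_analysis.
Set Implicit Arguments.
Unset Strict Implicit.
Unset Printing Implicit Defensive.
Import Order.TTheory GRing.Theory Num.Theory.
Import numFieldNormedType.Exports.
Local Open Scope classical_set_scope.
Local Open Scope ring_scope.

(* [Plus] refers to out-degrees, [Minus] to in-degrees. *)
Variant sign := Plus | Minus.

Section Probability.
Context {R : realType}.

Definition slowly_varying (L : R -> R) : Prop :=
  [/\ measurable_fun (`]0, +oo[ : set R) L,
      \forall x \near +oo, 0 < L x &
      forall t : R, 0 < t -> L (t * x) / L x @[x --> +oo] --> (1 : R)].

(* Convergence to 0 in probability; the n-th variable lives on its own
   probability space. *)
Definition cvg_in_probability0 (d : nat -> measure_display)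
    (Omega : forall n, measurableType (d n))
    (P : forall n, probability (Omega n) R)
    (X : forall n, Omega n -> R) : Prop :=
  forall eps : R, 0 < eps ->
    P n [set w | eps < `|X n w|] @[n --> \oo] --> 0%E.

Definition mutually_independent d (Omega : measurableType d)
    (P : probability Omega R) (I : choiceType) (F : I -> set_system Omega) :
    Prop :=
  forall (J : {fset I}) (A : I -> set Omega),
    (forall i, i \in J -> F i (A i)) ->
    P (\bigcap_(i in [set` J]) A i) = (\prod_(i <- J) P (A i))%E.

Definition events_of d d' (Omega : measurableType d) (T : measurableType d')
    (X : Omega -> T) : set_system Omega :=
  [set X @^-1` B | B in measurable].

Definition discrete_events_of d (Omega : measurableType d) (T : Type)
    (X : Omega -> T) : set_system Omega :=
  [set X @^-1` B | B in [set: set T]].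

Definition same_law d d' d'' (Omega : measurableType d)
    (Omega' : measurableType d') (T : measurableType d'')
    (P : probability Omega R) (P' : probability Omega' R)
    (X : Omega -> T) (X' : Omega' -> T) : Prop :=
  forall B : set T, measurable B -> P (X @^-1` B) = P' (X' @^-1` B).

Definition mean d (Omega : measurableType d) (P : probability Omega R)
    (X : Omega -> nat) : \bar R := 'E_P[fun w => (X w)%:R].

End Probability.

Section Limiting.
Context {R : realType} d (Omega : measurableType d) (P : probability Omega R).
Variables gamma xi : Omega -> nat.

Let prob (X : Omega -> nat) (k : nat) : R := fine (P (X @^-1` [set k])).
Let size_biased (X : Omega -> nat) (k : nat) : R :=
  k%:R * prob X k / fine (mean P X).

Definition source_law (alpha : sign) : nat -> R :=
  if alpha is Plus then size_biased xi else prob gamma.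

Definition target_law (beta : sign) : nat -> R :=
  if beta is Plus then prob xi else size_biased gamma.

Definition concentrated_in_a_point (p : nat -> R) : Prop := exists k, p k = 1.

End Limiting.

Section RankCorrelations.
Context {R : realType} {V : finType}.
(* A simple directed graph on V is given by its edge set; an edge e has source
   e.1 and target e.2. *)
Variable E : {set V * V}.

Definition degree (s : sign) (v : V) : nat :=
  if s is Plus then #|[set e in E | e.1 == v]| else #|[set e in E | e.2 == v]|.

Variables alpha beta : sign.

Definition src_degree (e : V * V) : nat := degree alpha e.1.
Definition tgt_degree (e : V * V) : nat := degree beta e.2.

Definition rank (D : V * V -> nat) (U : V * V -> R) (e : V * V) : R :=
  \sum_(f in E) ((D e)%:R + U e <= (D f)%:R + U f)%R%:R.

Definition average_rank (D : V * V -> nat) (e : V * V) : R :=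
  2^-1 + \sum_(f in E) ((D e < D f)%N%:R + 2^-1 * (D e == D f)%:R).

(* Below, a quotient with vanishing denominator is 0, since 0^-1 = 0. *)

Definition spearman_uniform (U W : V * V -> R) : R :=
  let m : R := #|E|%:R in
  (12 * \sum_(e in E) rank src_degree U e * rank tgt_degree W e
     - 3 * m * (m + 1) ^+ 2) / (m ^+ 3 - m).

Definition spearman_average : R :=
  let m : R := #|E|%:R in
  (4 * \sum_(e in E) average_rank src_degree e * average_rank tgt_degree e
     - m * (m + 1) ^+ 2)
  / (Num.sqrt (4 * \sum_(e in E) average_rank src_degree e ^+ 2
                 - m * (m + 1) ^+ 2)
     * Num.sqrt (4 * \sum_(e in E) average_rank tgt_degree e ^+ 2
                   - m * (m + 1) ^+ 2)).

Definition concordance (e f : V * V) : int :=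
  ((src_degree e)%:Z - (src_degree f)%:Z)
  * ((tgt_degree e)%:Z - (tgt_degree f)%:Z).

Definition concordant_pairs : {set {set V * V}} :=
  ([set [set e; f] | e in E, f in E & (0 < concordance e f)%R])%SET.

Definition discordant_pairs : {set {set V * V}} :=
  ([set [set e; f] | e in E, f in E & (concordance e f < 0)%R])%SET.

Definition kendall : R :=
  let m : R := #|E|%:R in
  2 * (#|concordant_pairs|%:R - #|discordant_pairs|%:R) / (m * (m - 1)).

End RankCorrelations.

Section BiDegreeSequences.
Context {V : finType}.

(* (in-degrees, out-degrees) *)
Definition bidegree := ({ffun V -> nat} * {ffun V -> nat})%type.

Definition excess (r : bidegree) : int :=
  (\sum_v r.1 v)%N%:Z - (\sum_v r.2 v)%N%:Z.

Definition balance (r : bidegree) (S : {set V}) : bidegree :=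
  if 0 <= excess r then (r.1, [ffun v => (r.2 v + (v \in S))%N])
  else ([ffun v => (r.1 v + (v \in S))%N], r.2).

Definition acceptable {R : realType} (c : R) (r : bidegree) : Prop :=
  `|excess r|%N%:R <= c.

(* Equal to 0 by default if no term of the sequence is acceptable. *)
Definition first_acceptable {R : realType} (c : R) (r : nat -> bidegree) : nat :=
  xget 0%N [set k | acceptable c (r k) /\
                    forall j, (j < k)%N -> ~ acceptable c (r j)].

Definition inbound_stub (D : bidegree) := {v : V & 'I_(D.1 v)}.
Definition outbound_stub (D : bidegree) := {v : V & 'I_(D.2 v)}.

Definition stub_map := {D : bidegree & {ffun outbound_stub D -> inbound_stub D}}.

Definition to_stub_map (D : bidegree)
    (m : {ffun outbound_stub D -> inbound_stub D}) : stub_map := existT _ D m.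

Definition stub_bijections (D : bidegree) :
    {set {ffun outbound_stub D -> inbound_stub D}} :=
  ([set m : {ffun outbound_stub D -> inbound_stub D} |
    injectiveb m && [forall t, t \in codom m]])%SET.

Definition erased_edges (M : stub_map) : {set V * V} :=
  ([set e : V * V | (e.1 != e.2) &&
    [exists s, (tag s == e.1) && (tag (projT2 M s) == e.2)]])%SET.

End BiDegreeSequences.
Arguments bidegree V : clear implicits.
Arguments stub_map V : clear implicits.

Section ErasedConfigurationModel.
Context {R : realType} d (Omega : measurableType d) (P : probability Omega R).
Variable V : finType.

(* Random elements from which an ECM graph on V is built: independent attempts
   at sampling the two degree sequences, of which the first acceptable one is
   kept; the set of vertices receiving an extra stub; the matching of the stubs;
   and the uniform variables which break ties in the ranks. The latter are
   attached to all potential edges; only those of actual edges are used. *)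
Record ecm_data := ECMData {
  ecm_gamma : nat -> V -> {RV P >-> nat} ;
  ecm_xi : nat -> V -> {RV P >-> nat} ;
  ecm_extra : Omega -> {set V} ;
  ecm_match : Omega -> stub_map V ;
  ecm_U : V * V -> {RV P >-> R} ;
  ecm_W : V * V -> {RV P >-> R}
}.

Variable G : ecm_data.

Definition ecm_attempt (w : Omega) (k : nat) : bidegree V :=
  ([ffun v => ecm_gamma G k v w], [ffun v => ecm_xi G k v w]).

Definition ecm_kept (c : R) (w : Omega) : bidegree V :=
  ecm_attempt w (first_acceptable c (ecm_attempt w)).

Definition ecm_degrees (c : R) (w : Omega) : bidegree V :=
  balance (ecm_kept c w) (ecm_extra G w).

Definition ecm_graph (w : Omega) : {set V * V} := erased_edges (ecm_match G w).

(* The choices of the extra stubs and of the matching are described by their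
   conditional laws given the degrees they depend on. *)
Record is_ecm d0 (Omega0 : measurableType d0) (P0 : probability Omega0 R)
    (gamma xi : {RV P0 >-> nat}) (c : R) : Prop := IsECM {
  ecm_gamma_law : forall k v, same_law P P0 (ecm_gamma G k v) gamma ;
  ecm_xi_law : forall k v, same_law P P0 (ecm_xi G k v) xi ;
  ecm_attempt_indep : mutually_independent P
    (fun i : bool * (nat * V) =>
       if i.1 then events_of (ecm_gamma G i.2.1 i.2.2)
       else events_of (ecm_xi G i.2.1 i.2.2)) ;

  ecm_extra_measurable : forall S, measurable (ecm_extra G @^-1` [set S]) ;
  ecm_extra_law : forall (r : bidegree V) (S : {set V}), #|S| = `|excess r|%N ->
    P (ecm_kept c @^-1` [set r] `&` ecm_extra G @^-1` [set S])
    = (P (ecm_kept c @^-1` [set r]) * ('C(#|V|, `|excess r|)%:R^-1)%:E)%E ;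

  ecm_match_measurable : forall m, measurable (ecm_match G @^-1` [set m]) ;
  ecm_match_law : forall (D : bidegree V) m, m \in stub_bijections D ->
    P (ecm_degrees c @^-1` [set D] `&` ecm_match G @^-1` [set to_stub_map m])
    = (P (ecm_degrees c @^-1` [set D]) * (#|stub_bijections D|%:R^-1)%:E)%E ;

  ecm_U_law : forall e, distribution P (ecm_U G e) = uniform_prob (@ltr01 R) ;
  ecm_W_law : forall e, distribution P (ecm_W G e) = uniform_prob (@ltr01 R) ;
  ecm_UW_indep : mutually_independent P
    (fun i : option (bool * (V * V)) =>
       match i with
       | None => discrete_events_of ecm_graph
       | Some (true, e) => events_of (ecm_U G e)
       | Some (false, e) => events_of (ecm_W G e)
       end)
}.

End ErasedConfigurationModel.

(* Main.v *)
(* The first attempt is accepted with high probability: truncating the degrees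
   at n^(1/p), with 1 < p < min(a, b, 2), the tails give finite p-th moments and
   Chebyshev's inequality applies to the truncated sums, so the conditioning on
   acceptance costs only a vanishing probability.

   Given the degrees, exchanging the targets of two stubs preserves the law of
   the matching and negates the term of these two stubs in the sum of
   sgn(D e - D f) sgn(D' e - D' f) over pairs of stubs. Hence only pairs with a
   stub in common contribute to the second moment of this sum, which is thus
   negligible with respect to the square of the number of stubs. The same sum
   over the edges of the erased graph is close to it, because vertices of large
   degree hold few stubs and few stubs are in loops or in multiple edges.
   Spearman's sum is treated in the same way.

   The denominator of the average-rank coefficient is of order |E|^3 because
   each limiting law has two atoms, and a positive fraction of the stubs has
   either value as its degree. The uniform tie-breakers are cut into finitely
   many intervals, so that, unless two of them fall in the same one, breaking the
   ties is a finite uniform choice, to which the exchange argument applies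
   again. *)
Require Import Defs.
From HB Require Import structures.
From mathcomp Require Import all_boot all_order all_algebra finmap.
From mathcomp Require Import all_classical all_reals all_analysis.
From mathcomp Require Import perm measurable_realfun.
From mathcomp Require Import zify ring lra.
Import Order.TTheory GRing.Theory Num.Theory.
Import numFieldNormedType.Exports.
Local Open Scope classical_set_scope.
Local Open Scope ring_scope.

Set Implicit Arguments.
Unset Strict Implicit.
Unset Printing Implicit Defensive.

(** * Rank statistics as sums over pairs of edges *)

(** The degrees may have infinite variance, so no estimate may use the second moment of an
    untruncated degree. What the p-th moments give is that the stubs in excess of a level K number
    at most of order n K^(1-p); the levels used against heavy vertices are therefore chosen before n
    and do not grow with it.

    No conditional law is formed for the kept degrees: they are those of the first attempt as soon
    as it is acceptable, so a union bound transfers events. Given the degrees, all estimates are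
    counts of bijections, and [pr_uniform_choice] and [pr_disintegrate] are the bridge to
    probabilities.

    Spearman's sum runs over triples of edges, where an exchange of two targets does not simply
    change a sign. For a bijection, however, the centred rank of a target depends on the inbound
    stub alone, which reduces the triples to pairs; antisymmetrizing then makes the exchange
    argument apply.

    The average-rank coefficient is bounded by [eta / c], where [c] bounds its denominator from
    below. Hence [c] has to be fixed before the precision [eta]. *)

Definition cmp {R : realFieldType} (k l : nat) : R :=
  (k < l)%N%:R - (l < k)%N%:R.

Section Cmp.
Context {R : realFieldType}.
Notation cmp := (@cmp R).

Lemma cmpC k l : cmp k l = - cmp l k.
Proof. by rewrite /cmp opprB. Qed.

Lemma cmpxx k : cmp k k = 0.
Proof. by rewrite /cmp subrr. Qed.

Lemma cmp_norm k l : `|cmp k l| <= 1.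
Proof.
by rewrite /cmp; case: ltngtP => _; rewrite ?subrr ?subr0 ?sub0r ?normrN ?normr1 ?normr0.
Qed.

Lemma cmp_antisum (I : finType) (A : {set I}) (F : I -> I -> R) :
  (forall s t, F s t = - F t s) -> \sum_(s in A) \sum_(t in A) F s t = 0.
Proof.
move=> FC; set x := LHS.
have : x = - x.
  rewrite {1}/x exchange_big /= -sumrN; apply: eq_bigr => s _.
  by rewrite -sumrN; apply: eq_bigr => t _.
by move=> ?; lra.
Qed.

End Cmp.

Lemma ler_sum_norm1 {R : realFieldType} (I : finType) (A : {set I}) (F : I -> R)
    (c : R) :
  (forall i, i \in A -> `|F i| <= c) -> `|\sum_(i in A) F i| <= #|A|%:R * c.
Proof.
move=> Fc; apply: (le_trans (ler_norm_sum _ _ _)).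
by rewrite mulr_natl -sumr_const; exact: ler_sum.
Qed.

Lemma card_markov {R : realFieldType} (X : finType) (Om : {set X}) (f : X -> R)
    (t M : R) :
  0 < t -> \sum_(x in Om) f x <= M -> (forall x, x \in Om -> 0 <= f x) ->
  #|[set x in Om | t < f x]%SET|%:R <= M / t.
Proof.
move=> t0 fM f0; rewrite ler_pdivlMr //; apply: le_trans fM.
rewrite mulr_natl -sumr_const [leRHS](big_setID [set x in Om | t < f x]%SET) /=.
rewrite -[leLHS]addr0; apply: lerD; last first.
  by apply: sumr_ge0 => x; rewrite inE => /andP[_ /f0].
have -> : (Om :&: [set x in Om | t < f x] = [set x in Om | t < f x])%SET.
  by apply/setP => x; rewrite !inE andbA andbb.
by apply: ler_sum => x; rewrite inE => /andP[_ /ltW].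
Qed.

Lemma card_chebyshev {R : realFieldType} (X : finType) (Om : {set X}) (f : X -> R)
    (t M : R) :
  0 < t -> \sum_(x in Om) f x ^+ 2 <= M ->
  #|[set x in Om | t < `|f x|]%SET|%:R <= M / t ^+ 2.
Proof.
move=> t0 fM.
have t20 : 0 < t ^+ 2 by rewrite exprn_gt0.
apply: le_trans (card_markov t20 fM _); last by move=> x _; exact: sqr_ge0.
rewrite ler_nat; apply: subset_leq_card; apply/fintype.subsetP => x.
rewrite !inE => /andP[->] /=; rewrite -[f x ^+ 2]real_normK ?num_real//.
by move=> h; rewrite ltrXn2r ?normr_ge0// ltW.
Qed.

(* The transposition of s and t negates the summand at (s, t) and fixes the
   summands at the pairs disjoint from it, so that only the pairs (s, t),
   (u, v) having a point in common contribute to the second moment. *)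
Lemma swap_second_moment {R : realFieldType} (I Y : finType)
    (Om : {set {ffun I -> Y}}) (A : {set I}) (h : I -> I -> Y -> Y -> R) (C : R) :
  (forall s t (x : {ffun I -> Y}),
    ([ffun i => x (tperm s t i)] \in Om) = (x \in Om)) ->
  (forall s t y z, h s t z y = - h s t y z) ->
  (forall s t y z, s \in A -> t \in A -> `|h s t y z| <= C) ->
  \sum_(x in Om) (\sum_(s in A) \sum_(t in A) h s t (x s) (x t)) ^+ 2
    <= #|Om|%:R * (4 * #|A|%:R ^+ 3 * C ^+ 2).
Proof.
move=> Omsw hC hle.
pose m : R := #|A|%:R.
pose sw s t (x : {ffun I -> Y}) := [ffun i => x (tperm s t i)].
have swK s t : involutive (sw s t).
  by move=> x; apply/ffunP => i; rewrite !ffunE tpermK.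
pose q s t (x : {ffun I -> Y}) := h s t (x s) (x t).
pose meet (s t u v : I) := [|| u == s, u == t, v == s | v == t].
have qle s t x : s \in A -> t \in A -> `|q s t x| <= C by move=> *; exact: hle.
have main s t u v : s \in A -> t \in A -> u \in A -> v \in A ->
    \sum_(x in Om) q s t x * q u v x <= #|Om|%:R * C ^+ 2 * (meet s t u v)%:R.
  move=> sA tA uA vA; case: (boolP (meet s t u v)) => [_|].
    rewrite mulr1; apply: (le_trans (ler_norm _)); apply: ler_sum_norm1 => x _.
    by rewrite normrM expr2 ler_pM// qle.
  rewrite /meet !negb_or => /and4P[us ut vs vt]; rewrite mulr0.
  set T := \sum_(x in Om) _; suff : T = - T by move=> ?; lra.
  rewrite {1}/T (reindex_inj (can_inj (swK s t))) /= -sumrN.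
  apply: eq_big => [x|x _]; first by rewrite Omsw.
  rewrite /q /sw !ffunE tpermL tpermR !tpermD// 1?eq_sym// hC mulNr//.
have -> : \sum_(x in Om) (\sum_(s in A) \sum_(t in A) h s t (x s) (x t)) ^+ 2 =
    \sum_(s in A) \sum_(t in A) \sum_(u in A) \sum_(v in A)
      \sum_(x in Om) q s t x * q u v x.
  under eq_bigr => x _.
    rewrite expr2 mulr_suml; under eq_bigr => s _.
      rewrite mulr_suml; under eq_bigr => t _.
        rewrite mulr_sumr; under eq_bigr => u _ do rewrite mulr_sumr.
      over.
    over.
  over.
  rewrite exchange_big; apply: eq_bigr => s _.
  rewrite exchange_big; apply: eq_bigr => t _.
  rewrite exchange_big; apply: eq_bigr => u _.
  by rewrite exchange_big; apply: eq_bigr => v _.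
apply: (@le_trans _ _ (\sum_(s in A) \sum_(t in A) (#|Om|%:R * C ^+ 2 * (4 * m)))).
  apply: ler_sum => s sA; apply: ler_sum => t tA.
  apply: (@le_trans _ _ (\sum_(u in A) \sum_(v in A)
      (#|Om|%:R * C ^+ 2 * (meet s t u v)%:R))).
    by apply: ler_sum => u uA; apply: ler_sum => v vA; exact: main.
  under eq_bigr => u _ do rewrite -mulr_sumr.
  rewrite -mulr_sumr; apply: ler_wpM2l; first by rewrite mulr_ge0// sqr_ge0.
  apply: (@le_trans _ _ (\sum_(u in A) \sum_(v in A)
     ((u == s)%:R + (u == t)%:R + (v == s)%:R + (v == t)%:R : R))).
    apply: ler_sum => u _; apply: ler_sum => v _.
    by rewrite /meet -!natrD ler_nat; do 4! case: (_ == _).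
  have one (w : I) : w \in A -> \sum_(u in A) (u == w)%:R = 1 :> R.
    move=> wA; rewrite (bigD1 w)//= eqxx big1 ?addr0// => i /andP[_ /negbTE->].
    by [].
  have H1 (w : I) : w \in A -> \sum_(u in A) \sum_(v in A) (u == w)%:R = m.
    move=> wA; rewrite exchange_big/=.
    by under eq_bigr => u _ do rewrite one//; rewrite sumr_const.
  have H2 (w : I) : w \in A -> \sum_(u in A) \sum_(v in A) (v == w)%:R = m.
    by move=> wA; under eq_bigr => u _ do rewrite one//; rewrite sumr_const.
  under eq_bigr => u _ do rewrite !big_split/=.
  by rewrite !big_split/= !H1// !H2//; lra.
rewrite sumr_const -mulr_natl sumr_const -mulr_natl -/m.
by rewrite le_eqVlt; apply/orP; left; apply/eqP; ring.
Qed.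

Section Formulas.
Context {R : realFieldType}.
Notation cmp := (@cmp R).

(** Irreflexivity makes e and f distinct in each counted set, so its only two preimages are (e, f)
    and (f, e). *)
Lemma card_unordered_pairs (T : finType) (E : {set T}) (r : rel T) :
  (forall e f, r e f = r f e) -> (forall e, ~~ r e e) ->
  (2 * #|[set [set e; f] | e in E, f in E & r e f]%SET| =
   \sum_(e in E) \sum_(f in E) r e f)%N.
Proof.
move=> rC rI.
pose P := [set p : T * T | [&& p.1 \in E, p.2 \in E & r p.1 p.2]]%SET.
pose F (p : T * T) := [set p.1; p.2]%SET.
have -> : [set [set e; f] | e in E, f in E & r e f]%SET = (F @: P)%SET.
  apply/setP => S; apply/imset2P/imsetP => [[e f eE]|[[e f]]].
    by rewrite !inE => /andP[fE ref] ->; exists (e, f); rewrite // inE eE fE.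
  rewrite inE /= => /and3P[eE fE ref] ->.
  by exists e f; rewrite // inE fE.
have -> : (\sum_(e in E) \sum_(f in E) r e f = #|P|)%N.
  rewrite -sum1_card pair_big /= (bigID (fun p : T * T => r p.1 p.2)) /=.
  rewrite [X in (_ + X)%N]big1 ?addn0; last first.
    by move=> p /andP[_ /negbTE ->].
  apply: eq_big => [p|p /andP[_ ->]//]; by rewrite inE andbA.
rewrite -[RHS]sum1_card (partition_big_imset F) /=.
rewrite (eq_bigr (fun=> 2%N)) ?sum_nat_const 1?mulnC// => S /imsetP[[e f]].
rewrite inE /= => /and3P[eE fE ref] ->.
have ef : e != f by apply: contraTneq ref => ->.
have two : 2%N = #|[set (e, f); (f, e)]%SET|.
  by rewrite cards2 xpair_eqE (negbTE ef).
rewrite sum1_card two; apply: eq_card => -[x y]; rewrite unfold_in/= !inE /F /=.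
apply/andP/idP => [[/and3P[xE yE rxy] /eqP/setP xy]|].
  have xy' : x != y by apply: contraTneq rxy => ->.
  move: (xy x) (xy y); rewrite !inE !eqxx orbT /=.
  move=> /esym/orP xx /esym/orP yy; move: xx yy xy' => [] /eqP -> [] /eqP ->;
    by move=> h; rewrite ?eqxx // in h *; rewrite orbC.
move=> /orP[] /eqP[-> ->]; first by rewrite eE fE ref eqxx.
by rewrite eE fE rC ref finset.setUC eqxx.
Qed.

(** Edges above e minus edges below it: twice the rank of e, counted from the top and centred at its
    mean. *)
Definition csum (T : finType) (E : {set T}) (D : T -> nat) (e : T) : R :=
  \sum_(f in E) cmp (D e) (D f).

Lemma csum_norm (T : finType) (E : {set T}) D e : `|csum E D e| <= #|E|%:R.
Proof.
rewrite -[leRHS]mulr1; apply: ler_sum_norm1 => f _; exact: cmp_norm.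
Qed.

Lemma sum_csum (T : finType) (E : {set T}) D : \sum_(e in E) csum E D e = 0.
Proof. by apply: cmp_antisum => s t; exact: cmpC. Qed.

Definition kendall_sum (T : finType) (E : {set T}) (D D' : T -> nat) : R :=
  \sum_(e in E) \sum_(f in E) cmp (D e) (D f) * cmp (D' e) (D' f).

Definition spearman_sum (T : finType) (E : {set T}) (D D' : T -> nat) : R :=
  \sum_(e in E) csum E D e * csum E D' e.

(** The mixed terms vanish, and the first term on the right is, up to a factor, the constant
    subtracted in both Spearman coefficients. *)
Lemma sum_ranks (T : finType) (E : {set T}) (A A' : T -> R) :
  \sum_(e in E) A e = 0 -> \sum_(e in E) A' e = 0 ->
  \sum_(e in E) (#|E|%:R + 1 + A e) * (#|E|%:R + 1 + A' e)
    = #|E|%:R * (#|E|%:R + 1) ^+ 2 + \sum_(e in E) A e * A' e.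
Proof.
move=> A0 A'0; set m : R := #|E|%:R.
under eq_bigr => e _.
  have -> : (m + 1 + A e) * (m + 1 + A' e) =
    (m + 1) ^+ 2 + (m + 1) * A' e + (m + 1) * A e + A e * A' e by ring.
  over.
rewrite !big_split /= -!mulr_sumr A0 A'0 !mulr0 !addr0.
by rewrite sumr_const -mulr_natl; ring.
Qed.

End Formulas.

Section GraphFormulas.
Context {R : realType} {V : finType}.
Variables (E : {set V * V}) (alpha beta : sign).
Let D := src_degree E alpha.
Let D' := tgt_degree E beta.

Lemma kendallE :
  kendall E alpha beta = kendall_sum E D D' / (#|E|%:R * (#|E|%:R - 1)) :> R.
Proof.
rewrite /kendall; congr (_ / _).
have concC e f : concordance E alpha beta e f = concordance E alpha beta f e.
  by rewrite /concordance -mulrNN !opprB.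
have conc0 e : concordance E alpha beta e e = 0.
  by rewrite /concordance subrr mul0r.
rewrite mulrBr -!natrM !card_unordered_pairs; first last.
- by move=> e; rewrite conc0 ltxx.
- by move=> e f; rewrite concC.
- by move=> e; rewrite conc0 ltxx.
- by move=> e f; rewrite concC.
rewrite !natr_sum -sumrB; apply: eq_bigr => e _.
rewrite !natr_sum -sumrB; apply: eq_bigr => f _.
rewrite /concordance -/D -/D'; rewrite -/(D e) -/(D f) -/(D' e) -/(D' f).
have sg k l : ((k%:Z - l%:Z < 0) = (k < l)%N) * ((0 < k%:Z - l%:Z) = (l < k)%N).
  by rewrite subr_lt0 subr_gt0 !ltz_nat.
have sg2 k l : Num.sg (k%:Z - l%:Z) = (l < k)%N%:Z - (k < l)%N%:Z.
  by case: (ltngtP k l) => h; [rewrite ltr0_sg// sg|rewrite gtr0_sg// sg|rewrite h subrr sgr0].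
have sg3 (z : int) : (0 < z)%R%:R - (z < 0)%R%:R = (Num.sg z)%:~R :> R.
  by rewrite -[Num.sg z]/(if _ then _ else _); case: ltrgt0P => _ /=; rewrite ?subr0 ?sub0r ?subrr.
rewrite sg3 sgrM !sg2 /cmp rmorphM !rmorphB /=.
by rewrite -!pmulrn -mulrNN !opprB.
Qed.

Lemma average_rankE (d : V * V -> nat) e :
  average_rank E d e = 2^-1 * (#|E|%:R + 1 + csum E d e) :> R.
Proof.
rewrite /average_rank /csum -[#|E|%:R]mulr1 mulr_natl -sumr_const.
rewrite addrAC -big_split /= mulrDr mulr1 addrC mulr_sumr; congr (_ + _).
apply: eq_bigr => f _; rewrite /cmp.
by case: ltngtP => _ /=; rewrite ?mulr0 ?mulr1 ?subrr ?addr0 ?add0r ?subr0 ?sub0r //; field.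
Qed.

Lemma spearman_averageE :
  spearman_average E alpha beta =
  spearman_sum E D D' / (Num.sqrt (spearman_sum E D D)
    * Num.sqrt (spearman_sum E D' D')) :> R.
Proof.
have key (d d' : V * V -> nat) :
    4 * \sum_(e in E) average_rank E d e * average_rank E d' e
    - #|E|%:R * (#|E|%:R + 1) ^+ 2 = spearman_sum E d d' :> R.
  apply/eqP; rewrite subr_eq addrC /spearman_sum -sum_ranks ?sum_csum//; apply/eqP.
  rewrite mulr_sumr; apply: eq_bigr => e _; by rewrite !average_rankE; field.
have key2 (d : V * V -> nat) :
    4 * \sum_(e in E) average_rank E d e ^+ 2
    - #|E|%:R * (#|E|%:R + 1) ^+ 2 = spearman_sum E d d :> R.
  by rewrite -key; under eq_bigr do rewrite expr2.
by rewrite /spearman_average key !key2.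
Qed.

(* Ties are broken by the distinct integer values [val] and [val']. *)
Lemma spearman_uniformE (U W : V * V -> R) (val val' : V * V -> nat) :
  {in E &, injective val} -> {in E &, injective val'} ->
  (forall e f, e \in E -> f \in E -> e != f ->
    ((D e)%:R + U e <= (D f)%:R + U f) = (val e < val f)%N) ->
  (forall e f, e \in E -> f \in E -> e != f ->
    ((D' e)%:R + W e <= (D' f)%:R + W f) = (val' e < val' f)%N) ->
  spearman_uniform E alpha beta U W
    = 3 * spearman_sum E val val' / (#|E|%:R ^+ 3 - #|E|%:R).
Proof.
move=> vi vi' vE vE'.
have key (d v : V * V -> nat) (X : V * V -> R) e : {in E &, injective v} ->
  (forall e f, e \in E -> f \in E -> e != f ->
    ((d e)%:R + X e <= (d f)%:R + X f) = (v e < v f)%N) -> e \in E ->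
  rank E d X e = 2^-1 * (#|E|%:R + 1 + csum E v e).
  move=> {}vi {}vE eE; rewrite /rank.
  rewrite [csum _ _ _](bigD1 e)//= cmpxx add0r (bigD1 e) //= lexx.
  have -> : #|E|%:R = 1 + \sum_(i in E | i != e) 1 :> R.
    by rewrite -sumr_const (bigD1 e).
  rewrite [1 + _ + 1]addrAC -[1 + 1 + _ + _]addrA -big_split/= mulrDr mulr_sumr.
  congr (_ + _); first by field.
  apply: eq_bigr => f /andP[fE fe]; rewrite vE// 1?eq_sym// /cmp.
  have := vi _ _ eE fE; case: ltngtP => [||ef] /=; [by move=> *; field => //| |].
    by move=> *; ring.
  by move=> /(_ ef) fe'; rewrite fe' eqxx in fe.
rewrite /spearman_uniform; congr (_ / _).
rewrite -/D -/D'.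
have -> : 12 * \sum_(e in E) rank E D U e * rank E D' W e =
  3 * \sum_(e in E) (#|E|%:R + 1 + csum E val e) * (#|E|%:R + 1 + csum E val' e).
  rewrite !mulr_sumr; apply: eq_bigr => e eE.
  by rewrite (key D val U)// (key D' val' W)//; field.
by rewrite sum_ranks ?sum_csum//; rewrite /spearman_sum; ring.
Qed.

End GraphFormulas.

(** Terms outside [H] are merely bounded by 1: there are |S| - |H| of them on one side and, since
    |E| <= |S|, no more on the other. It is applied to pairs and to triples of stubs, compared with
    those of edges. *)
Lemma ler_dist_sum_embed {R : realFieldType} (S T : finType) (H : {set S})
    (E : {set T}) (phi : S -> T) (F : T -> R) (G : S -> R) :
  {in H &, injective phi} -> (forall s, s \in H -> phi s \in E) ->
  (#|E| <= #|S|)%N -> (forall e, `|F e| <= 1) -> (forall s, `|G s| <= 1) ->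
  (forall s, s \in H -> F (phi s) = G s) ->
  `|\sum_(e in E) F e - \sum_s G s| <= 2 * (#|S|%:R - #|H|%:R).
Proof.
move=> phiI phiE ES F1 G1 FG.
have HE : (phi @: H \subset E)%SET by apply/fintype.subsetP => _ /imsetP[s sH ->]; exact: phiE.
have cH : #|phi @: H|%SET = #|H| by rewrite card_in_imset.
have -> : \sum_(e in E) F e = \sum_(s in H) G s + \sum_(e in E :\: (phi @: H)) F e.
  rewrite (big_setID (phi @: H)%SET) /= (finset.setIidPr HE) big_imset//; congr (_ + _).
  by apply: eq_bigr => s sH; rewrite FG.
have -> : \sum_s G s = \sum_(s in H) G s + \sum_(s in ~: H) G s.
  by rewrite (bigID (mem H)) /=; congr (_ + _); apply: eq_bigl => s; rewrite inE.
rewrite opprD addrACA subrr add0r.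
apply: (le_trans (ler_normB _ _)).
have /(_ 1) b1 := @ler_sum_norm1 R T (E :\: (phi @: H))%SET F.
have /(_ 1) b2 := @ler_sum_norm1 R S (~: H)%SET G.
have := lerD (b1 (fun e _ => F1 e)) (b2 (fun e _ => G1 e)).
move=> /le_trans; apply; rewrite !mulr1.
have -> : #|~: H|%SET%:R = #|S|%:R - #|H|%:R :> R.
  by rewrite -(cardsC H) natrD addrC addKr.
rewrite cardsD (finset.setIidPr HE) cH natrB; last by rewrite -cH subset_leq_card.
have : #|E|%:R <= #|S|%:R :> R by rewrite ler_nat.
lra.
Qed.

Section CompareSums.
Context {R : realFieldType}.
Variables (S T : finType) (H : {set S}) (E : {set T}) (phi : S -> T).
Variables (k l : S -> nat) (k' l' : T -> nat).
Hypothesis phiI : {in H &, injective phi}.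
Hypothesis phiE : forall s, s \in H -> phi s \in E.
Hypothesis cardE : (#|E| <= #|S|)%N.
Hypothesis kE : forall s, s \in H -> k' (phi s) = k s.
Hypothesis lE : forall s, s \in H -> l' (phi s) = l s.

(** The unmatched pairs number |S|^2 - |H|^2 <= 2 |S| (|S| - |H|), and the two sides double this. *)
Lemma kendall_sum_embed :
  `|kendall_sum E k' l' - kendall_sum [set: S]%SET k l|
    <= 4 * #|S|%:R * (#|S|%:R - #|H|%:R) :> R.
Proof.
have c1 a b c d : `|@cmp R a b * cmp c d| <= 1.
  by rewrite normrM mulr_ile1 ?cmp_norm.
have := @ler_dist_sum_embed R _ _ (finset.setX H H) (finset.setX E E)
  (fun p : S * S => (phi p.1, phi p.2))
  (fun p => cmp (k' p.1) (k' p.2) * cmp (l' p.1) (l' p.2))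
  (fun p => cmp (k p.1) (k p.2) * cmp (l p.1) (l p.2)).
rewrite !cardsX card_prod leq_mul// !natrM.
have -> : \sum_(e in finset.setX E E) cmp (k' e.1) (k' e.2) * cmp (l' e.1) (l' e.2)
    = kendall_sum E k' l' :> R.
  by rewrite /kendall_sum pair_big; apply: eq_bigl => -[a b]; rewrite finset.in_setX.
have -> : \sum_s cmp (k s.1) (k s.2) * cmp (l s.1) (l s.2)
    = kendall_sum [set: S]%SET k l :> R.
  rewrite /kendall_sum pair_big; apply: eq_bigl => -[a b]; by rewrite !inE.
move=> h; apply: le_trans (h _ _ isT _ _ _) _ => //; clear h.
- move=> [a b] [c d]; rewrite !finset.in_setX /= => /andP[aH bH] /andP[cH dH] [].
  by move=> /phiI-> // /phiI->.
- by move=> [a b]; rewrite !finset.in_setX /= => /andP[/phiE-> /phiE->].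
- by move=> [a b]; rewrite !finset.in_setX /= => /andP[aH bH]; rewrite !kE// !lE.
have : #|H|%:R <= #|S|%:R :> R by rewrite ler_nat max_card.
have : 0 <= #|H|%:R :> R by [].
by nra.
Qed.

(** A product of two centred ranks summed over e is a sum over triples, with |S|^3 - |H|^3 <= 3
    |S|^2 (|S| - |H|) unmatched ones on each side. *)
Lemma spearman_sum_embed :
  `|spearman_sum E k' l' - spearman_sum [set: S]%SET k l|
    <= 6 * #|S|%:R ^+ 2 * (#|S|%:R - #|H|%:R) :> R.
Proof.
have c1 a b c d : `|@cmp R a b * cmp c d| <= 1.
  by rewrite normrM mulr_ile1 ?cmp_norm.
have := @ler_dist_sum_embed R _ _ (finset.setX H (finset.setX H H))
  (finset.setX E (finset.setX E E))
  (fun p : S * (S * S) => (phi p.1, (phi p.2.1, phi p.2.2)))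
  (fun p => cmp (k' p.1) (k' p.2.1) * cmp (l' p.1) (l' p.2.2))
  (fun p => cmp (k p.1) (k p.2.1) * cmp (l p.1) (l p.2.2)).
rewrite !cardsX !card_prod !leq_mul// !natrM.
have sumE (U : finType) (A : {set U}) (u v : U -> nat) :
    \sum_(e in finset.setX A (finset.setX A A))
       cmp (u e.1) (u e.2.1) * cmp (v e.1) (v e.2.2)
    = spearman_sum A u v :> R.
  rewrite /spearman_sum /csum.
  under [RHS]eq_bigr => e _.
    rewrite mulr_suml.
    under eq_bigr => f _ do rewrite mulr_sumr.
    rewrite pair_big.
  over.
  by rewrite pair_big /=; apply: eq_bigl => -[a [b c]]; rewrite !finset.in_setX.
rewrite sumE.
have -> : \sum_s cmp (k s.1) (k s.2.1) * cmp (l s.1) (l s.2.2)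
    = spearman_sum [set: S]%SET k l :> R.
  by rewrite -sumE; apply: eq_bigl => p; rewrite !inE.
move=> h; apply: le_trans (h _ _ isT _ _ _) _ => //; clear h.
- move=> [a [b b']] [c [d d']]; rewrite !finset.in_setX /=.
  move=> /and3P[aH bH b'H] /and3P[cH dH d'H] [].
  by move=> /phiI-> // /phiI-> // /phiI->.
- by move=> [a [b b']]; rewrite !finset.in_setX /= => /and3P[/phiE-> /phiE-> /phiE->].
- by move=> [a [b b']]; rewrite !finset.in_setX /= => /and3P[aH bH b'H]; rewrite !kE// !lE.
have : #|H|%:R <= #|S|%:R :> R by rewrite ler_nat max_card.
have : 0 <= #|H|%:R :> R by [].
move: (#|H|%:R : R) (#|S|%:R : R) => h' s h0 hs.
rewrite -subr_ge0 (_ : _ - _ = 2 * (s - h') * ((s - h') * (2 * s + h'))); last by ring.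
by rewrite !mulr_ge0 ?subr_ge0// addr_ge0// mulr_ge0// (le_trans h0).
Qed.

End CompareSums.

(** * Erasure *)

Lemma sum_stubs (V : finType) (d : V -> nat) (F : V -> nat) :
  (\sum_(s : {v : V & 'I_(d v)}) F (tag s) = \sum_v d v * F v)%N.
Proof.
transitivity (\sum_v \sum_(j : 'I_(d v)) F v)%N; last first.
  by apply: eq_bigr => v _; rewrite sum_nat_const card_ord.
by rewrite (sig_big_dep _ (J := fun v => 'I_(d v)) _ (fun v _ => F v)).
Qed.

Lemma card_stubs (V : finType) (d : V -> nat) (Q : pred V) :
  #|[set s : {v : V & 'I_(d v)} | Q (tag s)]%SET| = (\sum_(v | Q v) d v)%N.
Proof.
rewrite -sum1dep_card big_mkcond /=.
rewrite (sum_stubs d (fun v => if Q v then 1 else 0)%N) [RHS]big_mkcond /=.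
by apply: eq_bigr => v _; case: (Q v); rewrite ?muln1 ?muln0.
Qed.

Section Erasure.
Variables (V : finType) (D : bidegree V).
Variable m : {ffun outbound_stub D -> inbound_stub D}.
Hypothesis m_bij : m \in stub_bijections D.

Let src (s : outbound_stub D) : V := tag s.
Let tgt (s : outbound_stub D) : V := tag (m s).
Let E : {set V * V} := erased_edges (to_stub_map m).

Lemma stub_bijection_inj : injective m.
Proof. by move: m_bij; rewrite inE => /andP[/injectiveP]. Qed.

Lemma stub_bijection_bij : bijective m.
Proof.
apply: inj_card_bij stub_bijection_inj _.
move: m_bij; rewrite inE => /andP[_ /forallP h].
rewrite -cardsT -[leqRHS](card_imset _ stub_bijection_inj).
apply: subset_leq_card; apply/fintype.subsetP => t _.
by have /codomP[s ->] := h t; rewrite imset_f.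
Qed.

(** All stubs of a multiple edge count, including one that could stand for the surviving edge; this
    avoids choosing representatives, and the remaining stubs embed into the edges. *)
Definition dirty (s : outbound_stub D) :=
  (src s == tgt s) ||
  [exists t, [&& t != s, src t == src s & tgt t == tgt s]].

(** Damage spreads in two stages: a dirty stub may change the degrees of its two ends, and thereby
    the terms of every stub at these vertices, which are then [spoiled]. *)
Definition affected (v : V) := [exists s, dirty s && ((src s == v) || (tgt s == v))].

Definition spoiled (s : outbound_stub D) := affected (src s) || affected (tgt s).

Definition stub_edge (s : outbound_stub D) : V * V := (src s, tgt s).

Lemma erased_edgesP e :
  reflect (exists2 s, src s != tgt s & e = stub_edge s) (e \in E).
Proof.
rewrite inE; apply: (iffP andP) => [[e12 /existsP[s /andP[/eqP s1 /eqP s2]]]|].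
  exists s; first by rewrite /src /tgt s1 s2.
  by rewrite /stub_edge /src /tgt s1 s2 -surjective_pairing.
move=> [s st ->]; split=> //; apply/existsP; exists s.
by rewrite !eqxx.
Qed.

Lemma clean_stub_edge s : ~~ dirty s -> stub_edge s \in E.
Proof.
rewrite /dirty negb_or => /andP[st _]; apply/erased_edgesP; exists s => //.
Qed.

Lemma clean_stub_edge_inj s t : ~~ dirty s -> stub_edge s = stub_edge t -> s = t.
Proof.
rewrite /dirty negb_or negb_exists => /andP[_ /forallP /(_ t)] + [st st'].
by rewrite st st' !eqxx !andbT negbK => /eqP.
Qed.

Lemma unaffected_clean v s :
  ~~ affected v -> (src s == v) || (tgt s == v) -> ~~ dirty s.
Proof.
rewrite negb_exists => /forallP/(_ s); rewrite negb_and => /orP[//|/negbTE ->//].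
Qed.

Lemma card_erased : (#|E| <= #|{: outbound_stub D}|)%N.
Proof.
rewrite -cardsT; apply: leq_trans (leq_imset_card stub_edge _).
apply: subset_leq_card; apply/fintype.subsetP => e /erased_edgesP[s _ ->].
exact: imset_f.
Qed.

(** Every stub at v is clean and clean stubs embed into the edges, so the degree counts stubs. For
    the in-degree, the inbound stubs at v are pulled back along the bijection [m]. *)
Lemma degree_unaffected sg v : ~~ affected v ->
  degree E sg v = if sg is Plus then D.2 v else D.1 v.
Proof.
move=> vN.
have key (Q : pred (V * V)) :
    (forall s, Q (stub_edge s) -> (src s == v) || (tgt s == v)) ->
    #|[set e in E | Q e]%SET| = #|[set s | Q (stub_edge s)]%SET|.
  move=> Qv.
  have clean s : Q (stub_edge s) -> ~~ dirty s.
    by move=> /Qv; exact: unaffected_clean.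
  rewrite -(@card_in_imset _ _ stub_edge); last first.
    move=> s t; rewrite !inE => /clean sc _; exact: clean_stub_edge_inj.
  apply: eq_card => e; rewrite inE; apply/andP/imsetP.
    by move=> [/erased_edgesP[s _ ->] Qs]; exists s; rewrite ?inE.
  move=> [s]; rewrite inE => Qs ->; split=> //.
  exact: clean_stub_edge (clean _ Qs).
case: sg; rewrite /degree key /=.
- by rewrite (card_stubs D.2 (pred1 v)) big_pred1_eq.
- by move=> s ->.
- rewrite -(big_pred1_eq addn v D.1) -(card_stubs D.1 (pred1 v)).
  rewrite -[RHS](on_card_preimset (f := m)); last exact: onW_bij stub_bijection_bij.
  by apply: eq_card => s; rewrite !inE.
- by move=> s ->; rewrite orbT.
Qed.

(** Each dirty stub affects at most two vertices, and a vertex holds at most 2K stubs besides its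
    overflow beyond K. *)
Lemma card_spoiled K : (#|[set s | spoiled s]%SET| <=
  4 * K * #|[set s | dirty s]%SET| + \sum_v ((D.1 v - K) + (D.2 v - K)))%N.
Proof.
have aff : (#|[set v | affected v]%SET| <= 2 * #|[set s | dirty s]%SET|)%N.
  rewrite mul2n -addnn.
  apply: (@leq_trans (#|src @: [set s | dirty s]%SET| + #|tgt @: [set s | dirty s]%SET|)%N);
    last by rewrite leq_add// leq_imset_card.
  apply: leq_trans (leq_card_setU _ _); apply: subset_leq_card.
  apply/fintype.subsetP => v; rewrite !inE => /existsP[s /andP[sd /orP[]/eqP <-]].
    by rewrite imset_f// inE.
  by rewrite [X in _ || X]imset_f ?orbT// inE.
apply: (@leq_trans (\sum_(v | affected v) (D.1 v + D.2 v))%N).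
  rewrite big_split /= addnC -!card_stubs.
  rewrite -[X in (_ <= _ + X)%N](on_card_preimset (f := m));
    last exact: onW_bij stub_bijection_bij.
  apply: leq_trans (leq_card_setU _ _); apply: subset_leq_card.
  by apply/fintype.subsetP => s; rewrite !inE.
apply: (@leq_trans (\sum_(v | affected v) (2 * K + ((D.1 v - K) + (D.2 v - K))))%N).
  by apply: leq_sum => v _; lia.
rewrite big_split /= leq_add//.
  rewrite sum_nat_const -cardsE.
  by apply: (leq_trans (leq_mul aff (leqnn _))); rewrite mulnACA mulnA mulnAC.
by rewrite [leqRHS](bigID affected) /= leq_addr.
Qed.

(** Without the restriction to ends of degree at most K, the expected numbers of loops and of double
    edges would involve second moments of the degrees; with it they are bounded by powers of K. *)
Definition light_loops K :=
  (\sum_s [&& tag (m s) == src s, D.2 (src s) <= K & D.1 (tag (m s)) <= K])%N.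

Definition light_doubles K :=
  (\sum_s \sum_(t | t != s) [&& src t == src s & D.2 (src s) <= K]
     * [&& tag (m t) == tag (m s) & D.1 (tag (m s)) <= K])%N.

(** A dirty stub either has a heavy end or enters the light counts. The cut is at 2K because d > 2K
    implies d <= 2 (d - K), so that the overflow beyond K controls all stubs of heavy vertices. *)
Lemma card_dirty K : (#|[set s | dirty s]%SET| <=
  2 * \sum_v ((D.1 v - K) + (D.2 v - K)) + (light_loops (2 * K) + light_doubles (2 * K)))%N.
Proof.
rewrite -sum1dep_card big_mkcond /=.
have heavy_le (d : V -> nat) :
    (\sum_(v | (2 * K < d v)%N) d v <= 2 * \sum_v (d v - K))%N.
  rewrite big_distrr [leqRHS](bigID (fun v => (2 * K < d v)%N)) /=.
  by rewrite -[leqLHS]addn0 leq_add// leq_sum// => v; lia.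
apply: (@leq_trans (\sum_s ((2 * K < D.2 (src s)) + (2 * K < D.1 (tgt s)) +
   ([&& tag (m s) == src s, D.2 (src s) <= 2 * K & D.1 (tag (m s)) <= 2 * K] +
    \sum_(t | t != s) [&& src t == src s & D.2 (src s) <= 2 * K]
     * [&& tag (m t) == tag (m s) & D.1 (tag (m s)) <= 2 * K])))%N).
  apply: leq_sum => s _; case: ifP => // /orP[|].
    move=> st; rewrite !addn_gt0 !lt0b eq_sym -/(tgt s) st /=.
    by rewrite !ltnNge; case: (D.2 _ <= _)%N; case: (D.1 _ <= _)%N.
  move=> /existsP[t /and3P[ts /eqP t1 /eqP t2]].
  rewrite (bigD1 t) //= t1 /= -/(tgt t) t2 /tgt !eqxx !addn_gt0 !lt0b /=.
  rewrite muln_gt0 !lt0b !ltnNge.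
  by case: (D.2 _ <= _)%N; case: (D.1 _ <= _)%N; rewrite ?orbT.
rewrite !big_split /= leq_add//.
have count_heavy (d : V -> nat) :
    (\sum_(s : {v : V & 'I_(d v)}) (2 * K < d (tag s)) <= 2 * \sum_v (d v - K))%N.
  apply: leq_trans (heavy_le d); rewrite -(card_stubs d (fun v => 2 * K < d v)%N).
  by rewrite -sum1dep_card [leqRHS]big_mkcond.
rewrite mulnDr addnC leq_add// ?count_heavy//.
have -> : (\sum_i (2 * K < D.1 (tgt i)) =
   \sum_(x : inbound_stub D) (2 * K < D.1 (tag x)))%N.
  by rewrite [RHS](reindex m)//; exact: onW_bij stub_bijection_bij.
exact: count_heavy.
Qed.

End Erasure.

(** * Averages over all stub bijections *)

Section RandomMatching.
Variables (V : finType) (D : bidegree V).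
Local Notation Out := (outbound_stub D).
Local Notation In := (inbound_stub D).
Local Notation Bij := (stub_bijections D).
Local Notation L := #|{: outbound_stub D}|.

Lemma card_outbound : L = (\sum_v D.2 v)%N.
Proof. by rewrite -cardsT -(card_stubs D.2 xpredT); apply: eq_card => s; rewrite !inE. Qed.

Lemma card_inbound : #|{: In}| = (\sum_v D.1 v)%N.
Proof. by rewrite -cardsT -(card_stubs D.1 xpredT); apply: eq_card => s; rewrite !inE. Qed.

Lemma perm_stub_bijections (p : {perm Out}) (m : {ffun Out -> In}) :
  ([ffun s => m (p s)] \in Bij) = (m \in Bij).
Proof.
rewrite !inE; congr (_ && _).
  apply/injectiveP/injectiveP => mI s t.
    by move=> st; apply: (can_inj (permKV p)); apply: mI; rewrite !ffunE !permKV.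
  by rewrite !ffunE => /mI; exact: perm_inj.
apply: eq_forallb => x; apply/codomP/codomP => -[s ->].
  by rewrite ffunE; exists (p s).
by exists (p^-1%g s); rewrite ffunE permKV.
Qed.

Lemma reindex_matching (p : {perm Out}) (F : {ffun Out -> In} -> nat) :
  (\sum_(m in Bij) F m = \sum_(m in Bij) F [ffun s => m (p s)])%N.
Proof.
pose h (q : {perm Out}) (m : {ffun Out -> In}) : {ffun Out -> In} := [ffun s => m (q s)].
have hK : cancel (h p) (h p^-1%g).
  by move=> m; apply/ffunP => s; rewrite !ffunE permKV.
rewrite (reindex_inj (can_inj hK)) /=.
by apply: eq_bigl => m; rewrite perm_stub_bijections.
Qed.

(** By exchangeability every stub gives the same sum, and for a fixed bijection the images of all
    stubs exhaust the inbound ones: [m s] is uniform. Denominators are cleared in order to stay in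
    [nat]. *)
Lemma sum_matching1 (f : In -> nat) s :
  (L * \sum_(m in Bij) f (m s) = #|Bij| * \sum_x f x)%N.
Proof.
transitivity (\sum_t \sum_(m in Bij) f (m t))%N.
  rewrite -sum_nat_const; apply: eq_bigr => t _.
  rewrite (reindex_matching (tperm s t)); apply: eq_bigr => m _.
  by rewrite ffunE tpermL.
rewrite exchange_big /= -sum_nat_const; apply: eq_bigr => m mB.
by rewrite [RHS](reindex m)//; exact: onW_bij (stub_bijection_bij mB).
Qed.

Lemma sum_matching2 (f : In -> In -> nat) s t : s != t ->
  (L * L.-1 * \sum_(m in Bij) f (m s) (m t) =
   #|Bij| * \sum_x \sum_(y | y != x) f x y)%N.
Proof.
move=> st.
transitivity (\sum_s' \sum_(t' | t' != s') \sum_(m in Bij) f (m s') (m t'))%N.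
  rewrite -mulnA -sum_nat_const; apply: eq_bigr => s' _.
  have -> : L.-1 = #|[pred t' | t' != s']|.
    by have := cardC1 s'; rewrite /= => <-; apply: eq_card.
  rewrite -sum_nat_const; apply: eq_bigr => t' t's'.
  (* The first transposition sends [s'] to [s]; the second brings the image of [t'] to [t] and fixes
     [s]. *)
  pose p := (tperm s' s * tperm (tperm s' s t') t)%g.
  rewrite [RHS](reindex_matching p); apply: eq_bigr => m _.
  have ps : p s' = s.
    rewrite permM tpermL tpermD 1?eq_sym//.
    by rewrite -{1}(tpermL s' s) (inj_eq (@perm_inj _ _)) eq_sym.
  have pt : p t' = t by rewrite permM tpermL.
  by rewrite !ffunE ps pt.
under eq_bigr => s' _ do rewrite exchange_big /=.
rewrite exchange_big -sum_nat_const /=; apply: eq_bigr => m mB.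
have mb := stub_bijection_bij mB.
rewrite [RHS](reindex m); last exact: onW_bij mb.
apply: eq_bigr => s' _; rewrite [RHS](reindex m); last exact: onW_bij mb.
by apply: eq_bigl => t'; rewrite (inj_eq (bij_inj mb)).
Qed.

Hypothesis bal : (\sum_v D.1 v = \sum_v D.2 v)%N.

Lemma sum_light (d : V -> nat) v K :
  (\sum_(x : {v : V & 'I_(d v)}) ((tag x == v) && (d (tag x) <= K)%N) <= K)%N.
Proof.
rewrite (sum_stubs d (fun w => (w == v) && (d w <= K)%N)).
rewrite (bigD1 v)//= eqxx /= big1 ?addn0.
  by case: (leqP (d v) K) => h; rewrite ?muln1 ?muln0.
by move=> w /negbTE ->; rewrite muln0.
Qed.

Lemma sum_light_loops K : (\sum_(m in Bij) light_loops m K <= #|Bij| * K)%N.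
Proof.
have [L0|L0] := posnP L.
  rewrite [leqLHS]big1// => m _; rewrite /light_loops big1// => s _.
  by have := max_card (pred1 s); rewrite card1 L0.
rewrite -(leq_pmul2l L0) mulnCA /light_loops exchange_big big_distrr /=.
rewrite -[(L * K)%N]sum_nat_const big_distrr /=.
apply: leq_sum => s _.
rewrite (sum_matching1 (fun x => [&& tag x == tag s, D.2 (tag s) <= K & D.1 (tag x) <= K]%N)).
rewrite leq_mul2l; apply/orP; right; apply: leq_trans (sum_light D.1 (tag s) K).
by apply: leq_sum => x _; case: (tag x == _) => //=; case: (D.2 _ <= _)%N => //=.
Qed.

(** There are at most L K pairs of outbound stubs with a common light source, and a given pair hits
    a common light target with probability at most K / (L - 1). *)
Lemma sum_light_doubles K :
  (L.-1 * \sum_(m in Bij) light_doubles m K <= #|Bij| * L * K ^ 2)%N.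
Proof.
have [L0|L0] := posnP L; first by rewrite L0.
rewrite -(leq_pmul2l L0) mulnA /light_doubles exchange_big big_distrr /=.
have -> : (L * (#|Bij| * L * K ^ 2) = L * K * (#|Bij| * (L * K)))%N by ring.
apply: (@leq_trans (\sum_(s : Out) K * (#|Bij| * (L * K)))%N); last first.
  by rewrite sum_nat_const mulnA.
apply: leq_sum => s _.
rewrite exchange_big big_distrr /=.
apply: (@leq_trans (\sum_(t : Out | t != s) ((tag t == tag s) && (D.2 (tag s) <= K))
    * (#|Bij| * (L * K)))%N); last first.
  rewrite -big_distrl leq_mul2r; apply/orP; right.
  apply: leq_trans (sum_light D.2 (tag s) K); rewrite [leqRHS](bigID (fun t => t != s)) /=.
  apply: leq_trans (leq_addr _ _); apply: leq_sum => t _.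
  by case: eqP => // ->.
apply: leq_sum => t ts; rewrite -big_distrr /= mulnCA leq_mul2l; apply/orP; right.
rewrite (sum_matching2 (fun x y => (tag y == tag x) && (D.1 (tag x) <= K)%N)); last first.
  by rewrite eq_sym.
rewrite leq_mul2l; apply/orP; right.
have -> : L = #|{: In}| by rewrite card_outbound card_inbound bal.
rewrite -sum_nat_const; apply: leq_sum => x _.
apply: leq_trans (sum_light D.1 (tag x) K); rewrite [leqRHS](bigID (fun t => t != x)) /=.
apply: leq_trans (leq_addr _ _); apply: leq_sum => y _.
by case: eqP => // ->.
Qed.

End RandomMatching.

Definition stub_degree (V : finType) (D : bidegree V) (sg : sign) (v : V) : nat :=
  if sg is Plus then D.2 v else D.1 v.

Definition overflow (V : finType) (D : bidegree V) (K : nat) : nat :=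
  (\sum_v ((D.1 v - K) + (D.2 v - K)))%N.

Section MatchingSums.
Context {R : realFieldType}.
Variables (V : finType) (D : bidegree V).
Local Notation Out := (outbound_stub D).
Local Notation In := (inbound_stub D).
Local Notation Bij := (stub_bijections D).
Local Notation L := (#|{: outbound_stub D}|%:R).
Variables (k : Out -> nat) (l : In -> nat).

Lemma kendall_matching_moment :
  \sum_(m in Bij) kendall_sum [set: Out]%SET k (fun s => l (m s)) ^+ 2
    <= #|Bij|%:R * (4 * L ^+ 3) :> R.
Proof.
have := @swap_second_moment R _ _ Bij [set: Out]%SET
  (fun s t x y => cmp (k s) (k t) * cmp (l x) (l y)) 1.
rewrite expr1n mulr1 cardsT; apply.
- by move=> s t m; rewrite perm_stub_bijections.
- by move=> s t y z; rewrite (cmpC (l z)) mulrN.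
- by move=> s t y z _ _; rewrite normrM mulr_ile1 ?cmp_norm.
Qed.

(** Since [m] is a bijection, the centred rank of [l (m s)] among all targets is a fixed function
    [B] of the inbound stub [m s]. The sum of [cmp (k s) (k t) * B (m s)] is unchanged when
    [B (m s)] is replaced by half of [B (m s) - B (m t)], and this form changes sign when the two
    targets are exchanged. *)
Lemma spearman_matching_moment :
  \sum_(m in Bij) spearman_sum [set: Out]%SET k (fun s => l (m s)) ^+ 2
    <= #|Bij|%:R * (4 * L ^+ 3 * L ^+ 2) :> R.
Proof.
case: (pickP (mem Bij)) => [m0 m0B|noB]; last first.
  by rewrite big_pred0// mulr_ge0// !mulr_ge0// exprn_ge0.
pose B x : R := csum [set: In]%SET l x.
have LI : #|{: In}|%:R = L.
  by rewrite (bij_eq_card (stub_bijection_bij m0B)).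
have BL x : `|B x| <= L.
  by have := @csum_norm R _ [set: In]%SET l x; rewrite cardsT LI.
have := @swap_second_moment R _ _ Bij [set: Out]%SET
  (fun s t x y => cmp (k s) (k t) * (2^-1 * (B x - B y))) L.
rewrite cardsT => h.
apply: le_trans (h _ _ _).
- rewrite le_eqVlt; apply/orP; left; apply/eqP; apply: eq_bigr => m mB.
  congr (_ ^+ 2).
  have csumE s : csum [set: Out]%SET (fun s => l (m s)) s = B (m s).
    rewrite /B /csum [RHS](reindex m); last exact: onW_bij (stub_bijection_bij mB).
    by apply: eq_bigl => t; rewrite !inE.
  transitivity (\sum_(s in [set: Out]%SET) \sum_(t in [set: Out]%SET) cmp (k s) (k t) * B (m s)).
    by apply: eq_bigr => s _; rewrite csumE mulr_suml.
  apply/eqP; rewrite -subr_eq0 -sumrB; apply/eqP.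
  under eq_bigr => s _ do rewrite -sumrB.
  rewrite (eq_bigr (fun s => \sum_(t in [set: Out]%SET)
     2^-1 * (cmp (k s) (k t) * (B (m s) + B (m t))))); last first.
    by move=> s _; apply: eq_bigr => t _; field.
  by apply: cmp_antisum => s t; rewrite (cmpC (k s)); ring.
- by move=> s t m; rewrite perm_stub_bijections.
- by move=> s t y z; ring.
- move=> s t y z _ _; rewrite normrM.
  rewrite -[leRHS]mul1r ler_pM ?cmp_norm// normrM ger0_norm ?invr_ge0//.
  have := le_trans (ler_normB (B y) (B z)) (lerD (BL y) (BL z)); lra.
Qed.

End MatchingSums.

(** The centred rank [a] depends on the value alone, and the elements at the two atoms separate
    [a k] from [a k'] by at least 2x. Hence the two squares sum to at least 2x^2, and each is taken
    at least x times. *)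
Lemma spearman_sum_lower {R : realFieldType} (T : finType) (E : {set T}) (D : T -> nat)
    (k k' : nat) (x : R) : k != k' -> 0 <= x ->
  x <= #|[set e in E | D e == k]%SET|%:R ->
  x <= #|[set e in E | D e == k']%SET|%:R ->
  2 * x ^+ 3 <= spearman_sum E D D.
Proof.
move=> kk' x0; wlog {kk'} kk' : k k' / (k < k')%N.
  by move=> h; case: (ltngtP k k') kk' => // kk' _ h1 h2; [exact: (h k k')|exact: (h k' k)].
move=> xk xk'.
have cnt i : \sum_(e in E) (D e == i)%:R = #|[set e in E | D e == i]%SET|%:R :> R.
  rewrite -sum1dep_card natr_sum big_mkcondr /=.
  by apply: eq_bigr => f _; case: eqP.
pose a (i : nat) : R := \sum_(f in E) cmp i (D f).
have aa : 2 * x <= a k - a k'.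
  apply: (@le_trans _ _ (\sum_(f in E) ((D f == k)%:R + (D f == k')%:R : R))).
    by rewrite big_split /= !cnt mulr_natl mulr2n lerD.
  rewrite /a -sumrB; apply: ler_sum => f _; rewrite /cmp.
  rewrite ![D f == _]eq_sym.
  by case: (ltngtP k (D f)) => h1; case: (ltngtP k' (D f)) => h2 /=;
    (lra || (exfalso; lia)).
have sq : 2 * x ^+ 2 <= a k ^+ 2 + a k' ^+ 2.
  have : (2 * x) ^+ 2 <= (a k - a k') ^+ 2 by rewrite lerXn2r// ?nnegrE; lra.
  have : 0 <= (a k + a k') ^+ 2 by exact: sqr_ge0.
  by nra.
have E2 : spearman_sum E D D = \sum_(e in E) a (D e) ^+ 2.
  by apply: eq_bigr => e _; rewrite expr2.
rewrite E2.
apply: (@le_trans _ _ (\sum_(e in E) ((D e == k)%:R * a k ^+ 2 + (D e == k')%:R * a k' ^+ 2))).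
  rewrite big_split /= -!mulr_suml.
  rewrite !cnt.
  apply: (@le_trans _ _ (x * (a k ^+ 2 + a k' ^+ 2))).
    by rewrite exprS mulrCA ler_wpM2l.
  by rewrite mulrDr lerD// ler_wpM2r// sqr_ge0.
apply: ler_sum => e _.
have := sqr_ge0 (a (D e)); case: (D e =P k) => [->|_] h0.
  by rewrite (ltn_eqF kk') /=; lra.
case: (D e =P k') => [h|_] /=; last lra.
by rewrite h; lra.
Qed.

(** The propositions [sp] and [tp] switch the lower bounds on the rank variances. They are taken
    [False] for the coefficients that make sense for concentrated laws, and [True] for the
    average-rank coefficient. *)
Record good_graph {R : realFieldType} {V : finType} (E : {set V * V})
    (alpha beta : sign) (N eta c : R) (sp tp : Prop) : Prop := GoodGraph {
  good_size : N <= #|E|%:R ;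
  good_kendall : `|kendall_sum E (src_degree E alpha) (tgt_degree E beta)|
    <= eta * #|E|%:R ^+ 2 ;
  good_spearman : `|spearman_sum E (src_degree E alpha) (tgt_degree E beta)|
    <= eta * #|E|%:R ^+ 3 ;
  good_src : sp -> c * #|E|%:R ^+ 3 <=
    spearman_sum E (src_degree E alpha) (src_degree E alpha) ;
  good_tgt : tp -> c * #|E|%:R ^+ 3 <=
    spearman_sum E (tgt_degree E beta) (tgt_degree E beta) }.

Lemma leq_double_pred q : (1 < q)%N -> (q <= 2 * q.-1)%N.
Proof. by case: q => // q; lia. Qed.

(** * Most matchings yield a good graph *)

Section BadMatchings.
Context {R : realFieldType}.
Variables (V : finType) (D : bidegree V) (alpha beta : sign).
Local Notation Out := (outbound_stub D).
Local Notation In := (inbound_stub D).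
Local Notation Bij := (stub_bijections D).
Local Notation L := (@GRing.natmul R 1 #|{: outbound_stub D}|).
Local Notation card A := (@GRing.natmul R 1 #|A|).
Let k (s : Out) := stub_degree D alpha (tag s).
Let l (x : In) := stub_degree D beta (tag x).
Variables (eta x : R) (K1 K2 : nat) (sp tp : Prop).

Hypothesis eta_gt0 : 0 < eta.
Hypothesis eta_le2 : eta <= 2^-1.
Hypothesis bal : (\sum_v D.1 v = \sum_v D.2 v)%N.
Hypothesis L2 : (2 <= #|{: outbound_stub D}|)%N.
Hypothesis over1 : (overflow D K1)%:R <= 3^-1 * eta * L.
Hypothesis over2 : (overflow D K2)%:R <= eta / (24 * K1.+1%:R) * L.
Hypothesis eta_x : 2 * eta <= x.
Hypothesis src_spread : sp -> exists i j, [/\ i != j,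
  x * L <= #|[set s | k s == i]%SET|%:R & x * L <= #|[set s | k s == j]%SET|%:R].
Hypothesis tgt_spread : tp -> exists i j, [/\ i != j,
  x * L <= #|[set y | l y == i]%SET|%:R & x * L <= #|[set y | l y == j]%SET|%:R].

Let Y (m : {ffun Out -> In}) : R :=
  (light_loops m (2 * K2) + light_doubles m (2 * K2))%N%:R.

Let Ks m : R := kendall_sum [set: Out]%SET k (fun s => l (m s)).
Let Ss m : R := spearman_sum [set: Out]%SET k (fun s => l (m s)).

(** The dirty stubs number at most 2 eta / (24 (K1 + 1)) + eta / (12 (K1 + 1)) = eta / (6 (K1 + 1))
    times L. Multiplied by 4 K1 this gives at most 2 eta / 3, and the overflow beyond K1 contributes
    the last third. *)
Lemma spoiled_few m : m \in Bij -> Y m <= eta / (12 * K1.+1%:R) * L ->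
  #|[set s | spoiled m s]%SET|%:R <= eta * L.
Proof.
move=> mB Ym.
have h1 := card_spoiled mB K1; have h2 := card_dirty mB K2.
have {}h2 : #|[set s | dirty m s]%SET|%:R <= 2 * (overflow D K2)%:R + Y m.
  by rewrite /Y -natrM -natrD ler_nat.
have {}h1 : #|[set s | spoiled m s]%SET|%:R <=
   4 * K1%:R * #|[set s | dirty m s]%SET|%:R + (overflow D K1)%:R :> R.
  by rewrite -!natrM -natrD ler_nat.
apply: le_trans h1 _.
have : 4 * K1%:R * #|[set s | dirty m s]%SET|%:R <= 2 / 3 * eta * L.
  apply: (@le_trans _ _ (4 * K1.+1%:R * (eta / (6 * K1.+1%:R) * L))).
    apply: ler_pM => //; first by rewrite ler_wpM2l// ler_nat.
    apply: (le_trans h2); apply: le_trans (lerD (ler_wpM2l _ over2) Ym) _ => //.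
    by rewrite le_eqVlt; apply/orP; left; apply/eqP; field.
  by rewrite le_eqVlt; apply/orP; left; apply/eqP; field.
by move: over1; lra.
Qed.

(** At least half of the stubs survive, so L <= 2 |E|. Spearman's sum costs eta L^3 for the matching
    and 6 eta L^3 for the erasure, and 7 * 8 = 56; Kendall's sum needs only 5 * 4. An atom loses at
    most eta L <= x L / 2 stubs, and 2 (x / 2)^3 is the lower bound. *)
Lemma good_matching m : m \in Bij -> Y m <= eta / (12 * K1.+1%:R) * L ->
  `|Ks m| <= eta * L ^+ 2 -> `|Ss m| <= eta * L ^+ 3 ->
  good_graph (erased_edges (to_stub_map m)) alpha beta (L / 2) (56 * eta)
    (4^-1 * x ^+ 3) sp tp.
Proof.
move=> mB Ym Km Sm; set E := erased_edges _.
have sf := spoiled_few mB Ym.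
have EL : card E <= L  by rewrite ler_nat; exact: card_erased.
pose H := [set s | ~~ spoiled m s]%SET.
have HE : L - card H <= eta * L.
  apply: le_trans sf; rewrite lerBlDr -natrD ler_nat.
  have -> : H = (~: [set s | spoiled m s])%SET by apply/setP => s; rewrite !inE.
  by rewrite cardsC.
have cleanH s : s \in H -> ~~ dirty m s.
  rewrite inE /spoiled negb_or => /andP[/unaffected_clean h _]; apply: h.
  by rewrite eqxx.
have phiI : {in H &, injective (stub_edge m)}.
  by move=> s t /cleanH sc _; exact: clean_stub_edge_inj.
have phiE s : s \in H -> stub_edge m s \in E.
  by move=> /cleanH; exact: clean_stub_edge.
have kE s : s \in H -> src_degree E alpha (stub_edge m s) = k s.
  rewrite inE /spoiled negb_or => /andP[a1 _].
  by rewrite /src_degree (degree_unaffected mB).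
have lE s : s \in H -> tgt_degree E beta (stub_edge m s) = l (m s).
  rewrite inE /spoiled negb_or => /andP[_ a1].
  by rewrite /tgt_degree (degree_unaffected mB).
have HleE : card H <= card E .
  rewrite ler_nat -(card_in_imset phiI) subset_leq_card//.
  by apply/fintype.subsetP => _ /imsetP[s sH ->]; exact: phiE.
have L0 : 0 < L  by rewrite ltr0n (leq_trans _ L2).
have EL2 : L / 2 <= card E.
  have : eta * L <= 2^-1 * L by rewrite ler_wpM2r// ltW.
  by lra.
have spread (T : finType) (f : T -> nat) (g : V * V -> nat) (F : Out -> T) :
    bijective F -> (forall s, s \in H -> g (stub_edge m s) = f (F s)) ->
    (exists i j, [/\ i != j,
  x * L <= #|[set s | f s == i]%SET|%:R & x * L <= #|[set s | f s == j]%SET|%:R]) ->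
    4^-1 * x ^+ 3 * card E ^+ 3 <= spearman_sum E g g.
  move=> Fbij gf [i [j [ij xi xj]]].
  have low a : x * L <= #|[set s | f s == a]%SET|%:R ->
      x / 2 * L <= #|[set e in E | g e == a]%SET|%:R.
    move=> xa.
    have : #|[set s | f s == a]%SET|%:R <= #|[set e in E | g e == a]%SET|%:R + (L - card H).
      rewrite addrA lerBrDr -!natrD ler_nat addnC.
      rewrite -[X in (_ + X <= _)%N](on_card_preimset (f := F)); last exact: onW_bij.
      rewrite -cardsUI addnC leq_add ?max_card//.
      rewrite -(@card_in_imset _ _ (stub_edge m)); last first.
        by move=> s t; rewrite finset.in_setI => /andP[sH _]; rewrite finset.in_setI => /andP[tH _]; exact: phiI.
      apply: subset_leq_card; apply/fintype.subsetP => _ /imsetP[s + ->].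
      rewrite finset.in_setI => /andP[sH sa]; apply/finset.setIdP.
      by split; [exact: phiE|move: sa; rewrite !inE gf].
    have : 2 * eta * L <= x * L by rewrite ler_wpM2r// ltW.
    by lra.
  have x0 : 0 <= x by rewrite (le_trans _ eta_x)// mulr_ge0// ltW.
  have := spearman_sum_lower ij _ (low i xi) (low j xj).
  rewrite mulr_ge0 ?divr_ge0 ?(ltW L0)// => /(_ isT); apply: le_trans.
  rewrite !exprMn exprVn.
  have -> : 2 * (x ^+ 3 * (2 ^+ 3)^-1 * L ^+ 3) = 4^-1 * x ^+ 3 * L ^+ 3 by field.
  apply: ler_wpM2l; first by rewrite mulr_ge0 ?invr_ge0 ?exprn_ge0.
  by apply: lerXn2r; rewrite ?nnegrE ?ler0n.
have E0 : 0 <= card E  by [].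
have LE : L <= 2 * card E by rewrite mulrC -ler_pdivrMr.
have LE2 : L ^+ 2 <= 4 * card E ^+ 2.
  rewrite (_ : 4 * _ = (2 * card E) ^+ 2); last by ring.
  by apply: lerXn2r; rewrite ?nnegrE ?mulr_ge0 ?ler0n.
have LE3 : L ^+ 3 <= 8 * card E ^+ 3.
  rewrite (_ : 8 * _ = (2 * card E) ^+ 3); last by ring.
  by apply: lerXn2r; rewrite ?nnegrE ?mulr_ge0 ?ler0n.
have dist (A B e M : R) : `|A - B| <= M -> `|B| <= e -> `|A| <= e + M.
  by move=> AB Be; rewrite -(subrK B A) addrC (le_trans (ler_normD _ _))// lerD.
split=> //.
- have h := @kendall_sum_embed R _ _ _ _ _ _ _ _ _ phiI phiE (card_erased m) kE lE.
  apply: (le_trans (dist _ _ _ _ h Km)).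
  have : 4 * L * (L - card H) <= 4 * L * (eta * L) by rewrite ler_wpM2l// mulr_ge0// ltW.
  have : eta * L ^+ 2 <= eta * (4 * card E ^+ 2) by rewrite ler_wpM2l// ltW.
  have : 0 <= eta * card E ^+ 2 by rewrite mulr_ge0// ?exprn_ge0// ltW.
  by lra.
- have h := @spearman_sum_embed R _ _ _ _ _ _ _ _ _ phiI phiE (card_erased m) kE lE.
  apply: (le_trans (dist _ _ _ _ h Sm)).
  have : 6 * L ^+ 2 * (L - card H) <= 6 * L ^+ 2 * (eta * L).
    by rewrite ler_wpM2l// mulr_ge0// exprn_ge0// ltW.
  have : eta * L ^+ 3 <= eta * (8 * card E ^+ 3) by rewrite ler_wpM2l// ltW.
  by lra.
- have idb : bijective (@id Out) by exists id.
  by move=> /src_spread; exact: (spread _ k _ id idb kE).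
- by move=> /tgt_spread; exact: (spread _ l _ m (stub_bijection_bij mB) lE).
Qed.

(** Chebyshev's inequality gives 4 / (eta^2 L) for each of the two sums. The light counts at level 2
    K2 have mean at most 2 K2 + 8 K2^2, where L / (L - 1) <= 2 is used, and Markov's inequality
    applies to them. *)
Lemma bad_matchings :
  card [set m in Bij | ~~ `[< good_graph (erased_edges (to_stub_map m)) alpha beta
     (L / 2) (56 * eta) (4^-1 * x ^+ 3) sp tp >]]%SET
  <= card Bij * ((8 / eta ^+ 2 + (2 * K2%:R + 8 * K2%:R ^+ 2) *
        (12 * K1.+1%:R) / eta) / L).
Proof.
have L0 : 0 < L by rewrite ltr0n (leq_trans _ L2).
have e0 : 0 < eta / (12 * K1.+1%:R) by rewrite divr_gt0// mulr_gt0.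
pose B1 := [set m in Bij | eta / (12 * K1.+1%:R) * L < Y m]%SET.
pose B2 := [set m in Bij | eta * L ^+ 2 < `|Ks m|]%SET.
pose B3 := [set m in Bij | eta * L ^+ 3 < `|Ss m|]%SET.
have b1 : card B1 <= card Bij * (2 * K2%:R + 8 * K2%:R ^+ 2)
    / (eta / (12 * K1.+1%:R) * L).
  apply: card_markov; [by rewrite mulr_gt0| |by []].
  have h1 := sum_light_loops D (2 * K2); have h2 := sum_light_doubles bal (2 * K2).
  rewrite -natr_sum -natrX -!natrM -natrD -natrM ler_nat big_split /=.
  rewrite mulnDr leq_add//.
  have Lp : (0 < #|{: outbound_stub D}|.-1)%N by rewrite -subn1 subn_gt0.
  rewrite -(leq_pmul2l Lp); apply: (leq_trans h2).
  apply: (leq_trans (leq_mul (leq_mul (leqnn _) (leq_double_pred L2)) (leqnn _))).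
  by rewrite leq_eqVlt; apply/orP; left; apply/eqP; ring.
have b2 : card B2 <= card Bij * (4 * L ^+ 3) / (eta * L ^+ 2) ^+ 2.
  apply: card_chebyshev; first by rewrite mulr_gt0// exprn_gt0.
  exact: kendall_matching_moment.
have b3 : card B3 <= card Bij * (4 * L ^+ 3 * L ^+ 2) / (eta * L ^+ 3) ^+ 2.
  apply: card_chebyshev; first by rewrite mulr_gt0// exprn_gt0.
  exact: spearman_matching_moment.
set B := [set m in Bij | _]%SET.
have cB : card B <= card B1 + card B2 + card B3.
  rewrite -!natrD ler_nat.
  apply: (@leq_trans #|B1 :|: B2 :|: B3|); last first.
    apply: leq_trans (leq_card_setU _ _) _; rewrite leq_add2r; exact: leq_card_setU.
  apply: subset_leq_card; apply/fintype.subsetP => m /finset.setIdP[mB /asboolPn bad].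
  have inB (P : pred {ffun Out -> In}) : (m \in [set m in Bij | P m]%SET) = P m.
    by rewrite finset.in_set mB.
  rewrite !finset.in_setU !inB !ltNge -!negb_and.
  by apply/negP => /andP[/andP[a1 a2] a3]; apply: bad; exact: good_matching.
apply: (le_trans cB); apply: le_trans (lerD (lerD b1 b2) b3) _.
by rewrite le_eqVlt; apply/orP; left; apply/eqP; field; rewrite !gt_eqF// ?mulr_gt0//.
Qed.

End BadMatchings.

(** * Breaking ties by independent uniform marks *)

Section TieBreaking.
Context {R : realFieldType}.
Variables (T : finType) (E : {set T}) (M : nat).
Local Notation ties := {ffun T -> 'I_M}.
Local Notation m := (@GRing.natmul R 1 #|E|).

(** The lexicographic order on (degree, mark), encoded in base [M] so that the sums for
    natural-number scores apply unchanged. *)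
Definition tie_value (D : T -> nat) (b : ties) (e : T) : nat := (D e * M + b e)%N.

Lemma tie_value_lt (D : T -> nat) (b : ties) e f :
  (tie_value D b e < tie_value D b f)%N =
  ((D e < D f) || ((D e == D f) && (b e < b f)))%N.
Proof.
rewrite /tie_value; have be := ltn_ord (b e); have bf := ltn_ord (b f).
case: (ltngtP (D e) (D f)) => [h|h|->] /=; last by rewrite ltn_add2l.
  have := leq_mul h (leqnn M); rewrite mulSn; lia.
have := leq_mul h (leqnn M); rewrite mulSn; lia.
Qed.

Lemma tie_value_cmp (D : T -> nat) (b : ties) e f :
  cmp (tie_value D b e) (tie_value D b f) =
  cmp (D e) (D f) + (D e == D f)%:R * cmp (b e) (b f) :> R.
Proof.
rewrite /cmp !tie_value_lt [D f == _]eq_sym.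
by case: (ltngtP (D e) (D f)) => _ /=; ring.
Qed.

Lemma spearman_sumC (D D' : T -> nat) : spearman_sum E D D' = spearman_sum E D' D :> R.
Proof. by apply: eq_bigr => e _; rewrite mulrC. Qed.

(** The change is a sum over tied pairs of [cmp (b e) (b f)] times the centred rank [c e] of the
    other score. Antisymmetrizing in [c] leaves a factor c e - c f, and exchanging the marks of e
    and f negates the term. All mark functions are admissible, so the family is invariant. *)
Lemma tie_noise_moment (D v : T -> nat) :
  \sum_(b in [set: ties]%SET)
     (spearman_sum E (tie_value D b) v - spearman_sum E D v) ^+ 2
  <= #|{: ties}|%:R * (4 * m ^+ 3 * m ^+ 2) :> R.
Proof.
pose c e : R := csum E v e.
have := @swap_second_moment R _ _ [set: ties]%SET E
  (fun e f y z => (D e == D f)%:R * cmp y z * (2^-1 * (c e - c f))) m.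
rewrite cardsT => h; apply: le_trans (h _ _ _) => {h}.
- rewrite le_eqVlt; apply/orP; left; apply/eqP; apply: eq_bigr => b _.
  congr (_ ^+ 2).
  transitivity (\sum_(e in E) \sum_(f in E) (D e == D f)%:R * cmp (b e) (b f) * c e).
    rewrite /spearman_sum -sumrB; apply: eq_bigr => e _.
    rewrite -mulrBl -mulr_suml; congr (_ * _); rewrite /csum -sumrB.
    by apply: eq_bigr => f _; rewrite tie_value_cmp addrC addKr.
  apply/eqP; rewrite -subr_eq0 -sumrB; apply/eqP.
  under eq_bigr => s _ do rewrite -sumrB.
  rewrite (eq_bigr (fun e => \sum_(f in E)
     2^-1 * ((D e == D f)%:R * cmp (b e) (b f) * (c e + c f)))); last first.
    by move=> e _; apply: eq_bigr => f _; field.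
  apply: cmp_antisum => e f; rewrite (cmpC (b e)) [D e == _]eq_sym; ring.
- by move=> e f b; rewrite !inE.
- by move=> e f y z; rewrite (cmpC z); ring.
- move=> e f y z _ _; rewrite normrM.
  rewrite -[leRHS]mul1r ler_pM//.
    rewrite normrM mulr_ile1 ?cmp_norm//.
    by case: (_ == _); rewrite ?normr1 ?normr0.
  rewrite normrM ger0_norm ?invr_ge0//.
  have := le_trans (ler_normB (c e) (c f))
    (lerD (csum_norm E v e) (csum_norm E v f)); lra.
Qed.

(** Ties are broken on one side at a time. When the source ties are broken by [p.2], the target
    scores already carry the marks [p.1]; these are frozen, which is why the previous bound allows
    an arbitrary second score. *)
Lemma tie_breaking (D D' : T -> nat) (t : R) : 0 < m -> 0 < t ->
  #|[set p : ties * ties | 2 * t * m ^+ 3 <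
      `|spearman_sum E (tie_value D p.2) (tie_value D' p.1) - spearman_sum E D D'|]%SET|%:R
  <= #|{: ties * ties}|%:R * (8 / (t ^+ 2 * m)).
Proof.
move=> m0 t0.
pose bad (d v : T -> nat) := [set b in [set: ties]%SET | t * m ^+ 3 <
  `|@spearman_sum R _ E (tie_value d b) v - spearman_sum E d v|]%SET.
have badle d v : #|bad d v|%:R <= #|{: ties}|%:R * (4 / (t ^+ 2 * m)) :> R.
  have tm : 0 < t * m ^+ 3 by rewrite mulr_gt0// exprn_gt0.
  apply: (le_trans (card_chebyshev tm (tie_noise_moment d v))).
  by rewrite le_eqVlt; apply/orP; left; apply/eqP; field; rewrite !gt_eqF.
pose B1 := [set p : ties * ties | p.2 \in bad D (tie_value D' p.1)]%SET.
pose B2 := [set p : ties * ties | p.1 \in bad D' D]%SET.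
have cN : #|{: ties * ties}|%:R = #|{: ties}|%:R * #|{: ties}|%:R :> R.
  by rewrite card_prod natrM.
have c1 : #|B1|%:R <= #|{: ties * ties}|%:R * (4 / (t ^+ 2 * m)) :> R.
  rewrite -sum1dep_card -(pair_big_dep xpredT (fun a b => b \in bad D (tie_value D' a)) (fun _ _ => 1%N)) /=.
  rewrite natr_sum cN -mulrA.
  apply: (@le_trans _ _ (\sum_(a : ties) #|{: ties}|%:R * (4 / (t ^+ 2 * m)))); last first.
    by rewrite sumr_const -[leLHS]mulr_natl.
  apply: ler_sum => a _.
  by rewrite sum1_card.
have c2 : #|B2|%:R <= #|{: ties * ties}|%:R * (4 / (t ^+ 2 * m)) :> R.
  have -> : B2 = finset.setX (bad D' D) [set: ties]%SET.
    by apply/setP => -[a b]; rewrite finset.in_set finset.in_setX finset.in_setT andbT.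
  by rewrite cardsX cardsT natrM cN mulrC -mulrA ler_wpM2l.
apply: (@le_trans _ _ (#|B1|%:R + #|B2|%:R)); last first.
  by apply: (le_trans (lerD c1 c2)); lra.
rewrite -natrD ler_nat; apply: leq_trans (leq_card_setU _ _).
apply: subset_leq_card; apply/fintype.subsetP => -[a b].
rewrite !inE /=; apply: contraTT; rewrite negb_or -!leNgt => /andP[h1 h2].
rewrite -(subrK (spearman_sum E D (tie_value D' a)) (spearman_sum E (tie_value D b) _)).
rewrite -addrA; apply: (le_trans (ler_normD _ _)).
rewrite (spearman_sumC D (tie_value D' a)) in h1 *.
rewrite (spearman_sumC D D') -mulrA.
lra.
Qed.

End TieBreaking.

(** * Probability *)

Section RealProbability.
Context {R : realType} {d : measure_display} {Omega : measurableType d}.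
Variable P : probability Omega R.
Implicit Types A B : set Omega.

Definition pr A : R := fine (P A).

Lemma prE A : measurable A -> P A = (pr A)%:E.
Proof. by move=> mA; rewrite /pr fineK// fin_num_measure. Qed.

Lemma pr_ge0 A : 0 <= pr A.
Proof. by rewrite /pr fine_ge0. Qed.

Lemma prT : pr setT = 1.
Proof. by rewrite /pr probability_setT. Qed.

Lemma pr0 : pr set0 = 0.
Proof. by rewrite /pr measure0. Qed.

Lemma pr_le A B : measurable A -> measurable B -> A `<=` B -> pr A <= pr B.
Proof.
by move=> mA mB AB; rewrite -lee_fin -!prE//; apply: le_measure; rewrite ?inE.
Qed.

Lemma pr_le1 A : measurable A -> pr A <= 1.
Proof. by move=> mA; rewrite -prT; exact: pr_le. Qed.

Lemma prU_le A B : measurable A -> measurable B -> pr (A `|` B) <= pr A + pr B.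
Proof.
move=> mA mB; rewrite -lee_fin EFinD -!prE//; last exact: measurableU.
exact: measureU2.
Qed.

Lemma prDI A B : measurable A -> measurable B -> pr A = pr (A `\` B) + pr (A `&` B).
Proof.
move=> mA mB; apply: EFin_inj; rewrite EFinD -!prE//.
- exact: measureDI.
- exact: measurableI.
- exact: measurableD.
Qed.

Lemma prC A : measurable A -> pr (~` A) = 1 - pr A.
Proof.
move=> mA; rewrite -prT (prDI measurableT mA) setTI setTD; ring.
Qed.

Lemma measurable_exists_in (I : eqType) (s : seq I) (F : I -> set Omega) :
  (forall i, measurable (F i)) -> measurable [set w | exists2 i, i \in s & F i w].
Proof.
move=> mF; elim: s => [|i s IH].
  rewrite (_ : mkset _ = set0); first exact: measurable0.
  by apply/seteqP; split => // w [].
rewrite (_ : mkset _ = F i `|` [set w | exists2 i, i \in s & F i w]).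
  exact: measurableU.
apply/seteqP; split => w /=.
  move=> [j]; rewrite inE => /orP[/eqP -> ?|js Fj]; [by left|right].
  by exists j.
by case=> [Fi|[j js Fj]]; [exists i|exists j]; rewrite ?inE ?eqxx ?js ?orbT.
Qed.

Lemma exists_in_cons (I : eqType) (i : I) (s : seq I) (F : I -> set Omega) :
  [set w | exists2 j, j \in i :: s & F j w]
  = F i `|` [set w | exists2 j, j \in s & F j w].
Proof.
apply/seteqP; split => w /=.
  move=> [j]; rewrite inE => /orP[/eqP -> ?|js Fj]; [by left|right].
  by exists j.
by case=> [Fi|[j js Fj]]; [exists i|exists j]; rewrite ?inE ?eqxx ?js ?orbT.
Qed.

Lemma pr_exists_le (I : eqType) (s : seq I) (F : I -> set Omega) :
  (forall i, measurable (F i)) ->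
  pr [set w | exists2 i, i \in s & F i w] <= \sum_(i <- s) pr (F i).
Proof.
move=> mF; elim: s => [|i s IH].
  rewrite big_nil (_ : mkset _ = set0) ?pr0//.
  by apply/seteqP; split => // w [].
rewrite exists_in_cons big_cons; apply: le_trans (prU_le _ _) _ => //.
  exact: measurable_exists_in.
by rewrite lerD2l.
Qed.

Lemma pr_exists_disjoint (I : eqType) (s : seq I) (F : I -> set Omega) :
  (forall i, measurable (F i)) -> uniq s ->
  (forall i j w, i != j -> F i w -> F j w -> False) ->
  pr [set w | exists2 i, i \in s & F i w] = \sum_(i <- s) pr (F i).
Proof.
move=> mF + FD; elim: s => [_|i s IH /= /andP[iN us]].
  rewrite big_nil (_ : mkset _ = set0) ?pr0//.
  by apply/seteqP; split => // w [].
rewrite exists_in_cons big_cons -IH//; apply: EFin_inj.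
have mS := measurable_exists_in s mF.
rewrite EFinD -!prE//; last exact: measurableU.
apply: measureU => //; apply/seteqP; split => // w [Fi [j js Fj]].
by apply: (FD i j w) => //; apply: contraNneq iN => ->.
Qed.

(** Bidegrees, stub maps and graphs are countable types considered without a sigma-algebra;
    measurable fibres then make every preimage measurable. *)
Definition countably_measurable (T : Type) (X : Omega -> T) :=
  forall t, measurable (X @^-1` [set t]).

Lemma countably_measurable_preimage (T : countType) (X : Omega -> T) (B : set T) :
  countably_measurable X -> measurable (X @^-1` B).
Proof.
move=> mX; rewrite (_ : _ @^-1` _ = \bigcup_t (if `[< B t >] then X @^-1` [set t] else set0)).
  apply: countable_bigcupT_measurable; first exact: countableP.
  by move=> t; case: ifP.
apply/seteqP; split => w /=.
  by move=> Bw; exists (X w) => //; case: asboolP.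
by move=> [t _]; case: asboolP => // Bt /= ->.
Qed.

Lemma countably_measurable_comp (T : countType) (U : Type) (X : Omega -> T) (f : T -> U) :
  countably_measurable X -> countably_measurable (f \o X).
Proof.
by move=> mX u; rewrite comp_preimage; exact: countably_measurable_preimage.
Qed.

(** The law of total probability over the countably many values of [X]. Conditional bounds are
    stated as products, so that values of probability zero need no separate treatment. *)
Lemma pr_disintegrate (T : countType) (X : Omega -> T) A (B : set T) (c : R) :
  countably_measurable X -> measurable A -> 0 <= c ->
  (forall t, B t -> pr (X @^-1` [set t] `&` A) <= pr (X @^-1` [set t]) * c) ->
  pr (X @^-1` B `&` A) <= c.
Proof.
move=> mX mA c0 H.
have mXB (C : set T) : measurable (X @^-1` C) by exact: countably_measurable_preimage.
pose F n := X @^-1` [set t | B t /\ choice.pickle t = n] `&` A.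
pose G n := X @^-1` [set t | choice.pickle t = n].
have -> : X @^-1` B `&` A = \bigcup_n F n.
  apply/seteqP; split => w /=.
    by move=> [Bw Aw]; exists (choice.pickle (X w)).
  by move=> [n _ [[]]].
have GT : setT = \bigcup_n G n.
  by apply/seteqP; split => w //= _; exists (choice.pickle (X w)).
have mF n : measurable (F n) by exact: measurableI.
have tF : trivIset setT F.
  by apply/trivIsetP => i j _ _ /eqP ij; apply/seteqP; split=> // w [[[_ wi] _] [[_ wj] _]];
    apply: ij; rewrite -wi -wj.
have tG : trivIset setT G.
  by apply/trivIsetP => i j _ _ /eqP ij; apply/seteqP; split=> // w [wi wj];
    apply: ij; rewrite -wi -wj.
rewrite -lee_fin -prE; last exact: bigcupT_measurable.
rewrite measure_bigcup//.
have Gsum : (\sum_(0 <= i <oo | i \in [set: nat]) P (G i) = 1)%E.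
  have := @measure_bigcup _ _ _ P setT G (fun i _ => mXB _) tG.
  by move=> <-; rewrite -GT; exact: probability_setT.
apply: (@le_trans _ _ (\sum_(0 <= i <oo | i \in [set: nat]) (c%:E * P (G i)))%E); last first.
  by rewrite nneseriesZl// Gsum mule1.
apply: lee_nneseries => // n _.
have [[t [Bt <-]]|no] := pselect (exists t, B t /\ choice.pickle t = n).
  have -> : F (choice.pickle t) = X @^-1` [set t] `&` A.
    apply/seteqP; split => w; rewrite /F /=.
      by move=> [[_ /(pcan_inj choice.pickleK)]].
    by move=> [-> Aw].
  have -> : G (choice.pickle t) = X @^-1` [set t].
    by apply/seteqP; split => w; rewrite /G /=; [move=> /(pcan_inj choice.pickleK)|move=> ->].
  have mXA : measurable (X @^-1` [set t] `&` A) by exact: measurableI.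
  have := H t Bt; rewrite -lee_fin EFinM -(prE mXA) -(prE (mX t)) muleC; exact.
have -> : F n = set0.
  by apply/seteqP; split => // w [[Bw] Xn _]; apply: no; exists (X w).
by rewrite measure0 mule_ge0.
Qed.

(* The hypotheses say that, on the event [A], the conditional law of [Y] is
   uniform on the finite set [f @: S]. *)
Lemma pr_uniform_choice (T : Type) (Z : finType) (Y : Omega -> T) (f : Z -> T)
    (S : {set Z}) A (Q : set T) :
  (forall Q, measurable (Y @^-1` Q)) -> measurable A -> injective f ->
  (0 < #|S|)%N ->
  (forall z, z \in S -> pr (A `&` Y @^-1` [set f z]) = pr A / #|S|%:R) ->
  pr (A `&` Y @^-1` Q) <= pr A * (#|[set z in S | `[< Q (f z) >]]%SET|%:R / #|S|%:R).
Proof.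
move=> mY mA fI S0 AS.
pose F z := A `&` Y @^-1` [set f z].
have mF z : measurable (F z) by exact: measurableI.
have FD i j w : i != j -> F i w -> F j w -> False.
  by rewrite /F /= => /eqP ij [_ Yi] [_ Yj]; apply: ij; apply: fI; rewrite -Yi.
pose U (S' : {set Z}) := [set w | exists2 z, z \in enum S' & F z w].
have prU' (S' : {set Z}) : S' \subset S -> pr (U S') = pr A * (#|S'|%:R / #|S|%:R).
  move=> /fintype.subsetP S'S; rewrite /U pr_exists_disjoint ?enum_uniq//.
  rewrite big_enum /= (eq_bigr (fun _ => pr A / #|S|%:R)); last by move=> z /S'S /AS.
  by rewrite sumr_const -[LHS]mulr_natl; ring.
have mU S' : measurable (U S') by exact: measurable_exists_in.
have US : pr (A `\` U S) = 0.
  have := prDI mA (mU S).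
  have -> : A `&` U S = U S.
    by apply/seteqP; split=> [w []|w Uw] //; split=> //; case: Uw => z _ [].
  rewrite (prU' S)// divff ?pnatr_eq0 -?lt0n// mulr1 => /eqP.
  by rewrite -subr_eq subrr eq_sym => /eqP.
rewrite -(prU' [set z in S | `[< Q (f z) >]]%SET); last first.
  by apply/fintype.subsetP => z; rewrite inE => /andP[].
rewrite -[leRHS]addr0 -US.
apply: le_trans (prU_le _ _); last 2 first.
- exact: mU.
- exact: measurableD.
apply: pr_le; [exact: measurableI|by apply: measurableU => //; exact: measurableD|].
move=> w [Aw Qw].
have [[z zS Fz]|no] := pselect (U S w); [left|by right].
exists z => //; move: zS; rewrite !mem_enum inE => -> /=.
by apply/asboolP; case: Fz => _ /= <-.
Qed.

End RealProbability.

Section Moments.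
Context {R : realType} {d : measure_display} {Omega : measurableType d}.
Variable P : probability Omega R.

Lemma measurable_EFin_fun (f : Omega -> R) :
  measurable_fun setT f -> measurable_fun setT (fun w => (f w)%:E).
Proof. by move=> mf; apply/measurable_EFinP. Qed.

Lemma integral_pr (B : set Omega) :
  measurable B -> (\int[P]_w (\1_B w)%:E = (pr P B)%:E)%E.
Proof. by move=> mB; rewrite integral_indic// setIT; exact: prE. Qed.

Lemma pr_markov (f : Omega -> R) (t M : R) :
  measurable_fun setT f -> (forall w, 0 <= f w) -> 0 < t ->
  (\int[P]_w (f w)%:E <= M%:E)%E -> pr P [set w | t <= f w] <= M / t.
Proof.
move=> mf f0 t0 fM.
have mA : measurable [set w | t <= f w].
  rewrite (_ : mkset _ = f @^-1` `[t, +oo[%classic).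
    by rewrite -[X in measurable X]setTI; exact: mf.
  by apply/seteqP; split=> w /=; rewrite in_itv /= andbT.
rewrite ler_pdivlMr// mulrC -lee_fin EFinM; apply: le_trans fM.
rewrite -integral_pr// -ge0_integralZl_EFin//; last 2 first.
- by apply: measurable_EFin_fun; exact: measurable_indic.
- exact: ltW.
apply: ge0_le_integral => //.
- by move=> w _; rewrite -EFinM lee_fin mulr_ge0// ltW.
- by apply: emeasurable_funM => //; apply: measurable_EFin_fun; exact: measurable_indic.
- exact: measurable_EFin_fun.
move=> w _; rewrite -EFinM lee_fin indicE.
case: (boolP (w \in [set w | t <= f w])); rewrite ?inE/= ?mulr1//.
by rewrite mulr0.
Qed.

Lemma pr_chebyshev (Z : Omega -> R) (t c s : R) :
  measurable_fun setT Z -> (forall w, 0 <= Z w) -> 0 < t ->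
  (\int[P]_w (Z w)%:E = c%:E)%E ->
  (\int[P]_w (Z w ^+ 2)%:E <= (s + c ^+ 2)%:E)%E ->
  pr P [set w | t <= `|Z w - c|] <= s / t ^+ 2.
Proof.
move=> mZ Z0 t0 Zc Zs.
have c0 : 0 <= c.
  by rewrite -lee_fin -Zc; apply: integral_ge0 => w _; rewrite lee_fin.
have mZ2 : measurable_fun setT (fun w => Z w ^+ 2) by exact: measurable_funX.
have mZc : measurable_fun setT (fun w => (Z w - c) ^+ 2).
  by apply: measurable_funX; exact: measurable_funB.
have -> : [set w | t <= `|Z w - c|] = [set w | t ^+ 2 <= (Z w - c) ^+ 2].
  apply/seteqP; split => w /=; rewrite -(real_normK (num_real (Z w - c))).
    by move=> h; apply: lerXn2r; rewrite ?nnegrE// ltW.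
  by rewrite ler_pXn2r ?nnegrE// ltW.
apply: pr_markov => //.
- by move=> w; exact: sqr_ge0.
- by rewrite exprn_gt0.
(* (Z - c)^2 + 2 c Z = Z^2 + c^2, with all four terms nonnegative *)
have key : (\int[P]_w ((Z w - c) ^+ 2)%:E + (2 * c * c)%:E
    = \int[P]_w (Z w ^+ 2)%:E + (c ^+ 2)%:E)%E.
  rewrite [X in (_ + X)%E](_ : _ = \int[P]_w ((2 * c)%:E * (Z w)%:E))%E; last first.
    rewrite ge0_integralZl_EFin//; last 3 first.
    - by move=> w _; rewrite lee_fin.
    - exact: measurable_EFin_fun.
    - by rewrite mulr_ge0.
    by rewrite Zc EFinM.
  rewrite [X in (_ = _ + X)%E](_ : _ = \int[P]_w (c ^+ 2)%:E)%E; last first.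
    rewrite integral_cst// [X in (_ * X)%E](_ : _ = 1%E) ?mule1//.
    exact: probability_setT.
  have h1 w : [set: Omega] w -> (0 <= ((Z w - c) ^+ 2)%:E)%E.
    by rewrite lee_fin sqr_ge0.
  have h2 w : [set: Omega] w -> (0 <= (2 * c)%:E * (Z w)%:E)%E.
    by rewrite -EFinM lee_fin !mulr_ge0.
  have h3 w : [set: Omega] w -> (0 <= (Z w ^+ 2)%:E)%E by rewrite lee_fin sqr_ge0.
  have h4 w : [set: Omega] w -> (0 <= (c ^+ 2)%:E)%E by rewrite lee_fin sqr_ge0.
  have m1 := measurable_EFin_fun mZc; have m3 := measurable_EFin_fun mZ2.
  have m2 : measurable_fun setT (fun w => (2 * c)%:E * (Z w)%:E)%E.
    by apply: emeasurable_funM => //; exact: measurable_EFin_fun.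
  have m4 : measurable_fun [set: Omega] (fun=> (c ^+ 2)%:E) by [].
  rewrite -(ge0_integralD _ measurableT h1 m1 h2 m2).
  rewrite -(ge0_integralD _ measurableT h3 m3 h4 m4).
  by apply: eq_integral => w _; rewrite -EFinM -!EFinD; congr EFin; ring.
have : (\int[P]_w ((Z w - c) ^+ 2)%:E + (2 * c * c)%:E <= s%:E + (2 * c * c)%:E)%E.
  rewrite key; apply: (le_trans (leeD2r _ Zs)).
  by rewrite -!EFinD lee_fin; lra.
by rewrite leeD2rE.
Qed.

(** Sums of indicators reduce the variance to probabilities of pairwise intersections. This covers
    truncated degrees, as min(X, T) is the sum of the indicators of X > i for i < T, and vertex
    counts, with T = 1. *)
Lemma pr_chebyshev_indic (V : finType) (T : nat) (A : V -> 'I_T -> set Omega)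
    (p : 'I_T -> R) (s t : R) :
  (forall v i, measurable (A v i)) ->
  (forall v i, pr P (A v i) = p i) ->
  (forall v w i j, v != w -> pr P (A v i `&` A w j) = p i * p j) ->
  (forall v, \sum_i \sum_j pr P (A v i `&` A v j) <= s) -> 0 < t ->
  pr P [set w | t <= `|\sum_v \sum_i \1_(A v i) w - #|V|%:R * \sum_i p i|]
    <= #|V|%:R * s / t ^+ 2.
Proof.
move=> mA Ap Ai As t0.
pose Z w : R := \sum_v \sum_i \1_(A v i) w.
have mI (B : set Omega) : measurable B -> measurable_fun setT (\1_B : Omega -> R).
  by move=> mB; exact: measurable_indic.
have mZ : measurable_fun setT Z.
  by apply: measurable_sum => v; apply: measurable_sum => i; exact: mI.
have Isum (I : finType) (F : I -> Omega -> R) (x : I -> R) :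
    (forall i, measurable_fun setT (F i)) -> (forall i w, 0 <= F i w) ->
    (forall i, (\int[P]_w (F i w)%:E = (x i)%:E)%E) ->
    (\int[P]_w (\sum_i F i w)%:E = (\sum_i x i)%:E)%E.
  move=> mF F0 Fx; rewrite -sumEFin -(eq_bigr _ (fun i _ => Fx i)).
  rewrite -ge0_integral_sum//.
  - by apply: eq_integral => w _; rewrite sumEFin.
  - by move=> i; exact: measurable_EFin_fun.
  - by move=> i w _; rewrite lee_fin.
have IA := integral_pr.
have I0 (B : set Omega) w : 0 <= \1_B w :> R by [].
apply: (pr_chebyshev mZ) => //.
- by move=> w; apply: sumr_ge0 => v _; apply: sumr_ge0.
- rewrite (Isum _ _ (fun v => \sum_i p i)); first last.
  + move=> v; apply: (Isum) => [i|i w|i]; [exact: mI|exact: I0|].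
    by rewrite IA// Ap.
  + by move=> v w; exact: sumr_ge0.
  + by move=> v; apply: measurable_sum => i; exact: mI.
  by rewrite sumr_const mulr_natl.
pose c v w := \sum_i \sum_j pr P (A v i `&` A w j).
have -> : (\int[P]_x (Z x ^+ 2)%:E = (\sum_v \sum_w c v w)%:E)%E.
  transitivity (\int[P]_x (\sum_v \sum_w \sum_i \sum_j \1_(A v i `&` A w j) x)%:E)%E.
    apply: eq_integral => x _; congr EFin; rewrite expr2 /Z mulr_suml.
    apply: eq_bigr => v _; rewrite mulr_sumr; apply: eq_bigr => w _.
    rewrite mulr_suml; apply: eq_bigr => i _; rewrite mulr_sumr; apply: eq_bigr => j _.
    by rewrite indicI.
  have mAA v w i j : measurable (A v i `&` A w j) by exact: measurableI.
  have g0 v w x : 0 <= \sum_i \sum_j \1_(A v i `&` A w j) x :> R.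
    by apply: sumr_ge0 => i _; apply: sumr_ge0.
  have gm v w : measurable_fun setT (fun x => \sum_i \sum_j \1_(A v i `&` A w j) x : R).
    by apply: measurable_sum => i; apply: measurable_sum => j; exact: mI.
  apply: (Isum) => [v|v x|v].
  - by apply: measurable_sum => w.
  - by apply: sumr_ge0.
  apply: (Isum) => // w; apply: (Isum) => [i|i x|i].
  - by apply: measurable_sum => j; exact: mI.
  - by apply: sumr_ge0.
  by apply: (Isum) => [j|j x|j]; [exact: mI|exact: I0|exact: IA].
rewrite lee_fin.
apply: (@le_trans _ _ (\sum_(v : V) (s + #|V|%:R * (\sum_i p i) ^+ 2))); last first.
  rewrite sumr_const -[leLHS]mulr_natl.
  by rewrite le_eqVlt; apply/orP; left; apply/eqP; ring.
apply: ler_sum => v _; rewrite (bigD1 v)//=; apply: lerD; first exact: As.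
apply: (@le_trans _ _ (\sum_(w : V) (\sum_i p i) ^+ 2)); last first.
  by rewrite sumr_const -[leLHS]mulr_natl.
rewrite [leRHS](bigD1 v)//= -[leLHS]add0r lerD ?sqr_ge0//.
apply: ler_sum => w wv; rewrite /c expr2 mulr_suml.
apply: ler_sum => i _; rewrite mulr_sumr; apply: ler_sum => j _.
by rewrite Ai// eq_sym.
Qed.

Lemma same_law_integral d0 (Omega0 : measurableType d0) (P0 : probability Omega0 R)
    (X : {RV P >-> nat}) (X0 : {RV P0 >-> nat}) (f : nat -> R) :
  same_law P P0 X X0 -> (forall k, 0 <= f k) ->
  (\int[P]_w (f (X w))%:E = \int[P0]_w (f (X0 w))%:E)%E.
Proof.
move=> XX0 f0.
have mf : measurable_fun setT (EFin \o f) by [].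
have := @ge0_integral_pushforward _ _ _ _ _ X (measurable_funPT X) P setT (EFin \o f)
  measurableT mf.
have := @ge0_integral_pushforward _ _ _ _ _ X0 (measurable_funPT X0) P0 setT (EFin \o f)
  measurableT mf.
rewrite !preimage_setT => h0 h.
transitivity (\int[pushforward P X]_x (EFin \o f) x)%E.
  by rewrite h// => k _; rewrite lee_fin.
rewrite (eq_measure_integral (pushforward P0 X0)).
  by rewrite h0// => k _; rewrite lee_fin.
by move=> A mA _; exact: XX0.
Qed.

End Moments.

(** * Moments and truncation *)

Section TailMoment.
Context {R : realType}.

Lemma near_pinfty_pow2 (Q : R -> Prop) :
  (\forall x \near +oo, Q x) -> exists k0, forall k, (k0 <= k)%N -> Q (2 ^+ k).
Proof.
move=> [A [_ AQ]]; exists (Num.truncn `|A|).+1 => k kk; apply: AQ.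
apply: (le_lt_trans (ler_norm A)); apply: (lt_trans (truncnS_gt _)).
rewrite -natrX ltr_nat; apply: leq_ltn_trans kk _; exact: ltn_expl.
Qed.

Lemma nneseries_geometric (u : nat -> R) (C r : R) :
  0 <= C -> 0 <= r < 1 -> (forall k, 0 <= u k) -> (forall k, u k <= C * r ^+ k) ->
  (\sum_(0 <= k <oo) (u k)%:E <= (C / (1 - r))%:E)%E.
Proof.
move=> C0 /andP[r0 r1] u0 uC; apply: lime_le.
  by apply: is_cvg_nneseries => k _ _; rewrite lee_fin.
apply: nearW => n; rewrite sumEFin lee_fin.
apply: (@le_trans _ _ (\sum_(0 <= k < n) C * r ^+ k)).
  by apply: ler_sum => k _.
rewrite -mulr_sumr ler_wpM2l// -[leRHS]mul1r ler_pdivlMr ?subr_gt0//.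
have -> : (\sum_(0 <= k < n) r ^+ k) * (1 - r) = 1 - r ^+ n.
  elim: n => [|n IH]; first by rewrite big_geq// expr0; ring.
  by rewrite big_nat_recr//= mulrDl IH exprS; ring.
by rewrite gerBl exprn_ge0.
Qed.

(* Only the values of the slowly varying function at powers of 2 are used, so
   that the convergence of the ratio [L (2 x) / L x] suffices. *)
Lemma regular_tail_geometric (q : nat -> R) (L : R -> R) (a p : R) :
  slowly_varying L -> 0 < p -> p < a -> (forall k, 0 <= q k) ->
  (forall k, q k <= (2 ^+ k) `^ (- a) * L (2 ^+ k)) ->
  exists C r, [/\ 0 <= C, 0 <= r < 1 & forall k, (2 ^+ k.+1) `^ p * q k <= C * r ^+ k].
Proof.
move=> [_ L0 Lr] p0 pa q0 qL.
pose s : R := 2 `^ (p - a).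
have s0 : 0 < s by rewrite powR_gt0.
have s1 : s < 1.
  rewrite lt_neqAle powR_eq1 !negb_or -[X in _ <= X](powRr0 2) ler_powR; [|lra|lra].
  rewrite andbT; apply/and3P; split; [|by rewrite -leNgt|by rewrite subr_eq0 lt_eqF].
  by rewrite (eqr_nat R 2 1).
(* The ratio of consecutive dyadic bounds tends to [s]; a rate strictly between [s] and 1 absorbs
   the slowly varying factor. *)
pose r := (s + 1) / 2.
have sr : 1 < r / s by rewrite ltr_pdivlMr// /r; lra.
have /near_pinfty_pow2[k0 kL] : \forall x \near +oo, 0 < L x /\ L (2 * x) / L x <= r / s.
  by near=> x; split; [near: x|near: x; exact: (cvgr_le _ (Lr 2 _))].
pose u k := (2 ^+ k.+1) `^ p * ((2 ^+ k) `^ (- a) * L (2 ^+ k)).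
have r0 : 0 < r by rewrite /r; lra.
have r1 : r < 1 by rewrite /r; lra.
have ur k : (k0 <= k)%N -> u k.+1 <= r * u k.
  move=> kk; have [Lk Lkk] := kL k kk.
  have -> : u k.+1 = s * ((2 ^+ k.+1) `^ p * (2 ^+ k) `^ (- a)) * L (2 * 2 ^+ k).
    rewrite /u [2 ^+ k.+2]exprS powRM ?exprn_ge0// [in (2 ^+ k.+1) `^ (- a)]exprS powRM ?exprn_ge0//.
    by rewrite /s powRD ?pnatr_eq0 ?implybT// -exprS; ring.
  have -> : r * u k = s * ((2 ^+ k.+1) `^ p * (2 ^+ k) `^ (- a)) * (r / s * L (2 ^+ k)).
    by rewrite /u; field; rewrite gt_eqF.
  by rewrite ler_wpM2l ?mulr_ge0 ?powR_ge0// -ler_pdivrMr.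
pose v k := (2 ^+ k.+1) `^ p * q k.
have v0 k : 0 <= v k by rewrite mulr_ge0 ?powR_ge0.
have vu k : v k <= u k by rewrite ler_wpM2l ?powR_ge0.
have ugeo k : u (k0 + k)%N <= u k0 * r ^+ k.
  elim: k => [|k IH]; first by rewrite addn0 expr0 mulr1.
  rewrite addnS; apply: (le_trans (ur _ (leq_addr _ _))).
  by rewrite exprS [leRHS]mulrCA (ler_wpM2l (ltW r0)).

have u00 : 0 <= u k0 := le_trans (v0 k0) (vu k0).
(* The finite sum covers the terms before [k0], where the ratio is not controlled. *)
pose C := \sum_(k < k0) v k / r ^+ k + u k0 / r ^+ k0.
have rk k : 0 < r ^+ k by rewrite exprn_gt0.
have S0 : 0 <= \sum_(k < k0) v k / r ^+ k.
  by apply: sumr_ge0 => k _; rewrite divr_ge0// ltW.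
exists C, r; split; first by rewrite addr_ge0// divr_ge0// ltW.
  by rewrite ltW.
move=> k; rewrite -ler_pdivrMr// -/(v k).
have [kk|kk] := ltnP k k0.
  rewrite /C (bigD1 (Ordinal kk))//= -addrA lerDl addr_ge0//.
    by apply: sumr_ge0 => j _; rewrite divr_ge0// ltW.
  by rewrite divr_ge0// ltW.
rewrite /C -[leLHS]add0r lerD//.
rewrite ler_pdivrMr// mulrAC ler_pdivlMr// -{1}(subnKC kk) -{2}(subnKC kk) exprD.
apply: (@le_trans _ _ (u k0 * r ^+ (k - k0) * r ^+ k0)).
  by rewrite ler_wpM2r ?(ltW (rk _))// (le_trans (vu _)).
by rewrite -mulrA [r ^+ (k - k0) * _]mulrC.
Unshelve. all: end_near.
Qed.

(** Dyadic decomposition: X^p is at most 1 plus the sum of 2^((k+1)p) over the k with X > 2^k, and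
    the tail bound with p < a makes the expectations geometric. *)
Lemma tail_moment d (Omega : measurableType d) (P : probability Omega R)
    (X : {RV P >-> nat}) (L : R -> R) (a p : R) :
  slowly_varying L -> 0 < p -> p < a ->
  (forall x : R, 0 < x -> (P [set w | (x < (X w)%:R)%R] <= (x `^ (- a) * L x)%:E)%E) ->
  exists M : R, 0 <= M /\ (\int[P]_w ((X w)%:R `^ p)%:E <= M%:E)%E.
Proof.
move=> Lsv p0 pa tail.
pose A k := [set w | (2 ^+ k < (X w)%:R :> R)%R].
have mX (f : nat -> R) : measurable_fun setT (fun w => f (X w)).
  by apply: (measurableT_comp (f := f)); [by []|exact: measurable_funPT].
have mA k : measurable (A k).
  rewrite (_ : A k = X @^-1` [set j | 2 ^+ k < j%:R :> R])//.
  by rewrite -[X in measurable X]setTI; exact: measurable_funPT.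
have qL k : pr P (A k) <= (2 ^+ k) `^ (- a) * L (2 ^+ k).
  by rewrite -lee_fin -prE//; apply: tail; rewrite exprn_gt0.
have [C [r [C0 r01 vC]]] := regular_tail_geometric Lsv p0 pa (fun k => pr_ge0 P (A k)) qL.
have [r0 r1] := andP r01.
exists (1 + C / (1 - r)); split.
  by rewrite addr_ge0// divr_ge0// subr_ge0 ltW.
pose g k w : R := (2 ^+ k.+1) `^ p * \1_(A k) w.
have g0 k w : 0 <= g k w by rewrite mulr_ge0 ?powR_ge0.
have mg k : measurable_fun setT (fun w => (g k w)%:E).
  by apply/measurable_EFinP; apply: measurable_funM => //; exact: measurable_indic.
apply: (@le_trans _ _ (\int[P]_w (1%:E + \sum_(0 <= k <oo) (g k w)%:E))%E).
  apply: ge0_le_integral => //.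
  - exact/measurable_EFinP/(mX (fun j => j%:R `^ p)).
  - apply: emeasurable_funD => //; apply: ge0_emeasurable_sum => // k w _ _.
    by rewrite lee_fin.
  move=> w _; have [w1|w1] := leqP (X w) 1.
    apply: (@le_trans _ _ 1%:E).
      rewrite lee_fin; case: (X w) w1 => [|[|//]] _; last by rewrite powR1.
      by rewrite powR0// gt_eqF.
    by rewrite leeDl// nneseries_ge0// => k _ _; rewrite lee_fin.
  (* Taking the logarithm of X - 1 gives 2^k < X <= 2^(k+1), with the strict inequality that [A k]
     asks for. *)
  pose k := trunc_log 2 (X w).-1.
  have w0 : (0 < (X w).-1)%N by rewrite -subn1 subn_gt0.
  have := trunc_log_bounds (isT : (1 < 2)%N) w0; rewrite -/k => /andP[k1 k2].
  have Ak : w \in A k.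
    by rewrite inE /A /= -natrX ltr_nat; move: k1 w1; case: (X w).
  apply: (@le_trans _ _ (\sum_(0 <= j < k.+1) (g j w)%:E)%E).
    rewrite sumEFin lee_fin big_nat_recr//=.
    apply: (@le_trans _ _ (g k w)); last by rewrite lerDr sumr_ge0.
    rewrite /g indicE Ak mulr1 ge0_ler_powR ?nnegrE ?exprn_ge0 ?(ltW p0)//.
    by rewrite -natrX ler_nat; move: k2; case: (X w).
  apply: le_trans (nneseries_lim_ge _ _) _; first by move=> j _ _; rewrite lee_fin.
  by rewrite leeDr.
rewrite ge0_integralD//; last 2 first.
- by move=> w _; rewrite nneseries_ge0// => k _ _; rewrite lee_fin.
- apply: ge0_emeasurable_sum => // k w _ _; by rewrite lee_fin.
rewrite integral_cst// mul1e integral_nneseries//; last first.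
  by move=> k w _; rewrite lee_fin.
rewrite EFinD; apply: leeD.
  by apply: (le_trans (probability_le1 P measurableT)).
rewrite (_ : (\sum_(0 <= k <oo) _)%E = \sum_(0 <= k <oo) ((2 ^+ k.+1) `^ p * pr P (A k))%:E)%E.
  by apply: nneseries_geometric => // k; rewrite mulr_ge0 ?powR_ge0 ?pr_ge0.
apply: eq_eseriesr => k _; rewrite EFinM -integral_pr// -ge0_integralZl_EFin ?powR_ge0//.
by apply: measurable_EFin_fun; exact: measurable_indic.
Qed.

End TailMoment.

Lemma independent_prod (R : realType) (d : measure_display) (Omega : measurableType d)
    (P : probability Omega R) (I : choiceType) (F : I -> set_system Omega)
    (s : seq I) (A : I -> set Omega) :
  mutually_independent P F -> uniq s -> (forall i, F i (A i)) ->
  (forall i, measurable (A i)) ->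
  pr P [set w | forall i, i \in s -> A i w] = \prod_(i <- s) pr P (A i).
Proof.
move=> Find us FA mA; have := Find (seq_fset tt s) A (fun i _ => FA i).
have -> : \bigcap_(i in [set` seq_fset tt s]) A i = [set w | forall i, i \in s -> A i w].
  have sE i : (i \in seq_fset tt s) = (i \in s) by exact: seq_fsetE.
  apply/seteqP; split => w H i.
    by move=> si; apply: H; rewrite /mkset sE.
  by rewrite /mkset sE => si; exact: H.
rewrite (perm_big s) /=; last first.
  by apply: (perm_trans (seq_fset_perm tt s)); rewrite undup_id.
rewrite (eq_bigr (fun i => (pr P (A i))%:E)); last by move=> i _; exact: prE.
by rewrite prodEFin /pr => ->.
Qed.

Section PointwiseBounds.
Context {R : realType}.
Variable p : R.
Hypotheses (p1 : 1 < p) (p2 : p < 2).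

(** For x > T, write x = x^p x^(1-p) and use 1 - p < 0. The bound on the truncated square below
    splits 2 as p + (2 - p) in the same way. *)
Lemma overshoot_le (x T : nat) : (0 < T)%N ->
  (x - T)%:R <= x%:R `^ p * T%:R `^ (1 - p) :> R.
Proof.
move=> T0; have [xT|xT] := leqP x T.
  by rewrite (eqP (_ : x - T == 0)%N) ?subn_eq0// mulr_ge0 ?powR_ge0.
have x0 : 0 < x%:R :> R by rewrite ltr0n (leq_ltn_trans _ xT).
have T0' : 0 < T%:R :> R by rewrite ltr0n.
apply: (@le_trans _ _ x%:R); first by rewrite ler_nat leq_subr.
have split_pow : x%:R = x%:R `^ p * x%:R `^ (1 - p) :> R.
  rewrite -powRD; last by rewrite (gt_eqF x0) implybT.
  by rewrite (_ : p + (1 - p) = 1) ?powRr1 ?ltW//; ring.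
rewrite [leLHS]split_pow ler_wpM2l ?powR_ge0//.
have pp : 0 <= p - 1 by rewrite subr_ge0 ltW.
rewrite -(opprB p) !powRN lef_pV2 ?posrE ?powR_gt0//.
by rewrite ge0_ler_powR ?nnegrE ?ler_nat// ltnW.
Qed.

Lemma minn_sqr_le (x T : nat) : (0 < T)%N ->
  (minn x T)%:R ^+ 2 <= x%:R `^ p * T%:R `^ (2 - p) :> R.
Proof.
move=> T0; have [->|x0] := posnP x.
  by rewrite min0n expr0n mulr_ge0 ?powR_ge0.
have pp : 0 <= p by move: p1; lra.
have pp' : 0 <= 2 - p by move: p2; lra.
set m := minn x T; have m0 : 0 < m%:R :> R by rewrite ltr0n leq_min x0.
have -> : m%:R ^+ 2 = m%:R `^ p * m%:R `^ (2 - p) :> R.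
  rewrite -powRD; last by rewrite (gt_eqF m0) implybT.
  by rewrite (_ : p + (2 - p) = 2%:R) ?powR_mulrn ?ltW//; ring.
by apply: ler_pM; rewrite ?powR_ge0// ge0_ler_powR ?nnegrE ?ler_nat// ?geq_minl ?geq_minr.
Qed.

End PointwiseBounds.

Section Truncation.
Context {R : realType}.
Context d0 (Omega0 : measurableType d0) (P0 : probability Omega0 R).
Variable X0 : {RV P0 >-> nat}.
Lemma measurable_RV_comp d' (W : measurableType d') (Q : probability W R)
    (Y : {RV Q >-> nat}) (f : nat -> R) : measurable_fun setT (fun w => f (Y w)).
Proof. by apply: (measurableT_comp (f := f)); [by []|exact: measurable_funPT]. Qed.

Lemma measurable_RV_preimage d' (W : measurableType d') (Q : probability W R)
    (Y : {RV Q >-> nat}) (B : set nat) : measurable (Y @^-1` B).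
Proof. by rewrite -[X in measurable X]setTI; exact: measurable_funPT. Qed.

(** The expectation of min(X0, T), written by the tail formula as a finite sum of probabilities. *)
Definition truncated_mean (T : nat) : R :=
  \sum_(i < T) pr P0 (X0 @^-1` [set k | (i < k)%N]).

Lemma truncated_indic d' (W : measurableType d') (Q : probability W R)
    (Y : {RV Q >-> nat}) T w :
  \sum_(i < T) \1_(Y @^-1` [set k | (i < k)%N]) w = (minn (Y w) T)%:R :> R.
Proof.
rewrite -[minn _ _]card_ord -sum1_card natr_sum.
rewrite (eq_bigr (fun i : 'I_T => (i < Y w)%N%:R)); last first.
  by move=> i _; rewrite indicE; congr (_%:R); congr nat_of_bool; rewrite -[LHS]/(_ \in _); apply/idP/idP; rewrite ?inE.
rewrite -natr_sum -natr_sum; congr (_%:R).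
rewrite sum1_card card_ord -(big_mkord xpredT (fun i => (i < Y w)%N : nat)).
elim: T => [|T IH]; first by rewrite big_geq// minn0.
by rewrite big_nat_recr//= IH; case: leqP; lia.
Qed.

(** Because the means of [gamma] and [xi] agree, this bounds the difference of their truncated means
    by their mean overshoots. *)
Lemma truncated_mean_split (T : nat) :
  (\int[P0]_w ((X0 w)%:R : R)%:E
   = (truncated_mean T)%:E + \int[P0]_w ((X0 w - T)%:R : R)%:E)%E.
Proof.
have -> : (truncated_mean T)%:E = (\int[P0]_w ((minn (X0 w) T)%:R : R)%:E)%E.
  under eq_integral => w _ do rewrite -truncated_indic -sumEFin.
  rewrite ge0_integral_sum//; last first.
    by move=> i; apply: measurable_EFin_fun; apply: measurable_indic; exact: measurable_RV_preimage.
  rewrite -sumEFin; apply: eq_bigr => i _; rewrite integral_pr//.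
  exact: measurable_RV_preimage.
rewrite -ge0_integralD//.
- by apply: eq_integral => w _; rewrite -EFinD -natrD; congr (_%:R%:E); lia.
- exact/measurable_EFinP/(measurable_RV_comp X0 (fun k => (minn k T)%:R)).
- exact/measurable_EFinP/(measurable_RV_comp X0 (fun k => (k - T)%:R)).
Qed.

Variables (p M : R).
Hypotheses (p1 : 1 < p) (p2 : p < 2).
Hypothesis X0p : (\int[P0]_w ((X0 w)%:R `^ p)%:E <= M%:E)%E.
Context d (Omega : measurableType d) (P : probability Omega R) (V : finType).
Variable X : V -> {RV P >-> nat}.
Hypothesis X_law : forall v, same_law P P0 (X v) X0.
Hypothesis X_indep : forall v w (B C : set nat), v != w ->
  pr P (X v @^-1` B `&` X w @^-1` C) = pr P (X v @^-1` B) * pr P (X w @^-1` C).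

Lemma expected_power_le (c : R) : 0 <= c ->
  (\int[P0]_w ((X0 w)%:R `^ p * c)%:E <= (M * c)%:E)%E.
Proof.
move=> c0; under eq_integral => w _ do rewrite EFinM muleC.
rewrite ge0_integralZl_EFin//; last first.
  exact/measurable_EFinP/(measurable_RV_comp X0 (fun k => k%:R `^ p)).
by rewrite EFinM [leRHS]muleC lee_pmul// integral_ge0// => w _; rewrite lee_fin powR_ge0.
Qed.

Lemma overshoot_mean_le (T : nat) : (0 < T)%N ->
  (\int[P0]_w ((X0 w - T)%:R : R)%:E <= (M * T%:R `^ (1 - p))%:E)%E.
Proof.
move=> T0; apply: le_trans (expected_power_le (powR_ge0 _ _)).
apply: ge0_le_integral => //.
- exact/measurable_EFinP/(measurable_RV_comp X0 (fun k => (k - T)%:R)).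
- exact/measurable_EFinP/(measurable_RV_comp X0 (fun k => k%:R `^ p * T%:R `^ (1 - p))).
by move=> w _; rewrite lee_fin overshoot_le.
Qed.

(** Chebyshev's inequality for pairwise independent terms, whose second moment is at most M T^(2-p)
    since min(x, T)^2 <= x^p T^(2-p). *)
Lemma truncated_sum_concentrates (T : nat) (t : R) : (0 < T)%N -> 0 < t ->
  pr P [set w | t <= `|(\sum_v minn (X v w) T)%:R - #|V|%:R * truncated_mean T|]
    <= #|V|%:R * (M * T%:R `^ (2 - p)) / t ^+ 2.
Proof.
move=> T0 t0.
pose A v (i : 'I_T) := X v @^-1` [set k | (i < k)%N].
have mA v i : measurable (A v i) by exact: measurable_RV_preimage.
have := @pr_chebyshev_indic R _ _ P V T A (fun i => pr P0 (X0 @^-1` [set k | (i < k)%N]))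
  (M * T%:R `^ (2 - p)) t mA.
have -> : [set w | t <= `|\sum_v \sum_i \1_(A v i) w - #|V|%:R * \sum_(i < T) pr P0 (X0 @^-1` [set k | (i < k)%N])|]
   = [set w | t <= `|(\sum_v minn (X v w) T)%:R - #|V|%:R * truncated_mean T|].
  have sumE w : \sum_v \sum_i \1_(A v i) w = (\sum_v minn (X v w) T)%:R :> R.
    by rewrite natr_sum; apply: eq_bigr => v _; exact: truncated_indic.
  by apply/seteqP; split => w; rewrite /mkset sumE.
have law v i : pr P (A v i) = pr P0 (X0 @^-1` [set k | (i < k)%N]).
  by rewrite /pr X_law.
apply=> //; first by move=> v w i j vw; rewrite X_indep// !law.
move=> v; rewrite -lee_fin.
have -> : ((\sum_i \sum_j pr P (A v i `&` A v j))%:E =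
   \int[P]_w ((minn (X v w) T)%:R ^+ 2 : R)%:E)%E.
  have mAA i j : measurable (A v i `&` A v j) by exact: measurableI.
  rewrite (eq_integral (fun w =>
      \sum_(q : 'I_T * 'I_T) (\1_(A v q.1 `&` A v q.2) w)%:E)%E); last first.
    move=> w _; rewrite -truncated_indic expr2 mulr_suml sumEFin; congr EFin.
    under eq_bigr => i _ do rewrite mulr_sumr.
    by rewrite pair_big /=; apply: eq_bigr => q _; rewrite indicI.
  rewrite ge0_integral_sum//; last first.
    by move=> q; apply: measurable_EFin_fun; exact: measurable_indic.
  rewrite pair_big /= -sumEFin; apply: eq_bigr => q _; rewrite integral_pr//.
rewrite (@same_law_integral _ _ _ _ _ _ _ _ X0 (fun k => (minn k T)%:R ^+ 2))//.
apply: le_trans (expected_power_le (powR_ge0 _ _)).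
apply: ge0_le_integral => //.
- exact/measurable_EFinP/(measurable_RV_comp X0 (fun k => (minn k T)%:R ^+ 2)).
- exact/measurable_EFinP/(measurable_RV_comp X0 (fun k => k%:R `^ p * T%:R `^ (2 - p))).
by move=> w _; rewrite lee_fin minn_sqr_le.
Qed.

Lemma overshoot_sum_markov (T : nat) (t : R) : (0 < T)%N -> 0 < t ->
  pr P [set w | t <= (\sum_v (X v w - T))%:R]
    <= #|V|%:R * (M * T%:R `^ (1 - p)) / t.
Proof.
move=> T0 t0; apply: pr_markov => //.
  under eq_fun do rewrite natr_sum.
  by apply: measurable_sum => v; exact: (measurable_RV_comp (X v) (fun k => (k - T)%:R)).
under eq_integral => w _ do rewrite natr_sum -sumEFin.
rewrite ge0_integral_sum//; last first.
  move=> v; apply: measurable_EFin_fun.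
  exact: (measurable_RV_comp (X v) (fun k => (k - T)%:R)).
rewrite (eq_bigr (fun _ => \int[P0]_w ((X0 w - T)%:R : R)%:E)%E); last first.
  move=> v _; exact: (same_law_integral (f := fun k => (k - T)%:R)).
apply: (@le_trans _ _ (\sum_(v : V) (M * T%:R `^ (1 - p))%:E)%E).
  by apply: lee_sum => v _; exact: overshoot_mean_le.
by rewrite sumEFin sumr_const mulr_natl.
Qed.

End Truncation.

Lemma minn_addB x T : (x = minn x T + (x - T))%N.
Proof. lia. Qed.

(** * The first attempt at sampling the degrees *)

Section Attempts.
Context {R : realType}.
Context (d0 : measure_display) (Omega0 : measurableType d0) (P0 : probability Omega0 R).
Variables (gamma xi : {RV P0 >-> nat}) (p M : R).
Hypotheses (p1 : 1 < p) (p2 : p < 2).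
Hypothesis gamma_p : (\int[P0]_w ((gamma w)%:R `^ p)%:E <= M%:E)%E.
Hypothesis xi_p : (\int[P0]_w ((xi w)%:R `^ p)%:E <= M%:E)%E.
Context (d : measure_display) (Omega : measurableType d) (P : probability Omega R).
Context (V : finType) (G : ecm_data P V) (c : R).
Hypothesis G_ecm : is_ecm G gamma xi c.
Local Notation n := (@GRing.natmul R 1 #|V|).
Let att0 (w : Omega) : bidegree V := ecm_attempt G w 0.

Definition ecm_variable (i : bool * (nat * V)) : {RV P >-> nat} :=
  if i.1 then ecm_gamma G i.2.1 i.2.2 else ecm_xi G i.2.1 i.2.2.

Lemma ecm_attempt_independent (s : seq (bool * (nat * V))) (B : bool * (nat * V) -> set nat) :
  uniq s ->
  pr P [set w | forall i, i \in s -> B i (ecm_variable i w)]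
  = \prod_(i <- s) pr P0 ((if i.1 then gamma else xi) @^-1` B i).
Proof.
move=> us.
have := @independent_prod R d Omega P _ _ s
  (fun i => ecm_variable i @^-1` B i) (ecm_attempt_indep G_ecm) us.
move=> ->; last 2 first.
- by move=> -[[] [k v]] /=; [exists (B (true, (k, v)))|exists (B (false, (k, v)))].
- by move=> i; exact: measurable_RV_preimage.
apply: eq_bigr => -[[] [k v]] _; rewrite /pr /ecm_variable /=.
  by rewrite (ecm_gamma_law G_ecm).
by rewrite (ecm_xi_law G_ecm).
Qed.

Lemma pr_ecm_gamma k v (B : set nat) :
  pr P (ecm_gamma G k v @^-1` B) = pr P0 (gamma @^-1` B).
Proof. by rewrite /pr (ecm_gamma_law G_ecm). Qed.

Lemma pr_ecm_xi k v (B : set nat) :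
  pr P (ecm_xi G k v @^-1` B) = pr P0 (xi @^-1` B).
Proof. by rewrite /pr (ecm_xi_law G_ecm). Qed.

Lemma ecm_gamma_independent v w (B C : set nat) : v != w ->
  pr P (ecm_gamma G 0 v @^-1` B `&` ecm_gamma G 0 w @^-1` C)
  = pr P (ecm_gamma G 0 v @^-1` B) * pr P (ecm_gamma G 0 w @^-1` C).
Proof.
move=> vw.
have := @ecm_attempt_independent [:: (true, (0%N, v)); (true, (0%N, w))]
  (fun i => if i.2.2 == v then B else C).
rewrite /= inE !xpair_eqE /= (negbTE vw) => /(_ isT).
rewrite big_cons big_seq1 /= eqxx eq_sym (negbTE vw).
rewrite -(pr_ecm_gamma 0 v B) -(pr_ecm_gamma 0 w C) => <-.
congr (pr P _); apply/seteqP; split => x /=.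
  move=> [Bx Cx] i; rewrite !inE => /orP[/eqP|/eqP] ->; rewrite /= ?eqxx//.
  by rewrite eq_sym (negbTE vw).
move=> h; split.
  by have := h (true, (0%N, v)); rewrite inE eqxx /= eqxx; exact.
have := h (true, (0%N, w)); rewrite !inE eqxx orbT /= eq_sym (negbTE vw); exact.
Qed.

Lemma ecm_xi_independent v w (B C : set nat) : v != w ->
  pr P (ecm_xi G 0 v @^-1` B `&` ecm_xi G 0 w @^-1` C)
  = pr P (ecm_xi G 0 v @^-1` B) * pr P (ecm_xi G 0 w @^-1` C).
Proof.
move=> vw.
have := @ecm_attempt_independent [:: (false, (0%N, v)); (false, (0%N, w))]
  (fun i => if i.2.2 == v then B else C).
rewrite /= inE !xpair_eqE /= (negbTE vw) => /(_ isT).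
rewrite big_cons big_seq1 /= eqxx eq_sym (negbTE vw).
rewrite -(pr_ecm_xi 0 v B) -(pr_ecm_xi 0 w C) => <-.
congr (pr P _); apply/seteqP; split => x /=.
  move=> [Bx Cx] i; rewrite !inE => /orP[/eqP|/eqP] ->; rewrite /= ?eqxx//.
  by rewrite eq_sym (negbTE vw).
move=> h; split.
  by have := h (false, (0%N, v)); rewrite inE eqxx /= eqxx; exact.
have := h (false, (0%N, w)); rewrite !inE eqxx orbT /= eq_sym (negbTE vw); exact.
Qed.

Lemma ecm_attempt_countably_measurable k :
  countably_measurable (fun w => ecm_attempt G w k).
Proof.
move=> r.
rewrite (_ : _ @^-1` _ = \bigcap_(v in [set: V])
    (ecm_gamma G k v @^-1` [set r.1 v] `&` ecm_xi G k v @^-1` [set r.2 v])).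
  apply: fin_bigcap_measurable; first exact: finite_finset.
  by move=> v _; apply: measurableI; exact: measurable_RV_preimage.
apply/seteqP; split => w /=.
  by move=> <- v _ /=; rewrite !ffunE.
move=> h; rewrite [RHS]surjective_pairing /ecm_attempt; congr pair;
  by apply/ffunP => v; rewrite ffunE; have [] := h v I.
Qed.

Lemma measurable_attempt_set (Q : set (bidegree V)) : measurable (att0 @^-1` Q).
Proof. exact: countably_measurable_preimage (ecm_attempt_countably_measurable 0). Qed.

Lemma measurable_attempt (Q : (V -> nat) -> (V -> nat) -> Prop) :
  measurable [set w | Q (fun v => ecm_gamma G 0 v w) (fun v => ecm_xi G 0 v w)].
Proof.
rewrite (_ : mkset _ = att0 @^-1` [set r : bidegree V | Q r.1 r.2]); first exact: measurable_attempt_set.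
have att1 w : (att0 w).1 = (fun v => ecm_gamma G 0 v w) :> (V -> nat).
  by apply/funext => v; rewrite ffunE.
have att2 w : (att0 w).2 = (fun v => ecm_xi G 0 v w) :> (V -> nat).
  by apply/funext => v; rewrite ffunE.
by apply/seteqP; split => w /=; rewrite att1 att2.
Qed.

Definition pair_count (r : bidegree V) (i j : nat) : nat :=
  #|[set v | (r.1 v == i) && (r.2 v == j)]%SET|.

Lemma abs_excess (r : bidegree V) :
  `|excess r|%N%:R = `|(\sum_v r.1 v)%N%:R - (\sum_v r.2 v)%N%:R| :> R.
Proof.
by rewrite -[LHS]/(`|excess r|%N%:Z%:~R) abszE /excess intr_norm rmorphB.
Qed.

(** Five errors of size t add up to the excess: the deviations of the two truncated sums, the two
    overshoots, and n times the difference of the truncated means, which equal full means keep below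
    n M T^(1-p). *)
Lemma pr_excess_gt (T : nat) (t : R) :
  mean P0 gamma = mean P0 xi ->
  (0 < T)%N -> 0 < t -> n * (M * T%:R `^ (1 - p)) <= t -> 5 * t <= c ->
  pr P [set w | c < `|excess (att0 w)|%N%:R]
    <= 2 * (n * (M * T%:R `^ (2 - p)) / t ^+ 2 + n * (M * T%:R `^ (1 - p)) / t).
Proof.
move=> mean_eq T0 t0 nt tc.
pose mg := truncated_mean gamma T; pose mx := truncated_mean xi T.
have g1 := truncated_sum_concentrates p1 p2 gamma_p (ecm_gamma_law G_ecm 0)
  ecm_gamma_independent T0 t0.
have x1 := truncated_sum_concentrates p1 p2 xi_p (ecm_xi_law G_ecm 0)
  ecm_xi_independent T0 t0.
have g2 := overshoot_sum_markov p1 gamma_p (ecm_gamma_law G_ecm 0) T0 t0.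
have x2 := overshoot_sum_markov p1 xi_p (ecm_xi_law G_ecm 0) T0 t0.
have mdiff : n * `|mg - mx| <= t.
  apply: le_trans nt; rewrite ler_wpM2l//.
  have sg := truncated_mean_split gamma T; have sx := truncated_mean_split xi T.
  have og := overshoot_mean_le p1 gamma_p T0; have ox := overshoot_mean_le p1 xi_p T0.
  move: mean_eq; rewrite /mean unlock sg sx.
  have fin (X : {RV P0 >-> nat}) : (\int[P0]_w ((X w - T)%:R : R)%:E <= (M * T%:R `^ (1 - p))%:E)%E ->
      exists2 z : R, 0 <= z <= M * T%:R `^ (1 - p) & (\int[P0]_w ((X w - T)%:R : R)%:E)%E = z%:E.
    have : (0 <= \int[P0]_w ((X w - T)%:R : R)%:E)%E.
      by apply: integral_ge0 => w _; rewrite lee_fin.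
    by case: (\int[P0]_w _)%E => // z; rewrite !lee_fin => z0 zM; exists z; rewrite ?z0.
  have [zg /andP[zg0 zgM] ->] := fin _ og; have [zx /andP[zx0 zxM] ->] := fin _ ox.
  rewrite -!EFinD => -[]; rewrite -/mg -/mx => e.
  by rewrite ler_norml; apply/andP; split; lra.
move: g1 x1 g2 x2.
set E1 := [set w | _]; set E2 := [set w | _]; set E3 := [set w | _]; set E4 := [set w | _].
move=> b1 b2 b3 b4.
have mE1 : measurable E1.
  exact: (measurable_attempt (fun g _ => t <= `|(\sum_v minn (g v) T)%:R - n * mg|)).
have mE2 : measurable E2.
  exact: (measurable_attempt (fun _ x => t <= `|(\sum_v minn (x v) T)%:R - n * mx|)).
have mE3 : measurable E3.
  exact: (measurable_attempt (fun g _ => t <= (\sum_v (g v - T))%:R)).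
have mE4 : measurable E4.
  exact: (measurable_attempt (fun _ x => t <= (\sum_v (x v - T))%:R)).
have sub : [set w | c < `|excess (att0 w)|%N%:R] `<=` (E1 `|` E2) `|` (E3 `|` E4).
  move=> w /= cw; apply/not_notP => /not_orP[] /not_orP[n1 n2] /not_orP[n3 n4].
  move: n1 n2 n3 n4; rewrite /E1 /E2 /E3 /E4 /= => /negP + /negP + /negP + /negP.
  rewrite -!ltNge -/mg -/mx => n1 n2 n3 n4.
  move: cw; rewrite abs_excess.
  have split_sum (X : V -> nat) : (\sum_v X v)%N%:R
      = (\sum_v minn (X v) T)%N%:R + (\sum_v (X v - T))%N%:R :> R.
    by rewrite -natrD -big_split /=; congr (_%:R); apply: eq_bigr => v _; exact: minn_addB.
  rewrite (eq_bigr (fun v => ecm_gamma G 0 v w : nat)); last by move=> v _; rewrite ffunE.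
  rewrite [X in _ - X%:R](eq_bigr (fun v => ecm_xi G 0 v w : nat)); last by move=> v _; rewrite ffunE.
  rewrite (split_sum (fun v => ecm_gamma G 0 v w)) (split_sum (fun v => ecm_xi G 0 v w)).
  move: n1 n2 n3 n4.
  move: (\sum_v _)%N (\sum_v _)%N (\sum_v _)%N (\sum_v _)%N => A1 A2 A3 A4 n1 n2 n3 n4.
  apply/negP; rewrite -leNgt; apply: le_trans tc.
  move: n1 n2 n3 n4 mdiff; rewrite -[X in X * `|_|](normr_nat R) -normrM mulrBr.
  rewrite !ltr_norml !ler_norml => /andP[q1 q2] /andP[q3 q4] q5 q6 /andP[q7 q8].
  have := ler0n R A1; have := ler0n R A2; have := ler0n R A3; have := ler0n R A4.
  clear -q1 q2 q3 q4 q5 q6 q7 q8.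
  move=> *; apply/andP; split; lra.
apply: (@le_trans _ _ (pr P E1 + pr P E2 + (pr P E3 + pr P E4))); last first.
  by apply: (le_trans (lerD (lerD b1 b2) (lerD b3 b4))); lra.
apply: le_trans (_ : pr P ((E1 `|` E2) `|` (E3 `|` E4)) <= _).
  apply: pr_le => //; first exact: (measurable_attempt_set [set r : bidegree V | c < `|excess r|%N%:R]).
  by apply: measurableU; exact: measurableU.
apply: (le_trans (prU_le _ _ _)); [exact: measurableU|exact: measurableU|].
by apply: lerD; exact: prU_le.
Qed.

Lemma pr_overflow_ge (T : nat) (x : R) : (0 < T)%N -> 0 < x ->
  pr P [set w | x <= (overflow (att0 w) T)%:R] <= 4 * (n * (M * T%:R `^ (1 - p))) / x.
Proof.
move=> T0 x0; have x2 : 0 < x / 2 by rewrite divr_gt0.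
have g2 := overshoot_sum_markov p1 gamma_p (ecm_gamma_law G_ecm 0) T0 x2.
have h2 := overshoot_sum_markov p1 xi_p (ecm_xi_law G_ecm 0) T0 x2.
move: g2 h2; set E1 := [set w | _]; set E2 := [set w | _] => b1 b2.
have mE1 : measurable E1.
  exact: (measurable_attempt (fun g _ => x / 2 <= (\sum_v (g v - T))%:R)).
have mE2 : measurable E2.
  exact: (measurable_attempt (fun _ g => x / 2 <= (\sum_v (g v - T))%:R)).
apply: (@le_trans _ _ (pr P (E1 `|` E2))).
  apply: pr_le.
  - exact: (measurable_attempt_set [set r : bidegree V | x <= (overflow r T)%:R]).
  - exact: measurableU.
  move=> w /=; rewrite /overflow big_split /= natrD.
  rewrite (eq_bigr (fun v => ecm_gamma G 0 v w - T)%N); last by move=> v _; rewrite ffunE.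
  rewrite [X in _ + X%:R](eq_bigr (fun v => ecm_xi G 0 v w - T)%N); last by move=> v _; rewrite ffunE.
  move=> xle; apply/orP; rewrite /E1 /E2 /= -implyNb; apply/implyP; rewrite -ltNge.
  by move: xle; lra.
apply: (le_trans (prU_le _ mE1 mE2)); apply: (le_trans (lerD b1 b2)).
by rewrite le_eqVlt; apply/orP; left; apply/eqP; field; rewrite gt_eqF.
Qed.

(** The count has mean n q and variance at most n, and t = n q / 2 is used. Both degrees of a vertex
    are prescribed together because the degree that matters at a stub may be of the opposite sign to
    the stub itself. *)
Lemma pr_pair_count_le (i j : nat) :
  let q := pr P0 (gamma @^-1` [set i]) * pr P0 (xi @^-1` [set j]) in
  0 < n -> 0 < q ->
  pr P [set w | (pair_count (att0 w) i j)%:R <= n * q / 2] <= 4 / (n * q ^+ 2).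
Proof.
move=> q n0 q0.
pose A v (k : 'I_1) := ecm_gamma G 0 v @^-1` [set i] `&` ecm_xi G 0 v @^-1` [set j].
have mA v k : measurable (A v k) by apply: measurableI; exact: measurable_RV_preimage.
pose B (e : bool * (nat * V)) : set nat := if e.1 then [set i] else [set j].
have prA v k : pr P (A v k) = q.
  have := @ecm_attempt_independent [:: (true, (0%N, v)); (false, (0%N, v))] B isT.
  rewrite big_cons big_seq1 /= => h.
  transitivity (pr P0 (gamma @^-1` B (true, (0%N, v))) *
                pr P0 (xi @^-1` B (false, (0%N, v)))); last by [].
  rewrite -h; congr (pr P _); apply/seteqP; split => x /=.
    by move=> [gi xj] e; rewrite !inE => /orP[/eqP|/eqP] ->.
  move=> {}h; split; first by have := h (true, (0%N, v)); rewrite inE eqxx /=; exact.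
  by have := h (false, (0%N, v)); rewrite !inE eqxx /=; exact.
have prAA v w k l : v != w -> pr P (A v k `&` A w l) = q * q.
  move=> vw.
  have := @ecm_attempt_independent [:: (true, (0%N, v)); (false, (0%N, v));
    (true, (0%N, w)); (false, (0%N, w))] B.
  rewrite /= !inE !xpair_eqE /= (negbTE vw) /= => /(_ isT).
  rewrite !big_cons big_nil /= => h.
  rewrite (_ : q * q = pr P0 (gamma @^-1` B (true, (0%N, v))) *
   (pr P0 (xi @^-1` B (false, (0%N, v))) * (pr P0 (gamma @^-1` B (true, (0%N, w))) *
    (pr P0 (xi @^-1` B (false, (0%N, w))) * 1)))); last by rewrite /q /B /=; ring.
  rewrite -h; congr (pr P _); apply/seteqP; split => x /=.
    by move=> [[g1 x1] [g2 x2]] e; rewrite !inE => /or4P[]/eqP ->.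
  move=> {}h; split; split.
  - by have := h (true, (0%N, v)); rewrite !inE eqxx /=; exact.
  - by have := h (false, (0%N, v)); rewrite !inE eqxx ?orbT /=; exact.
  - by have := h (true, (0%N, w)); rewrite !inE eqxx ?orbT /=; exact.
  - by have := h (false, (0%N, w)); rewrite !inE eqxx ?orbT /=; exact.
have t0 : 0 < n * q / 2 by rewrite divr_gt0// mulr_gt0.
have := @pr_chebyshev_indic R _ _ P V 1 A (fun=> q) 1 (n * q / 2) mA prA prAA.
move=> /(_ _ t0) h; apply: le_trans (le_trans (h _) _); last first.
- by rewrite le_eqVlt; apply/orP; left; apply/eqP; field; rewrite !gt_eqF.
- by move=> v; rewrite !big_ord1 pr_le1//; exact: measurableI.
have cnt w : \sum_v \sum_k \1_(A v k) w = (pair_count (att0 w) i j)%:R :> R.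
  have -> : pair_count (att0 w) i j =
      (\sum_v ((ecm_gamma G 0 v w == i) && (ecm_xi G 0 v w == j)))%N.
    rewrite /pair_count -sum1dep_card [LHS]big_mkcond /=.
    by apply: eq_bigr => v _; rewrite !ffunE; case: ifP.
  rewrite natr_sum; apply: eq_bigr => v _; rewrite big_ord1 indicE.
  case: (boolP (w \in _)); rewrite ?inE.
    by move=> [/= -> ->]; rewrite !eqxx.
  by move=> /negP; rewrite inE => nA; case: andP => // -[/eqP e1 /eqP e2]; case: nA.
apply: pr_le.
- exact: (measurable_attempt_set [set r : bidegree V | (pair_count r i j)%:R <= n * q / 2]).
- rewrite (_ : mkset _ = att0 @^-1` [set r : bidegree V |
    n * q / 2 <= `|(pair_count r i j)%:R - n * \sum_(k < 1) q|]).
    exact: measurable_attempt_set.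
  by apply/seteqP; split => w /=; rewrite cnt.
move=> w /=; rewrite cnt big_ord1 => le2.
by rewrite distrC; apply: le_trans (ler_norm _); move: le2 t0; lra.
Qed.

Lemma ecm_kept_acceptable w : acceptable c (att0 w) -> ecm_kept G c w = att0 w.
Proof.
move=> acc; rewrite /ecm_kept /first_acceptable.
rewrite (@xget_subset1 _ _ _ 0%N); [by []|by split|].
move=> j k [aj hj] [ak hk]; case: (ltngtP j k) => // jk.
  by case: (hk _ jk).
by case: (hj _ jk).
Qed.

Lemma ecm_kept_countably_measurable : countably_measurable (ecm_kept G c).
Proof.
pose A k := [set w | acceptable c (ecm_attempt G w k)].
have mA k : measurable (A k).
  exact: (@countably_measurable_preimage _ _ _ _ [set r | acceptable c r]
    (ecm_attempt_countably_measurable k)).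
pose F k := A k `&` \bigcap_(j in [set j | (j < k)%N]) ~` A j.
have mF k : measurable (F k).
  apply: measurableI => //; apply: bigcap_measurableType => j _; exact: measurableC.
(* On this event no attempt is acceptable and the index takes its default value 0. *)
pose N := ~` \bigcup_k A k.
have mN : measurable N by apply: measurableC; exact: bigcupT_measurable.
move=> r.
rewrite (_ : _ @^-1` _ = (\bigcup_k (F k `&` (fun w => ecm_attempt G w k) @^-1` [set r]))
   `|` (N `&` (fun w => ecm_attempt G w 0) @^-1` [set r])).
  apply: measurableU.
    apply: bigcupT_measurable => k; apply: measurableI => //.
    exact: ecm_attempt_countably_measurable.
  by apply: measurableI => //; exact: ecm_attempt_countably_measurable.
apply/seteqP; split => w.
  rewrite /ecm_kept /first_acceptable /=.
  case: xgetP => [k _ [ak hk] kr|no kr].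
    by left; exists k; [|split; [split; [exact: ak|exact: hk]|exact: kr]].
  right; split => //; move=> [k _ Ak].
  have exk : exists k, `[< acceptable c (ecm_attempt G w k) >] by exists k; exact/asboolP.
  have := no (ex_minn exk); apply; case: ex_minnP => m /asboolP am mmin; split => // j jm.
  by move=> /asboolP/mmin; rewrite leqNgt jm.
rewrite /ecm_kept /first_acceptable /= => -[[k _ [[ak hk] kr]]|[noA kr]].
  rewrite (@xget_subset1 _ _ _ k); [by []|by split|].
  move=> i j [ai hi] [aj hj]; case: (ltngtP i j) => // ij; first by case: (hj _ ij).
  by case: (hi _ ij).
by case: xgetP => [k _ [ak _]|//]; case: noA; exists k.
Qed.

(** Kept degrees and first attempt differ only when the latter is rejected, so no division by the
    probability of acceptance occurs. *)
Lemma pr_kept_le (B : set (bidegree V)) :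
  pr P (ecm_kept G c @^-1` B) <=
  pr P (att0 @^-1` B) + pr P [set w | c < `|excess (att0 w)|%N%:R].
Proof.
have mB : measurable (att0 @^-1` B) by exact: measurable_attempt_set.
have mE : measurable [set w | c < `|excess (att0 w)|%N%:R].
  exact: (measurable_attempt_set [set r : bidegree V | c < `|excess r|%N%:R]).
apply: le_trans (prU_le P mB mE); apply: pr_le => //.
- exact: countably_measurable_preimage ecm_kept_countably_measurable.
- exact: measurableU.
move=> w /= Bw; have [acc|nacc] := lerP (`|excess (att0 w)|%N%:R) c; last by right.
by left; move: Bw; rewrite /= ecm_kept_acceptable.
Qed.

End Attempts.

(** * The random graph *)

Section GraphLaw.
Context {R : realType}.
Context (d0 : measure_display) (Omega0 : measurableType d0) (P0 : probability Omega0 R).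
Variables (gamma xi : {RV P0 >-> nat}).
Context (d : measure_display) (Omega : measurableType d) (P : probability Omega R).
Context (V : finType) (G : ecm_data P V) (c : R).
Hypothesis G_ecm : is_ecm G gamma xi c.

Lemma countably_measurable_pair (T U : Type) (X : Omega -> T) (Y : Omega -> U) :
  countably_measurable X -> countably_measurable Y ->
  countably_measurable (fun w => (X w, Y w)).
Proof.
move=> mX mY [t u].
rewrite (_ : _ @^-1` _ = X @^-1` [set t] `&` Y @^-1` [set u]).
  exact: measurableI.
by apply/seteqP; split => w /=; [case=> -> ->|case=> -> ->].
Qed.

Lemma ecm_extra_countably_measurable : countably_measurable (ecm_extra G).
Proof. exact: (ecm_extra_measurable G_ecm). Qed.

Lemma ecm_match_preimage_measurable (Q : set (stub_map V)) :
  measurable (ecm_match G @^-1` Q).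
Proof.
pose T : countType := {D : bidegree V & {ffun outbound_stub D -> inbound_stub D}}.
apply: (@countably_measurable_preimage _ _ T).
exact: (ecm_match_measurable G_ecm).
Qed.

Lemma ecm_graph_preimage_measurable (Q : set {set V * V}) :
  measurable (ecm_graph G @^-1` Q).
Proof. exact: (ecm_match_preimage_measurable [set M | Q (erased_edges M)]). Qed.

Lemma ecm_degrees_countably_measurable : countably_measurable (ecm_degrees G c).
Proof.
have := countably_measurable_pair (ecm_kept_countably_measurable G c)
  ecm_extra_countably_measurable.
by move=> /(@countably_measurable_comp _ _ _ _ _ (fun p => balance p.1 p.2)).
Qed.

Lemma to_stub_map_inj (D : bidegree V) : injective (@to_stub_map V D).
Proof. by move=> m m' mm; apply: eq_from_Tagged mm. Qed.

Lemma stub_bijections_gt0 (D : bidegree V) : (\sum_v D.1 v = \sum_v D.2 v)%N ->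
  (0 < #|stub_bijections D|)%N.
Proof.
move=> bal; apply/card_gt0P.
have cc : #|{: outbound_stub D}| = #|{: inbound_stub D}|.
  by rewrite card_outbound card_inbound bal.
exists [ffun s => enum_val (cast_ord cc (enum_rank s))]; rewrite inE.
apply/andP; split.
  by apply/injectiveP => s t; rewrite !ffunE => /enum_val_inj/cast_ord_inj/enum_rank_inj.
apply/forallP => x; apply/codomP.
exists (enum_val (cast_ord (esym cc) (enum_rank x))).
by rewrite ffunE enum_valK cast_ordKV enum_rankK.
Qed.

Lemma balance_balanced (r : bidegree V) (S : {set V}) : #|S| = `|excess r|%N ->
  (\sum_v (balance r S).1 v = \sum_v (balance r S).2 v)%N.
Proof.
have sumS : (\sum_v (v \in S) = #|S|)%N by rewrite -sum1_card [RHS]big_mkcond.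
have sumF (f : {ffun V -> nat}) :
    (\sum_v [ffun v => f v + (v \in S)] v = \sum_v f v + #|S|)%N.
  by rewrite -sumS -big_split /=; apply: eq_bigr => v _; rewrite ffunE.
rewrite /balance /excess => cS; case: ifPn => /= ex; rewrite sumF cS; move: ex.
  lia.
lia.
Qed.

(** Three things may go wrong: the kept degrees are not good, the set of extra stubs has the wrong
    size, or the matching is bad given good balanced degrees. The bound on the excess guarantees
    that vertex sets of the required size exist. *)
Lemma pr_bad_graph (good : set (bidegree V)) (H : set {set V * V}) (theta : R) :
  0 <= theta ->
  (forall r, good r -> (`|excess r| <= #|V|)%N) ->
  (forall r (S : {set V}), good r -> #|S| = `|excess r|%N ->
    #|[set m in stub_bijections (balance r S) |
         ~~ `[< H (erased_edges (to_stub_map m)) >]]%SET|%:R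
      <= #|stub_bijections (balance r S)|%:R * theta) ->
  pr P (ecm_graph G @^-1` (~` H)) <= pr P (ecm_kept G c @^-1` (~` good)) + theta.
Proof.
move=> th0 goodV goodH.
have mK := ecm_kept_countably_measurable G c.
have mD := ecm_degrees_countably_measurable.
pose KX w := (ecm_kept G c w, ecm_extra G w).
have mKX : countably_measurable KX.
  exact: countably_measurable_pair mK ecm_extra_countably_measurable.
pose A := [set w | #|ecm_extra G w| <> `|excess (ecm_kept G c w)|%N].
have mA : measurable A.
  exact: (countably_measurable_preimage [set p : bidegree V * {set V} | #|p.2| <> `|excess p.1|%N] mKX).
(* The prescribed law gives the mass of the sets of the right size only; these masses add up to the
   whole, so that the wrong sizes form a null event. *)
have A0 : pr P (ecm_kept G c @^-1` good `&` A) <= 0.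
  apply: pr_disintegrate => // r goodr; rewrite mulr0.
  have -> : ecm_kept G c @^-1` [set r] `&` A =
     ecm_kept G c @^-1` [set r] `&` ecm_extra G @^-1` [set S : {set V} | #|S| <> `|excess r|%N].
    by apply/seteqP; split => w [/= <-].
  pose Sk := [set S : {set V} | #|S| == `|excess r|%N]%SET.
  have cSk : #|Sk| = 'C(#|V|, `|excess r|).
    by rewrite -card_draws; apply: eq_card => S; rewrite !inE.
  apply: (le_trans (@pr_uniform_choice _ _ _ P _ _ (ecm_extra G) id Sk _ _ _ _ _ _ _)) => //.
  - by move=> Q; exact: countably_measurable_preimage ecm_extra_countably_measurable.
  - by rewrite cSk bin_gt0 goodV.
  - move=> S; rewrite inE => /eqP cS.
    by rewrite /pr (ecm_extra_law G_ecm)// cSk (prE P (mK r)).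
  rewrite (_ : #|_| = 0%N) ?mul0r ?mulr0//.
  apply: eq_card0 => S; rewrite !inE; apply/negP => /andP[/eqP cS /asboolP]; exact.
(* The matching is uniform given the final degrees, so the conditioning is on these, whatever kept
   degrees and extra set produced them. *)
pose GD := [set D : bidegree V | exists r (S : {set V}),
   [/\ good r, #|S| = `|excess r|%N & D = balance r S]].
have D0 : pr P (ecm_degrees G c @^-1` GD `&` ecm_graph G @^-1` (~` H)) <= theta.
  apply: pr_disintegrate => //; first exact: ecm_graph_preimage_measurable.
  move=> D [r [S [goodr cS ->]]].
  have -> : ecm_graph G @^-1` (~` H) = ecm_match G @^-1` [set M | ~ H (erased_edges M)] by [].
  apply: (le_trans (@pr_uniform_choice _ _ _ P _ _ (ecm_match G)
    (@to_stub_map V (balance r S)) (stub_bijections (balance r S)) _ _ _ _ _ _ _)).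
  - exact: ecm_match_preimage_measurable.
  - exact: mD.
  - exact: to_stub_map_inj.
  - by apply: stub_bijections_gt0; exact: balance_balanced.
  - move=> m mB; rewrite /pr (ecm_match_law G_ecm)//.
    by rewrite (prE P (mD _)).
  apply: ler_wpM2l; first exact: pr_ge0.
  rewrite ler_pdivrMr; last by rewrite ltr0n stub_bijections_gt0// balance_balanced.
  rewrite mulrC; apply: le_trans (goodH r S goodr cS).
  rewrite ler_nat; apply: subset_leq_card; apply/fintype.subsetP => m.
  move=> /finset.setIdP[mB /asboolP nH]; apply/finset.setIdP; split=> //.
  exact/asboolPn.
apply: (@le_trans _ _ (pr P (ecm_kept G c @^-1` (~` good)) +
   (pr P (ecm_kept G c @^-1` good `&` A) +
    pr P (ecm_degrees G c @^-1` GD `&` ecm_graph G @^-1` (~` H))))); last first.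
  by rewrite lerD2l; apply: (le_trans (lerD A0 D0)); rewrite add0r.
have mkg (B : set (bidegree V)) : measurable (ecm_kept G c @^-1` B).
  exact: countably_measurable_preimage.
have mGH := ecm_graph_preimage_measurable (~` H).
have mDg : measurable (ecm_degrees G c @^-1` GD) by exact: countably_measurable_preimage.
have mI1 : measurable (ecm_kept G c @^-1` good `&` A) by exact: measurableI.
have mI2 : measurable (ecm_degrees G c @^-1` GD `&` ecm_graph G @^-1` (~` H)).
  exact: measurableI.
apply: (le_trans _ (lerD (lexx _) (prU_le _ mI1 mI2))).
apply: le_trans (prU_le _ _ _) => //; last exact: measurableU.
apply: pr_le => //; first by apply: measurableU => //; exact: measurableU.
move=> w nH; have [gk|ngk] := pselect (good (ecm_kept G c w)); last by left.
right; have [cS|ncS] := pselect (#|ecm_extra G w| = `|excess (ecm_kept G c w)|%N).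
  by right; split => //; exists (ecm_kept G c w), (ecm_extra G w).
by left; split.
Qed.

End GraphLaw.

(** With 2 / 16 + 1 / 8 = 1 / 4, the left side is at most eps times 3/4 c. Here c stands for |E|^3,
    and e for the denominator |E|^3 - |E|, at least 3/4 |E|^3 once |E| >= 2. *)
Lemma perturbed_bound {R : realFieldType} (x y eps c e : R) :
  `|x - y| <= 2 * (eps / 16) * c -> `|y| <= eps / 8 * c -> 3 / 4 * c <= e ->
  0 <= eps -> 3 * `|x| <= eps * e.
Proof.
move=> xy yc ce eps0; have := ler_normD (x - y) y; rewrite subrK.
by have := ler_wpM2l eps0 ce; lra.
Qed.

(** * Discretizing the uniform tie-breakers *)

Section Ties.
Context {R : realType}.
Context (d0 : measure_display) (Omega0 : measurableType d0) (P0 : probability Omega0 R).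
Variables (gamma xi : {RV P0 >-> nat}).
Context (d : measure_display) (Omega : measurableType d) (P : probability Omega R).
Context (V : finType) (G : ecm_data P V) (c : R).
Hypothesis G_ecm : is_ecm G gamma xi c.
Variables (alpha beta : sign) (M : nat).
Local Notation ties := {ffun V * V -> 'I_M.+1}.
Local Notation m g := (@GRing.natmul R 1 #|g|).

Definition bin (j : 'I_M.+1) : interval R := `[j%:R / M.+1%:R, j.+1%:R / M.+1%:R[.

Definition tie_variable (q : bool * (V * V)) : {RV P >-> R} :=
  if q.1 then ecm_U G q.2 else ecm_W G q.2.

Lemma bin_lt (j k : 'I_M.+1) (u v : R) : u \in bin j -> v \in bin k -> (j < k)%N -> u < v.
Proof.
rewrite !in_itv /= => /andP[_ uj] /andP[vk _] jk; apply: lt_le_trans uj _.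
by apply: le_trans vk; rewrite ler_pM2r ?invr_gt0// ler_nat.
Qed.

Lemma bin_eq (j k : 'I_M.+1) (u : R) : u \in bin j -> u \in bin k -> j = k.
Proof.
move=> uj uk; apply/val_inj; case: (ltngtP j k) => //= jk.
  by have := bin_lt uj uk jk; rewrite ltxx.
by have := bin_lt uk uj jk; rewrite ltxx.
Qed.

Lemma bin_unit (j : 'I_M.+1) (u : R) : u \in bin j -> 0 <= u < 1.
Proof.
rewrite in_itv /= => /andP[ju uj]; apply/andP; split.
  by apply: le_trans ju; rewrite divr_ge0.
by apply: lt_le_trans uj _; rewrite ler_pdivrMr// mul1r ler_nat.
Qed.

Lemma measurable_bin q j : measurable [set w | tie_variable q w \in bin j].
Proof.
have := measurable_funPT (tie_variable q) measurableT _ (measurable_itv (bin j)).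
by rewrite setTI.
Qed.

Lemma pr_bin q j : pr P [set w | tie_variable q w \in bin j] = M.+1%:R^-1.
Proof.
have law : distribution P (tie_variable q) = uniform_prob (@ltr01 R).
  by rewrite /tie_variable; case: (q.1); [exact: (ecm_U_law G_ecm)|exact: (ecm_W_law G_ecm)].
have -> : [set w | tie_variable q w \in bin j] = tie_variable q @^-1` [set` bin j] by [].
have mB : measurable [set` bin j] by exact: measurable_itv.
rewrite /pr -[P _]/(distribution P (tie_variable q) _) law.
have -> : uniform_prob (@ltr01 R) [set` bin j] = lebesgue_measure [set` bin j].
  have -> : uniform_prob (@ltr01 R) [set` bin j] =
      (\int[uniform_prob (@ltr01 R)]_x (\1_[set` bin j] x)%:E)%E.
    by rewrite integral_indic// setIT.
  rewrite integral_uniform//; last first.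
    by apply/measurable_EFinP; exact: measurable_indic.
  rewrite subr0 invr1 mul1e integral_indic//.
  congr (lebesgue_measure _); apply/seteqP; split => [u []//|u ub]; split => //.
  have /andP[u0 u1] := bin_unit ub.
  by rewrite /= in_itv /= u0 ltW.
rewrite lebesgue_measure_itv /= lte_fin ltr_pM2r ?invr_gt0// ltr_nat ltnSn /=.
by rewrite -mulrBl -natrB// subSnn mul1r.
Qed.

(** A Boolean matrix instead of a map to bins, because a tie-breaker may lie in no bin on a null
    event. The matrices of genuine assignments are the values of [tie_code]. *)
Definition tie_matrix (w : Omega) : {ffun (bool * (V * V)) * 'I_M.+1 -> bool} :=
  [ffun x => tie_variable x.1 w \in bin x.2].

Definition tie_value_of (z : ties * ties) (q : bool * (V * V)) : 'I_M.+1 :=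
  (if q.1 then z.1 else z.2) q.2.

Definition tie_code (z : ties * ties) : {ffun (bool * (V * V)) * 'I_M.+1 -> bool} :=
  [ffun x => tie_value_of z x.1 == x.2].

Lemma tie_matrix_code w z :
  (tie_matrix w = tie_code z) <-> (forall q, tie_variable q w \in bin (tie_value_of z q)).
Proof.
split=> [/ffunP wz q|wz].
  by have := wz (q, tie_value_of z q); rewrite !ffunE /= eqxx.
apply/ffunP => -[q j]; rewrite !ffunE /=; apply/idP/eqP => [uj|<-]; last exact: wz.
exact: bin_eq (wz q) uj.
Qed.

Lemma tie_code_inj : injective tie_code.
Proof.
move=> z z' /ffunP zz.
have vv q : tie_value_of z q = tie_value_of z' q.
  by have := zz (q, tie_value_of z q); rewrite !ffunE /= eqxx => /esym/eqP.
rewrite [z]surjective_pairing [z']surjective_pairing; congr pair; apply/ffunP => e.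
  exact: (vv (true, e)).
exact: (vv (false, e)).
Qed.

Lemma tie_matrix_measurable (Q : set {ffun (bool * (V * V)) * 'I_M.+1 -> bool}) :
  measurable (tie_matrix @^-1` Q).
Proof.
apply: countably_measurable_preimage => y.
rewrite (_ : _ @^-1` _ = \bigcap_(x in [set: (bool * (V * V)) * 'I_M.+1])
    [set w | (tie_variable x.1 w \in bin x.2) = y x]).
  apply: fin_bigcap_measurable; first exact: finite_finset.
  move=> x _.
  have mB := measurable_bin x.1 x.2.
  case: (y x); first exact: mB.
  rewrite (_ : mkset _ = ~` [set w | tie_variable x.1 w \in bin x.2]).
    exact: measurableC.
  by apply/seteqP; split => w /=; [move=> ->|case: (_ \in _)].
apply/seteqP; split => w /=.
  by move=> <- x _; rewrite /= ffunE.
by move=> h; apply/ffunP => x; rewrite ffunE; exact: h.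
Qed.

Lemma pr_graph_ties g z :
  pr P (ecm_graph G @^-1` [set g] `&` tie_matrix @^-1` [set tie_code z])
  = pr P (ecm_graph G @^-1` [set g]) / #|[set: ties * ties]%SET|%:R.
Proof.
pose A (i : option (bool * (V * V))) : set Omega :=
  if i is Some q then [set w | tie_variable q w \in bin (tie_value_of z q)]
  else ecm_graph G @^-1` [set g].
pose s := None :: [seq Some q | q <- enum {: bool * (V * V)}].
have := @independent_prod R d Omega P _ _ s A (ecm_UW_indep G_ecm).
have us : uniq s.
  rewrite /s /= map_inj_uniq ?enum_uniq ?andbT; last by move=> ? ? [].
  by apply/mapP => -[].
have mA i : measurable (A i).
  case: i => [q|] /=; last exact: ecm_graph_preimage_measurable G_ecm _.
  exact: measurable_bin.
move=> /(_ us) h; rewrite (_ : _ `&` _ = [set w | forall i, i \in s -> A i w]).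
  rewrite h//; last first.
    move=> [[[] e]|] /=; last by exists [set g].
      by exists [set` bin (tie_value_of z (true, e))]; [exact: measurable_itv|].
    by exists [set` bin (tie_value_of z (false, e))]; [exact: measurable_itv|].
  rewrite /s big_cons /= big_map big_enum /= (eq_bigr (fun=> M.+1%:R^-1)); last first.
    by move=> q _; exact: pr_bin.
  have cS : #|[set: ties * ties]%SET| = (M.+1 ^ #|{: bool * (V * V)}|)%N.
    rewrite cardsT [LHS]card_prod [#|{: bool * _}|]card_prod card_bool mul2n -addnn.
    by rewrite expnD !card_ffun card_ord.
  by rewrite prodr_const cS natrX exprVn.
apply/seteqP; split => w /=.
  move=> [wg /tie_matrix_code wz] i; rewrite inE => /orP[/eqP ->//|/mapP[q _ ->]].
  exact: wz.
move=> {}h; split; first by apply: (h None); rewrite inE eqxx.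
apply/tie_matrix_code => q; apply: (h (Some q)).
by rewrite inE /= map_f// mem_enum.
Qed.

(** Overwriting [b e] by an arbitrary value is injective on the colliding functions: the lost value
    is still present at f. *)
Lemma card_tie_collision (e f : V * V) : e != f ->
  (#|[set b : ties | b e == b f]%SET| * M.+1 <= #|{: ties}|)%N.
Proof.
move=> ef.
pose upd (x : ties * 'I_M.+1) : ties := [ffun i => if i == e then x.2 else x.1 i].
have -> : (#|[set b : ties | b e == b f]%SET| * M.+1 =
    #|finset.setX [set b : ties | b e == b f]%SET [set: 'I_M.+1]%SET|)%N.
  by rewrite cardsX cardsT card_ord.
rewrite -(@card_in_imset _ _ upd); first exact: max_card.
move=> [b k] [b' k']; rewrite !inE !andbT /= => /eqP be /eqP be' /ffunP bb.
have kk : k = k' by have := bb e; rewrite !ffunE eqxx.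
have bi i : i != e -> b i = b' i.
  by move=> /negbTE ie; have := bb i; rewrite !ffunE ie.
congr pair => //; apply/ffunP => i; have [->|] := eqVneq i e; last exact: bi.
by rewrite be be' bi// eq_sym.
Qed.

Lemma card_noninjective_ties :
  #|[set b : ties | ~~ injectiveb b]%SET|%:R
    <= #|{: V * V}|%:R ^+ 2 / M.+1%:R * #|{: ties}|%:R :> R.
Proof.
apply: (@le_trans _ _ (\sum_(p : (V * V) * (V * V) | p.1 != p.2)
    #|[set b : ties | b p.1 == b p.2]%SET|%:R)).
  rewrite -natr_sum ler_nat.
  apply: (@leq_trans #|\bigcup_(p : (V * V) * (V * V) | p.1 != p.2)
     [set b : ties | b p.1 == b p.2]%SET|).
    apply: subset_leq_card; apply/fintype.subsetP => b; rewrite inE.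
    move=> /injectivePn[e [f ef bef]]; apply/finset.bigcupP.
    by exists (e, f) => //; rewrite inE bef.
  elim/big_rec2: _ => [|p x B _ IH]; first by rewrite cards0.
  by apply: leq_trans (leq_card_setU _ _) _; rewrite leq_add2l.
apply: (@le_trans _ _ (\sum_(p : (V * V) * (V * V)) #|{: ties}|%:R / M.+1%:R)).
  rewrite big_mkcond /=; apply: ler_sum => p _; case: ifP => // pp.
  by rewrite ler_pdivlMr// -natrM ler_nat card_tie_collision.
rewrite sumr_const [#|{: (V * V) * (V * V)}|]card_prod -[leLHS]mulr_natl natrM.
by rewrite le_eqVlt; apply/orP; left; apply/eqP; ring.
Qed.

(** Offsets in [0, 1) cannot reverse a difference of degrees, and distinct bins decide between equal
    degrees. *)
Lemma rank_compare (D : V * V -> nat) (U : V * V -> R) (b : ties) e f :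
  injective b -> (forall e, U e \in bin (b e)) -> e != f ->
  ((D e)%:R + U e <= (D f)%:R + U f) = (tie_value D b e < tie_value D b f)%N.
Proof.
move=> bI Ub ef; rewrite tie_value_lt.
have /andP[e0 e1] := bin_unit (Ub e); have /andP[f0 f1] := bin_unit (Ub f).
have Dlt x y : (x < y)%N -> x%:R + 1 <= y%:R :> R by rewrite natr1 ler_nat.
case: (ltngtP (D e) (D f)) => [h|h|->] /=.
- by have := Dlt _ _ h; move: e0 e1 f0 f1; lra.
- by apply/negbTE; rewrite -ltNge; have := Dlt _ _ h; move: e0 e1 f0 f1; lra.
rewrite lerD2l; case: (ltngtP (b e) (b f)) => h.
- by rewrite ltW// (bin_lt (Ub e) (Ub f) h).
- by apply/negbTE; rewrite -ltNge (bin_lt (Ub f) (Ub e) h).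
- by move: ef; rewrite (bI _ _ (val_inj h)) eqxx.
Qed.

Lemma tie_value_inj (D : V * V -> nat) (b : ties) :
  injective b -> injective (tie_value D b).
Proof.
move=> bI e f ef; apply: bI; apply/val_inj.
have := tie_value_lt D b e f; have := tie_value_lt D b f e.
rewrite ef ltnn eq_sym.
case: (ltngtP (D e) (D f)) => //= _.
by case: (ltngtP (b e) (b f)).
Qed.

Lemma measurable_sum_in (I : finType) (A : {set I}) (F : I -> Omega -> R) :
  (forall i, measurable_fun setT (F i)) ->
  measurable_fun setT (fun w => \sum_(i in A) F i w).
Proof.
move=> mF; rewrite (_ : (fun w => _) = (fun w => \sum_(i <- enum A) F i w)).
  exact: measurable_sum.
by apply/funext => w; rewrite big_enum.
Qed.

Lemma measurable_spearman_uniform_gt (eps : R) :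
  measurable [set w | eps < `|spearman_uniform (ecm_graph G w) alpha beta
          (fun e => ecm_U G e w) (fun e => ecm_W G e w)|].
Proof.
pose rho g w := spearman_uniform g alpha beta (fun e => ecm_U G e w) (fun e => ecm_W G e w).
have mrank (X : V * V -> {RV P >-> R}) (D : V * V -> nat) g e :
    measurable_fun setT (fun w => rank g D (fun e => X e w) e).
  rewrite /rank; apply: measurable_sum_in => f.
  pose S := [set w | ((D e)%:R + X e w <= (D f)%:R + X f w)%R].
  rewrite (_ : (fun w => _) = (\1_S : Omega -> R)); last first.
    by apply/funext => w; rewrite indicE; congr (nat_of_bool _)%:R; apply/idP/idP; rewrite inE.
  apply: measurable_indic.
  rewrite (_ : S = (fun w => (D f)%:R + X f w - ((D e)%:R + X e w)) @^-1` `[0, +oo[%classic).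
    rewrite -[X in measurable X]setTI; apply: (_ : measurable_fun setT _) => //.
    by apply: measurable_funB; apply: measurable_funD.
  by apply/seteqP; split => w; rewrite /S /= in_itv /= andbT subr_ge0.
have mrho g : measurable_fun setT (rho g).
  apply: measurable_funM => //; apply: measurable_funB => //; apply: measurable_funM => //.
  by apply: measurable_sum_in => e; apply: measurable_funM; exact: mrank.
have mG := ecm_graph_preimage_measurable G_ecm.
have mAg g : measurable [set w | eps < `|rho g w|].
  rewrite (_ : mkset _ = (fun w => `|rho g w|) @^-1` `]eps, +oo[%classic).
    rewrite -[X in measurable X]setTI; apply: (_ : measurable_fun setT _) => //.
    exact: measurableT_comp.
  by apply/seteqP; split => w; rewrite /= in_itv /= andbT.
rewrite (_ : mkset _ = [set w | exists2 g, g \in enum {: {set V * V}} &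
    (ecm_graph G @^-1` [set g] `&` [set w | eps < `|rho g w|]) w]).
  by apply: measurable_exists_in => g; exact: measurableI.
apply/seteqP; split => w; first by move=> Aw; exists (ecm_graph G w); rewrite ?mem_enum.
by move=> [g _ [/= <-]].
Qed.

(** Given the graph, the bins of the tie-breakers are uniform. The first error bounds collisions
    within a bin for either family, and [M] is free to depend on [V]; the second is the Chebyshev
    bound for tie-breaking at precision eps / 16. *)
Lemma pr_spearman_uniform_gt (H : set {set V * V}) (eps : R) (N : nat) :
  0 < eps -> (1 < N)%N ->
  (forall g, H g -> (N <= #|g|)%N /\
    `|spearman_sum g (src_degree g alpha) (tgt_degree g beta)| <= eps / 8 * m g ^+ 3) ->
  pr P [set w | eps < `|spearman_uniform (ecm_graph G w) alpha beta
          (fun e => ecm_U G e w) (fun e => ecm_W G e w)|]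
  <= pr P (ecm_graph G @^-1` (~` H)) +
     (2 * (#|{: V * V}|%:R ^+ 2 / M.+1%:R) + 8 / ((eps / 16) ^+ 2 * N%:R)).
Proof.
move=> eps0 N1 Hgood.
set c0 := 2 * _ + _.
have c00 : 0 <= c0.
  apply: addr_ge0.
    by apply: mulr_ge0 => //; apply: divr_ge0 => //; exact: exprn_ge0.
  by apply: divr_ge0 => //; apply: mulr_ge0 => //; exact: sqr_ge0.
set A := [set w | _].
have mG := ecm_graph_preimage_measurable G_ecm.
have mA : measurable A := measurable_spearman_uniform_gt eps.
have key : pr P (ecm_graph G @^-1` H `&` A) <= c0.
  apply: pr_disintegrate => // g Hg.
  have [Ng Sg] := Hgood g Hg.
  have g0 : 0 < m g by rewrite ltr0n (leq_trans _ Ng)// ltnW.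
  pose D := src_degree g alpha; pose D' := tgt_degree g beta.
  pose bad := [set z : ties * ties | [|| ~~ injectiveb z.1, ~~ injectiveb z.2 |
     2 * (eps / 16) * m g ^+ 3 < `|@spearman_sum R _ g (tie_value D z.2) (tie_value D' z.1)
        - spearman_sum g D D'|]]%SET.
  (* The components are swapped because in [bad] the second one breaks the source ties. Matrices
     that are not codes satisfy [Q] vacuously, but carry no mass. *)
  pose Q := [set y | forall z, y = tie_code z -> (z.2, z.1) \in bad].
  have sub : ecm_graph G @^-1` [set g] `&` A `<=`
      ecm_graph G @^-1` [set g] `&` tie_matrix @^-1` Q.
    move=> w [/= wg]; rewrite /A /= wg => Aw; split => // z /tie_matrix_code wz.
    apply: contraTT Aw; rewrite inE /= !negb_or !negbK -!leNgt.
    move=> /and3P[/injectiveP i2 /injectiveP i1 dev].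
    have U1 e : ecm_U G e w \in bin (z.1 e) by exact: (wz (true, e)).
    have U2 e : ecm_W G e w \in bin (z.2 e) by exact: (wz (false, e)).
    rewrite (@spearman_uniformE _ _ _ _ _ _ _ (tie_value D z.1) (tie_value D' z.2)).
    - have m1 : 2 <= m g by rewrite ler_nat (leq_trans N1).
      have m3 : 3 / 4 * m g ^+ 3 <= m g ^+ 3 - m g.
        rewrite -subr_ge0 (_ : _ - _ = 4^-1 * m g * ((m g - 2) * (m g + 2))); last by field.
        by rewrite !mulr_ge0 ?invr_ge0 ?subr_ge0 ?addr_ge0.
      have m30 : 0 < m g ^+ 3 by rewrite exprn_gt0.
      have den0 : 0 < m g ^+ 3 - m g by apply: lt_le_trans m3; rewrite mulr_gt0 ?divr_gt0.
      rewrite normrM normfV (gtr0_norm den0) ler_pdivrMr// normrM ger0_norm//.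
      exact: (perturbed_bound dev Sg m3 (ltW eps0)).
    - by move=> e f _ _; exact: tie_value_inj.
    - by move=> e f _ _; exact: tie_value_inj.
    - by move=> e f _ _; exact: (rank_compare D i1 U1).
    - by move=> e f _ _; exact: (rank_compare D' i2 U2).
  have cardbad : #|bad|%:R <= #|{: ties * ties}|%:R * c0.
    pose B1 := finset.setX [set b : ties | ~~ injectiveb b]%SET [set: ties]%SET.
    pose B2 := finset.setX [set: ties]%SET [set b : ties | ~~ injectiveb b]%SET.
    pose B3 := [set p : ties * ties | 2 * (eps / 16) * m g ^+ 3 <
      `|@spearman_sum R _ g (tie_value D p.2) (tie_value D' p.1) - spearman_sum g D D'|]%SET.
    have cN : #|{: ties * ties}|%:R = #|{: ties}|%:R * #|{: ties}|%:R :> R.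
      by rewrite card_prod natrM.
    have t0 : 0 < eps / 16 by rewrite divr_gt0.
    have b3 := tie_breaking M.+1 D D' g0 t0; rewrite -/B3 in b3.
    have noninj := card_noninjective_ties.
    have b1 : #|B1|%:R <= #|{: ties * ties}|%:R * (#|{: V * V}|%:R ^+ 2 / M.+1%:R) :> R.
      rewrite cardsX cardsT natrM cN; apply: (le_trans (ler_wpM2r (ler0n R _) noninj)).
      by rewrite le_eqVlt; apply/orP; left; apply/eqP; ring.
    have b2 : #|B2|%:R <= #|{: ties * ties}|%:R * (#|{: V * V}|%:R ^+ 2 / M.+1%:R) :> R.
      rewrite cardsX cardsT natrM cN; apply: (le_trans (ler_wpM2l (ler0n R _) noninj)).
      by rewrite le_eqVlt; apply/orP; left; apply/eqP; ring.
    have {}b3 : #|B3|%:R <= #|{: ties * ties}|%:R * (8 / ((eps / 16) ^+ 2 * N%:R)) :> R.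
      apply: (le_trans b3); rewrite ler_wpM2l// ler_wpM2l//.
      rewrite lef_pV2 ?posrE ?mulr_gt0 ?exprn_gt0 ?ltr0n ?(ltnW N1)//.
        by rewrite ler_wpM2l ?sqr_ge0// ler_nat.
      by rewrite (leq_trans _ Ng)// ltnW.
    apply: (@le_trans _ _ (#|B1|%:R + #|B2|%:R + #|B3|%:R)).
      rewrite -!natrD ler_nat; apply: (@leq_trans #|B1 :|: B2 :|: B3|).
        apply: subset_leq_card; apply/fintype.subsetP => -[a b].
        by rewrite !inE /= andbT orbA.
      apply: leq_trans (leq_card_setU _ _) _; rewrite leq_add2r; exact: leq_card_setU.
    apply: (le_trans (lerD (lerD b1 b2) b3)).
    by rewrite le_eqVlt /c0; apply/orP; left; apply/eqP; ring.
  have S0 : (0 < #|[set: ties * ties]%SET|)%N.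
    by apply/card_gt0P; exists ([ffun=> ord0], [ffun=> ord0]); rewrite inE.
  apply: (le_trans (pr_le P _ _ sub)).
  - by apply: measurableI => //; exact: mG.
  - by apply: measurableI; [exact: mG|exact: tie_matrix_measurable].
  apply: (le_trans (@pr_uniform_choice _ _ _ P _ _ tie_matrix tie_code [set: ties * ties]%SET
    _ Q tie_matrix_measurable (mG _) tie_code_inj S0 (fun z _ => pr_graph_ties g z))).
  rewrite ler_wpM2l ?pr_ge0// ler_pdivrMr ?ltr0n// mulrC cardsT; apply: le_trans cardbad.
  rewrite ler_nat; pose sw (z : ties * ties) := (z.2, z.1).
  rewrite -(card_imset _ (_ : injective sw)); last first.
    by move=> [a b] [a' b'] [-> ->].
  apply: subset_leq_card; apply/fintype.subsetP => _ /imsetP[z + ->].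
  by move=> /finset.setIdP[_ /asboolP]; apply.
have mI : measurable (ecm_graph G @^-1` H `&` A) by apply: measurableI => //; exact: mG.
apply: le_trans (lerD (lexx _) key); apply: le_trans (prU_le _ (mG _) mI).
apply: pr_le => //; first by apply: measurableU => //; exact: mG.
by move=> w Aw; have [Hw|nHw] := pselect (H (ecm_graph G w)); [right|left].
Qed.

End Ties.

(** * Atoms of the degree laws *)

Section Atoms.
Context {R : realType}.
Context (d0 : measure_display) (Omega0 : measurableType d0) (P0 : probability Omega0 R).
Variable X : {RV P0 >-> nat}.
Let q (k : nat) : R := pr P0 (X @^-1` [set k]).

Lemma mean_le_atom (k : nat) :
  (forall j, (0 < j)%N -> j != k -> q j = 0) -> (mean P0 X <= (k%:R * q k)%:E)%E.
Proof.
move=> q0; rewrite /mean unlock.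
pose g j w : R := j%:R * \1_(X @^-1` [set j]) w.
have g0 j w : 0 <= g j w by rewrite mulr_ge0.
have mI j : measurable_fun setT (fun w => (\1_(X @^-1` [set j]) w : R)%:E).
  by apply: measurable_EFin_fun; apply: measurable_indic; exact: measurable_RV_preimage.
have mg j : measurable_fun setT (fun w => (g j w)%:E).
  apply/measurable_EFinP; apply: measurable_funM => //; apply: measurable_indic.
  exact: measurable_RV_preimage.
apply: (@le_trans _ _ (\int[P0]_w (\sum_(0 <= j <oo) (g j w)%:E))%E).
  apply: ge0_le_integral => //.
  - exact/measurable_EFinP/(measurable_RV_comp X (fun j => j%:R)).
  - by apply: ge0_emeasurable_sum => // j w _ _; rewrite lee_fin.
  move=> w _; apply: (@le_trans _ _ (\sum_(0 <= j < (X w).+1) (g j w)%:E)%E).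
    rewrite sumEFin lee_fin big_nat_recr//=.
    apply: (@le_trans _ _ (g (X w) w)); last by rewrite lerDr sumr_ge0.
    by rewrite /g indicE mem_set//= mulr1.
  by apply: nneseries_lim_ge => j _ _; rewrite lee_fin.
rewrite integral_nneseries//; last by move=> j w _; rewrite lee_fin.
have Ig j : (\int[P0]_w (g j w)%:E = (j%:R * q j)%:E)%E.
  rewrite EFinM /q -integral_pr; last exact: measurable_RV_preimage.
  by rewrite -ge0_integralZl_EFin.
apply: lime_le.
  by apply: is_cvg_nneseries => j _ _; rewrite Ig lee_fin mulr_ge0 ?pr_ge0.
apply: nearW => n; rewrite (eq_bigr (fun j => (j%:R * q j)%:E)); last by move=> j _.
rewrite sumEFin lee_fin big_mkord.
apply: (@le_trans _ _ (\sum_(j < n) if (j : nat) == k then k%:R * q k else 0)).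
  apply: ler_sum => j _; case: eqP => [->//|/eqP jk].
  by have [->|j0] := posnP j; rewrite ?mul0r// q0// mulr0.
rewrite -big_mkcond /=; have [kn|kn] := ltnP k n.
  rewrite (bigD1 (Ordinal kn))//= big1 ?addr0// => i /andP[/eqP ik].
  by rewrite -(inj_eq val_inj) /= ik eqxx.
rewrite big1 ?mulr_ge0 ?pr_ge0// => i /eqP ik; move: (ltn_ord i).
by rewrite ik ltnNge kn.
Qed.

Lemma atom_le_mean (k : nat) : ((k%:R * q k)%:E <= mean P0 X)%E.
Proof.
rewrite /mean unlock EFinM /q -integral_pr; last exact: measurable_RV_preimage.
have mI : measurable_fun setT (fun w => (\1_(X @^-1` [set k]) w : R)%:E).
  by apply: measurable_EFin_fun; apply: measurable_indic; exact: measurable_RV_preimage.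
rewrite -ge0_integralZl_EFin//; apply: ge0_le_integral => //.
- by apply: emeasurable_funM.
- exact/measurable_EFinP/(measurable_RV_comp X (fun j => j%:R)).
move=> w _; rewrite -EFinM lee_fin indicE.
case: (boolP (w \in _)); rewrite ?mulr0// inE /= => ->.
by rewrite mulr1.
Qed.

Lemma q_gt0 j : q j <> 0 -> 0 < q j.
Proof. by move=> /eqP qj; rewrite lt0r qj pr_ge0. Qed.

Lemma positive_atom : (0 < mean P0 X)%E -> exists2 k, (0 < k)%N & 0 < q k.
Proof.
move=> m0; apply: contrapT => no.
have := @mean_le_atom 0 _; rewrite mul0r leNgt m0 => /(_ _)/negP; apply => // j j0 _.
by apply: contrapT => /q_gt0 qj; apply: no; exists j.
Qed.

(** If [k] were the only positive atom, the mean would be k q(k), and the size-biased law would give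
    mass 1 to [k]. *)
Lemma two_positive_atoms : (0 < mean P0 X)%E -> (mean P0 X < +oo)%E ->
  ~ concentrated_in_a_point (fun k => k%:R * q k / fine (mean P0 X)) ->
  exists i j, [/\ (0 < i)%N, (0 < j)%N, i != j, 0 < q i & 0 < q j].
Proof.
move=> m0 mfin nconc; have [k k0 qk] := positive_atom m0.
apply: contrapT => no; apply: nconc; exists k.
have -> : mean P0 X = (k%:R * q k)%:E.
  apply/eqP; rewrite eq_le atom_le_mean andbT; apply: mean_le_atom => j j0 jk.
  by apply: contrapT => /q_gt0 qj; apply: no; exists j, k.
by rewrite /= divff// mulf_neq0 ?gt_eqF ?ltr0n.
Qed.

(** A set without atoms is null by countability, so an atom without a companion would have
    probability 1. *)
Lemma two_atoms : ~ concentrated_in_a_point q ->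
  exists i j, [/\ i != j, 0 < q i & 0 < q j].
Proof.
move=> nconc; apply: contrapT => no; apply: nconc.
have mX : countably_measurable (X : _ -> nat) by move=> k; exact: measurable_RV_preimage.
have rest (B : set nat) : (forall j, B j -> q j = 0) -> pr P0 (X @^-1` B) = 0.
  move=> B0; apply/eqP; rewrite eq_le pr_ge0 andbT -[X @^-1` B]setIT.
  by apply: (pr_disintegrate mX) => // j Bj; rewrite setIT mulr0 -/(q j) B0.
have [k qk] : exists k, 0 < q k.
  apply: contrapT => nok; have := rest setT; rewrite preimage_setT prT => h.
  have /eqP : 1 = 0 :> R by apply: h => j _; apply: contrapT => /q_gt0 qj; apply: nok; exists j.
  by rewrite oner_eq0.
exists k; have := rest (~` [set k]); rewrite -preimage_setC prC; last exact: mX.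
move=> h; apply/eqP; rewrite eq_sym -subr_eq0; apply/eqP; apply: h => j /= jk.
by apply: contrapT => /q_gt0 qj; apply: no; exists j, k; split=> //; apply/eqP.
Qed.

End Atoms.

Section BalancedDegrees.
Context {V : finType}.
Variables (r : bidegree V) (S : {set V}).

Lemma balance_bounds v :
  [/\ (r.1 v <= (balance r S).1 v <= r.1 v + (v \in S))%N &
      (r.2 v <= (balance r S).2 v <= r.2 v + (v \in S))%N].
Proof. by rewrite /balance; case: ifP => _ /=; rewrite ?ffunE ?leqnn ?leq_addr. Qed.

(** Balancing adds at most one stub to a vertex, which raising the level by one absorbs. *)
Lemma overflow_balance K : (overflow (balance r S) K.+1 <= overflow r K)%N.
Proof.
apply: leq_sum => v _; have [/andP[_ h1] /andP[_ h2]] := balance_bounds v.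
have vS : ((v \in S) <= 1)%N by case: (v \in S).
by lia.
Qed.

Lemma pair_count_balance i j :
  (pair_count r i j <= pair_count (balance r S) i j + #|S|)%N.
Proof.
apply: leq_trans (leq_card_setU _ _); apply: subset_leq_card.
apply/fintype.subsetP => v; rewrite !inE => /andP[/eqP <- /eqP <-].
have [/andP[h1 h2] /andP[h3 h4]] := balance_bounds v.
case: (v \in S) h2 h4; rewrite ?orbT// !addn0 => h2 h4.
by rewrite eq_sym eqn_leq h1 h2 eq_sym eqn_leq h3 h4.
Qed.

End BalancedDegrees.

Section DegreeCounts.
Context {V : finType}.
Variable D : bidegree V.

(** Each counted vertex carries at least one outbound stub, as x.2 > 0. *)
Lemma pair_count_outbound sg (x : nat * nat) : (0 < x.2)%N ->
  (pair_count D x.1 x.2 <= #|[set s : outbound_stub D |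
     stub_degree D sg (tag s) == if sg is Plus then x.2 else x.1]%SET|)%N.
Proof.
move=> x2; rewrite (card_stubs D.2 (fun v => stub_degree D sg v == _)).
rewrite /pair_count -sum1dep_card big_mkcond [leqRHS]big_mkcond /=.
apply: leq_sum => v _; case: ifP => // /andP[/eqP e1 /eqP e2].
by case: sg; rewrite /stub_degree /= ?e1 ?e2 eqxx ?e1 ?e2.
Qed.

Lemma pair_count_inbound sg (x : nat * nat) : (0 < x.1)%N ->
  (pair_count D x.1 x.2 <= #|[set s : inbound_stub D |
     stub_degree D sg (tag s) == if sg is Plus then x.2 else x.1]%SET|)%N.
Proof.
move=> x1; rewrite (card_stubs D.1 (fun v => stub_degree D sg v == _)).
rewrite /pair_count -sum1dep_card big_mkcond [leqRHS]big_mkcond /=.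
apply: leq_sum => v _; case: ifP => // /andP[/eqP e1 /eqP e2].
by case: sg; rewrite /stub_degree /= ?e1 ?e2 eqxx ?e1 ?e2.
Qed.

Lemma card_outbound_le K : (#|{: outbound_stub D}| <= #|V| * K + overflow D K)%N.
Proof.
rewrite card_outbound /overflow -sum_nat_const -big_split /=.
by apply: leq_sum => v _; lia.
Qed.

End DegreeCounts.

Definition select (sg : sign) (x : nat * nat) : nat := if sg is Plus then x.2 else x.1.

Section GoodDegrees.
Context {R : realFieldType} {V : finType}.
Variables (alpha beta : sign) (l : seq (nat * nat)) (sp tp : Prop).
Variables (q C eta : R) (K1 K2 : nat).
Local Notation n := (@GRing.natmul R 1 #|V|).

(* A dirty stub spoils the stubs of its two ends, hence of the order of [K1]
   stubs apart from those of vertices of degree above [K1]; the fraction of dirty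
   stubs must thus be small with respect to [eta / K1], which the smaller overflow
   at level [K2] ensures. *)
Record good_degrees (r : bidegree V) : Prop := GoodDegrees {
  good_excess : `|excess r|%N%:R <= q / 2 * n ;
  good_overflow : (overflow r 1)%:R <= C * n ;
  good_overflow1 : (overflow r K1)%:R <= eta * q / 6 * n ;
  good_overflow2 : (overflow r K2)%:R <= eta * q / (48 * K1.+2%:R) * n ;
  good_count : forall x, x \in l -> q * n <= (pair_count r x.1 x.2)%:R }.

Definition matching_error : R :=
  8 / eta ^+ 2 + (2 * K2.+1%:R + 8 * K2.+1%:R ^+ 2) * (12 * K1.+2%:R) / eta.

Let x : R := q / 2 / (2 + C).

Hypotheses (q0 : 0 < q) (C0 : 0 <= C) (eta0 : 0 < eta) (eta2 : eta <= 2^-1).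
Hypothesis eta_x : 2 * eta <= x.
Hypothesis big_n : 2 <= q / 2 * n.
Hypothesis atom : exists2 x, x \in l & (0 < x.2)%N.
Hypothesis src_atoms : sp -> exists x1 x2, [/\ x1 \in l, x2 \in l,
  (0 < x1.2)%N, (0 < x2.2)%N & select alpha x1 != select alpha x2].
Hypothesis tgt_atoms : tp -> exists x1 x2, [/\ x1 \in l, x2 \in l,
  (0 < x1.1)%N, (0 < x2.1)%N & select beta x1 != select beta x2].

(** Balancing disturbs at most q n / 2 of the q n vertices of each listed type, so q n / 2 remain,
    while L <= 2 n + C n by the overflow at level 1. The quotient is [x], the guaranteed fraction of
    stubs at an atom. The bound |E| >= L / 2 >= q n / 4 explains the condition on [N]. *)
Lemma good_degrees_bad_matchings (r : bidegree V) (S : {set V}) (N : R) :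
  good_degrees r -> #|S| = `|excess r|%N -> N <= q / 4 * n ->
  #|[set m in stub_bijections (balance r S) | ~~ `[< good_graph
       (erased_edges (to_stub_map m)) alpha beta N (56 * eta) (4^-1 * x ^+ 3) sp tp >]]%SET|%:R
  <= #|stub_bijections (balance r S)|%:R * (matching_error / (q / 2 * n)).
Proof.
move=> [exc ov ov1 ov2 cnt] cS NL; set D := balance r S.
pose L : R := @GRing.natmul R 1 #|{: outbound_stub D}|.
have n0 : 0 < n.
  have : 0 < q / 2 * n by apply: lt_le_trans big_n.
  by rewrite pmulr_rgt0// divr_gt0.
have count_D y : y \in l -> q / 2 * n <= (pair_count D y.1 y.2)%:R.
  move=> /cnt cy.
  have : (pair_count r y.1 y.2)%:R <= (pair_count D y.1 y.2)%:R + #|S|%:R :> R.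
    by rewrite -natrD ler_nat pair_count_balance.
  rewrite cS => h; have := le_trans cy h; move: exc; lra.
have Llow : q / 2 * n <= L.
  have [y yl y2] := atom; apply: (le_trans (count_D y yl)); rewrite ler_nat.
  by apply: leq_trans (pair_count_outbound D Plus y2) _; exact: max_card.
have Lhigh : L <= (2 + C) * n.
  have : L <= n * 2 + (overflow D 2)%:R by rewrite -natrM -natrD ler_nat card_outbound_le.
  have : (overflow D 2)%:R <= (overflow r 1)%:R :> R by rewrite ler_nat overflow_balance.
  by move: ov; lra.
have C2 : 0 < 2 + C by apply: ltr_wpDr.
have xL : x * L <= q / 2 * n.
  rewrite /x mulrAC ler_pdivrMr// -[leRHS]mulrA [_ * (2 + C)]mulrC.
  by apply: ler_wpM2l => //; rewrite divr_ge0// ltW.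
have L0 : 0 < L by apply: lt_le_trans Llow; apply: lt_le_trans big_n.
have bal := balance_balanced cS.
have L2 : (2 <= #|{: outbound_stub D}|)%N.
  by rewrite -(ler_nat R); exact: le_trans Llow.
have o1 : (overflow D K1.+1)%:R <= 3^-1 * eta * L.
  apply: (@le_trans _ _ (overflow r K1)%:R); first by rewrite ler_nat overflow_balance.
  apply: (le_trans ov1); rewrite (_ : eta * q / 6 * n = 3^-1 * eta * (q / 2 * n)); last by field.
  by rewrite ler_wpM2l// mulr_ge0 ?invr_ge0// ltW.
have o2 : (overflow D K2.+1)%:R <= eta / (24 * K1.+2%:R) * L.
  apply: (@le_trans _ _ (overflow r K2)%:R); first by rewrite ler_nat overflow_balance.
  apply: (le_trans ov2).
  rewrite (_ : eta * q / _ * n = eta / (24 * K1.+2%:R) * (q / 2 * n)); last by field.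
  by rewrite ler_wpM2l// divr_ge0 ?ltW// mulr_gt0.
have ss : sp -> exists i j, [/\ i != j,
  x * L <= #|[set s : outbound_stub D | stub_degree D alpha (tag s) == i]%SET|%:R &
  x * L <= #|[set s : outbound_stub D | stub_degree D alpha (tag s) == j]%SET|%:R].
  move=> /src_atoms[x1 [x2 [l1 l2 p1 p2 ne]]]; exists (select alpha x1), (select alpha x2).
  split=> //; apply: (le_trans xL).
    by apply: (le_trans (count_D _ l1)); rewrite ler_nat; exact: pair_count_outbound.
  by apply: (le_trans (count_D _ l2)); rewrite ler_nat; exact: pair_count_outbound.
have ts : tp -> exists i j, [/\ i != j,
  x * L <= #|[set s : inbound_stub D | stub_degree D beta (tag s) == i]%SET|%:R &
  x * L <= #|[set s : inbound_stub D | stub_degree D beta (tag s) == j]%SET|%:R].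
  move=> /tgt_atoms[x1 [x2 [l1 l2 p1 p2 ne]]]; exists (select beta x1), (select beta x2).
  split=> //; apply: (le_trans xL).
    by apply: (le_trans (count_D _ l1)); rewrite ler_nat; exact: pair_count_inbound.
  by apply: (le_trans (count_D _ l2)); rewrite ler_nat; exact: pair_count_inbound.
have := @bad_matchings R V D alpha beta eta x K1.+1 K2.+1 sp tp eta0 eta2 bal L2 o1 o2 eta_x ss ts.
move=> bm; apply: le_trans (le_trans bm _).
  rewrite ler_nat; apply: subset_leq_card; apply/fintype.subsetP => m.
  move=> /finset.setIdP[mB /asboolP bad]; apply/finset.setIdP; split=> //.
  apply/asboolP => -[g1 g2 g3 g4 g5]; apply: bad; split=> //.
  apply: le_trans g1; apply: (le_trans NL); rewrite -/L.
  by rewrite (_ : q / 4 * n = q / 2 * n / 2); [rewrite ler_pM2r|field].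
have error0 : 0 <= matching_error.
  have e0 := ltW eta0; rewrite /matching_error; apply: addr_ge0.
    by apply: divr_ge0; rewrite ?exprn_ge0.
  rewrite divr_ge0// mulr_ge0 ?addr_ge0 ?mulr_ge0 ?exprn_ge0//.
apply: ler_wpM2l => //; apply: ler_wpM2l => //.
by rewrite lef_pV2 ?posrE// mulr_gt0// divr_gt0.
Qed.

End GoodDegrees.

(** * Large graphs *)

Section PowerAsymptotics.
Context {R : realType}.

Lemma near_powRN_le (s z : R) : 0 < s -> 0 < z -> \forall n \near \oo, n%:R `^ (- s) <= z.
Proof.
move=> s0 z0; have zs0 : 0 < z `^ (- s^-1) by exact: powR_gt0.
near=> n.
have nz : z `^ (- s^-1) <= n%:R by near: n; exact: nbhs_infty_ger.
have ns : z^-1 <= n%:R `^ s.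
  apply: (@le_trans _ _ ((z `^ (- s^-1)) `^ s)); last first.
    by apply: ge0_ler_powR nz; rewrite ?nnegrE ?ler0n ?(ltW s0) ?(ltW zs0).
  by rewrite -powRrM mulNr mulVf ?gt_eqF// powR_inv1// ltW.
by rewrite powRN -[leRHS]invrK lef_pV2// posrE ?invr_gt0// (lt_le_trans _ ns)// invr_gt0.
Unshelve. all: by end_near. Qed.

Lemma truncation_level (x : R) : 1 <= x -> exists T : nat, (0 < T)%N /\ x <= T%:R <= 2 * x.
Proof.
move=> x1; exists (Num.trunc x).+1; split=> //.
have x0 : 0 <= x by apply: le_trans x1.
by have := truncnS_gt x; have := truncn_le x; rewrite x0 -[_.+1]addn1 natrD; lra.
Qed.

(** Used with X = n^(1/p), so that X^p = n: at truncation level about X, the total overshoot is of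
    order X and the variance of the truncated sum of order X^2. *)
Lemma truncated_powers_le (X T p : R) : 1 < p -> p < 2 -> 0 < X -> X <= T <= 2 * X ->
  X `^ p * T `^ (1 - p) <= X /\ X `^ p * T `^ (2 - p) <= 2 * X ^+ 2.
Proof.
move=> p1 p2 X0 /andP[XT TX]; have T0 : 0 < T by exact: lt_le_trans XT.
have Xn0 : X != 0 by rewrite gt_eqF.
split.
  rewrite (_ : 1 - p = - (p - 1)); last by ring.
  rewrite powRN ler_pdivrMr ?powR_gt0//.
  apply: (@le_trans _ _ (X * X `^ (p - 1))).
    by rewrite mulrC -{3}[X]powRr1 ?(ltW X0)// -powRD ?Xn0 ?implybT// subrK.
  by rewrite ler_pM2l//; apply: ge0_ler_powR; rewrite ?nnegrE; lra.
apply: (@le_trans _ _ (X `^ p * (2 * X) `^ (2 - p))).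
  by rewrite ler_wpM2l ?powR_ge0//; apply: ge0_ler_powR; rewrite ?nnegrE; lra.
rewrite powRM; [|lra|lra]; rewrite mulrCA -powRD ?Xn0 ?implybT//.
rewrite (_ : p + (2 - p) = 2%:R) ?powR_mulrn; [|lra|ring].
rewrite ler_wpM2r ?exprn_ge0 ?(ltW X0)// -[leRHS]powRr1//.
by apply: ler_powR; lra.
Qed.

End PowerAsymptotics.

Lemma four_div_sqr_le (R : realFieldType) (n q r : R) : 0 < n -> 0 < q -> 2 * q <= r ->
  4 / (n * r ^+ 2) <= 1 / (q ^+ 2 * n).
Proof.
move=> n0 q0 qr; have r0 : 0 < r by apply: lt_le_trans qr; rewrite mulr_gt0.
have h : 2 / r <= q^-1 by rewrite ler_pdivrMr// mulrC ler_pdivlMr.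
rewrite (_ : 4 / _ = (2 / r) ^+ 2 / n); last by field; rewrite !gt_eqF.
rewrite (_ : 1 / _ = q^-1 ^+ 2 / n); last by field; rewrite !gt_eqF.
by rewrite ler_pM2r ?invr_gt0// ler_sqr ?nnegrE ?invr_ge0 ?divr_ge0 ?(ltW r0) ?(ltW q0).
Qed.

Section ManyVertices.
Context {R : realType}.
Context (d0 : measure_display) (Omega0 : measurableType d0) (P0 : probability Omega0 R).
Variables (gamma xi : {RV P0 >-> nat}) (p M s : R).
Hypotheses (p1 : 1 < p) (p2 : p < 2) (M0 : 0 <= M).
Hypothesis gamma_p : (\int[P0]_w ((gamma w)%:R `^ p)%:E <= M%:E)%E.
Hypothesis xi_p : (\int[P0]_w ((xi w)%:R `^ p)%:E <= M%:E)%E.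
Hypothesis mean_eq : mean P0 gamma = mean P0 xi.
Hypotheses (p_s : p^-1 < s) (s1 : s < 1).
Context (d : nat -> measure_display) (Omega : forall n, measurableType (d n)).
Context (P : forall n, probability (Omega n) R).
Context (V : nat -> finType) (card_V : forall n, #|V n| = n).
Context (G : forall n, ecm_data (P n) (V n)).
Hypothesis G_ecm : forall n, is_ecm (G n) gamma xi (n%:R `^ s).

Lemma near_acceptable (theta : R) : 0 < theta -> \forall n \near \oo,
  pr (P n) [set w | n%:R `^ s < `|excess (ecm_attempt (G n) w 0)|%N%:R] <= theta.
Proof.
(* With z = n^(1/p - s), which tends to 0, and t = n^s / 5, the two errors are at most 5 M z and 50
   M z^2. Doubled, they amount to at most 110 M z; the 1 added to [M] keeps the divisor positive. *)
move=> theta0; pose z0 := Num.min 1 theta / (110 * (M + 1)).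
have m0 : 0 < Num.min 1 theta by rewrite lt_min ltr01.
have M1 : 0 < 110 * (M + 1) by move: M0; lra.
have z00 : 0 < z0 by rewrite /z0 divr_gt0.
have sp0 : 0 < s - p^-1 by rewrite subr_gt0.
near=> n.
have n0 : 0 < (n%:R : R) by rewrite ltr0n; near: n; exact: nbhs_infty_gt.
have n1 : (1 : R) <= n%:R by rewrite ler1n -(ltr0n R).
have zz : n%:R `^ (- (s - p^-1)) <= z0 by near: n; exact: near_powRN_le.
set z := _ `^ _ in zz; pose X : R := n%:R `^ p^-1.
have z_gt0 : 0 < z by exact: powR_gt0.
have X0 : 0 < X by exact: powR_gt0.
have q0 : 0 < n%:R `^ s :> R by exact: powR_gt0.
have p_gt0 : 0 < p by move: p1; lra.
have Xz : X = z * n%:R `^ s.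
  have nn0 : n%:R != 0 :> R by rewrite gt_eqF.
  by rewrite /z /X -powRD ?nn0 ?implybT// opprB subrK.
have Xp : n%:R = X `^ p by rewrite /X -powRrM mulVf ?gt_eqF// powRr1// ltW.
have X1 : 1 <= X.
  by rewrite -(powRr0 n%:R) /X ler_powR// invr_ge0 ltW.
have [T [T0 XT]] := truncation_level X1.
have [b1 b2] := truncated_powers_le p1 p2 X0 XT.
have key : z * (110 * (M + 1)) <= Num.min 1 theta by rewrite -ler_pdivlMr.
have [k1 k2] : z * (110 * (M + 1)) <= 1 /\ z * (110 * (M + 1)) <= theta.
  by move: key; rewrite le_min => /andP.
have Mz : 0 <= M * z by rewrite mulr_ge0// ltW.
have e1 : n%:R * (M * T%:R `^ (1 - p)) <= 5 * (M * z) * (n%:R `^ s / 5).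
  rewrite mulrCA Xp; apply: le_trans (ler_wpM2l M0 b1) _.
  by rewrite -Xp Xz le_eqVlt; apply/orP; left; apply/eqP; field.
have e2 : n%:R * (M * T%:R `^ (2 - p)) <= 50 * (M * z ^+ 2) * (n%:R `^ s / 5) ^+ 2.
  rewrite mulrCA Xp; apply: le_trans (ler_wpM2l M0 b2) _.
  by rewrite -Xp Xz le_eqVlt; apply/orP; left; apply/eqP; field.
have t0 : 0 < n%:R `^ s / 5 :> R by rewrite divr_gt0.
have := @pr_excess_gt R d0 Omega0 P0 gamma xi p M p1 p2 gamma_p xi_p (d n) (Omega n) (P n)
  (V n) (G n) _ (G_ecm n) T (n%:R `^ s / 5) mean_eq T0 t0.
rewrite (card_V n) => exc.
have c1 : n%:R * (M * T%:R `^ (1 - p)) <= n%:R `^ s / 5.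
  apply: (le_trans e1); rewrite -[leRHS]mul1r ler_wpM2r ?(ltW t0)//; move: k1 Mz z_gt0; lra.
have c2 : 5 * (n%:R `^ s / 5) <= n%:R `^ s :> R by rewrite mulrC divfK.
apply: le_trans (exc c1 c2) _.
have f1 : n%:R * (M * T%:R `^ (1 - p)) / (n%:R `^ s / 5) <= 5 * (M * z) by rewrite ler_pdivrMr.
have f2 : n%:R * (M * T%:R `^ (2 - p)) / (n%:R `^ s / 5) ^+ 2 <= 50 * (M * z ^+ 2).
  by rewrite ler_pdivrMr ?exprn_gt0.
have z1 : z <= 1 by move: k1 Mz z_gt0; lra.
have : M * z ^+ 2 <= M * z by rewrite ler_wpM2l// expr2 -[leRHS]mulr1 ler_wpM2l// ltW.
by move: f1 f2 k2 Mz z_gt0; lra.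
Unshelve. all: by end_near. Qed.
Section Degrees.
Variables (l : seq (nat * nat)) (q C eta : R).
Hypotheses (q0 : 0 < q) (C0 : 0 < C) (eta0 : 0 < eta).
Hypothesis l_q : forall x, x \in l ->
  2 * q <= pr P0 (gamma @^-1` [set x.1]) * pr P0 (xi @^-1` [set x.2]).

Lemma overflow_level (x theta : R) : 0 < x -> 0 < theta ->
  exists2 K, (0 < K)%N & 4 * M * K%:R `^ (1 - p) / x <= theta.
Proof.
move=> x0 theta0; have z0 : 0 < theta * x / (4 * M + 1).
  by rewrite !(divr_gt0, mulr_gt0)// ltr_wpDl// mulr_ge0.
have p10 : 0 < p - 1 by rewrite subr_gt0.
have := near_powRN_le p10 z0; rewrite opprB => -[N _ NP].
exists N.+1 => //; have := NP N.+1 (leqnSn N) => /=.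
rewrite ler_pdivlMr; last by rewrite ltr_wpDl// mulr_ge0.
rewrite ler_pdivrMr//; have := powR_ge0 N.+1%:R (1 - p); set y := _ `^ _.
lra.
Qed.

Lemma pr_overflow_gt (n K : nat) (x : R) : (0 < n)%N -> (0 < K)%N -> 0 < x ->
  pr (P n) [set w | x * n%:R <= (overflow (ecm_attempt (G n) w 0) K)%:R]
  <= 4 * M * K%:R `^ (1 - p) / x.
Proof.
move=> n0 K0 x0; have nR : 0 < n%:R :> R by rewrite ltr0n.
have xn : 0 < x * n%:R by rewrite mulr_gt0.
have := pr_overflow_ge p1 gamma_p xi_p (G_ecm n) K0 xn; rewrite card_V => /le_trans; apply.
by rewrite le_eqVlt; apply/orP; left; apply/eqP; field; rewrite !gt_eqF.
Qed.

(** [K1] is chosen first, since the tolerance at level [K2] depends on it. The five terms are the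
    three overflows and the rejection of the first attempt, counted twice: once for the bound on the
    excess and once for passing to the kept degrees. *)
Lemma near_good_degrees (theta : R) : 0 < theta -> 4 * M / C <= theta ->
  exists K1 K2, \forall n \near \oo,
    pr (P n) (ecm_kept (G n) (n%:R `^ s) @^-1` (~` good_degrees l q C eta K1 K2))
    <= (5 + (size l)%:R) * theta.
Proof.
move=> theta0 C_theta.
have x1 : 0 < eta * q / 6 by rewrite divr_gt0 ?mulr_gt0.
have [K1 K10 K1P] := overflow_level x1 theta0; exists K1.
have x2 : 0 < eta * q / (48 * K1.+2%:R) by rewrite divr_gt0 ?mulr_gt0.
have [K2 K20 K2P] := overflow_level x2 theta0; exists K2.
have q2 : 0 < q / 2 by rewrite divr_gt0.
have s10 : 0 < 1 - s by rewrite subr_gt0.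
near=> n.
have n0 : (0 < n)%N by near: n; exact: nbhs_infty_gt.
have nR : 0 < n%:R :> R by rewrite ltr0n.
have ns : n%:R `^ s <= q / 2 * n%:R.
  have : n%:R `^ (- (1 - s)) <= q / 2 by near: n; exact: near_powRN_le.
  have nn0 : n%:R != 0 :> R by rewrite gt_eqF.
  rewrite -(ler_pM2r nR) -{2}[n%:R]powRr1 ?ler0n// -powRD ?nn0 ?implybT//.
  by rewrite opprB subrK.
have acc : pr (P n) [set w | n%:R `^ s < `|excess (ecm_attempt (G n) w 0)|%N%:R] <= theta.
  by near: n; exact: near_acceptable.
have cnt : 1 / (q ^+ 2 * n%:R) <= theta.
  have : (theta * q ^+ 2)^-1 <= n%:R by near: n; exact: nbhs_infty_ger.
  rewrite ler_pdivrMr ?mulr_gt0 ?exprn_gt0// => h.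
  have h0 : 0 < theta * q ^+ 2 by rewrite mulr_gt0 ?exprn_gt0.
  by rewrite mulrA -[leLHS](mulfV (lt0r_neq0 h0)) ler_pM2l.
pose att w := ecm_attempt (G n) w 0.
pose E1 := [set w | n%:R `^ s < `|excess (att w)|%N%:R].
pose O (x : R) K := [set w | x * n%:R <= (overflow (att w) K)%:R].
pose Q (x : nat * nat) := [set w | (pair_count (att w) x.1 x.2)%:R <=
   n%:R * (pr P0 (gamma @^-1` [set x.1]) * pr P0 (xi @^-1` [set x.2])) / 2].
have mE1 : measurable E1.
  exact: (measurable_attempt_set (G n) [set r | n%:R `^ s < `|excess r|%N%:R]).
have mO x K : measurable (O x K).
  exact: (measurable_attempt_set (G n) [set r | x * n%:R <= (overflow r K)%:R]).
have mQ x : measurable (Q x).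
  exact: (measurable_attempt_set (G n) [set r | (pair_count r x.1 x.2)%:R <=
   n%:R * (pr P0 (gamma @^-1` [set x.1]) * pr P0 (xi @^-1` [set x.2])) / 2]).
have bQ x : x \in l -> pr (P n) (Q x) <= theta.
  move=> xl; have := l_q xl; set r := pr P0 _ * _ => qr.
  have r0 : 0 < r by apply: lt_le_trans qr; rewrite mulr_gt0.
  have := @pr_pair_count_le _ _ _ _ _ _ _ _ _ _ _ _ (G_ecm n) x.1 x.2.
  rewrite /= card_V => /(_ nR r0)/le_trans; apply; apply: le_trans cnt.
  exact: four_div_sqr_le.
have mU : measurable [set w | exists2 x, x \in l & Q x w] by exact: measurable_exists_in.
have bU : pr (P n) [set w | exists2 x, x \in l & Q x w] <= (size l)%:R * theta.
  apply: (le_trans (pr_exists_le (P n) l mQ)).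
  rewrite big_seq; apply: le_trans (ler_sum _ bQ) _.
  by rewrite -big_seq big_const_seq count_predT iter_addr_0 mulr_natl.
pose B4 := O (eta * q / (48 * K1.+2%:R)) K2 `|` [set w | exists2 x, x \in l & Q x w].
pose B3 := O (eta * q / 6) K1 `|` B4.
pose B2 := O C 1%N `|` B3.
have mB4 : measurable B4 by exact: measurableU.
have mB3 : measurable B3 by exact: measurableU.
have mB2 : measurable B2 by exact: measurableU.
have sub : att @^-1` (~` good_degrees l q C eta K1 K2) `<=` E1 `|` B2.
  move=> w /= bad; apply: contrapT => /not_orP[ne1 /not_orP[ne2 /not_orP[ne3 /not_orP[ne4 ne5]]]].
  apply: bad; split; rewrite ?card_V.
  - by apply: le_trans ns; rewrite leNgt; apply/negP.
  - by rewrite ltW// ltNge; apply/negP.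
  - by rewrite ltW// ltNge; apply/negP.
  - by rewrite ltW// ltNge; apply/negP.
  - move=> x xl; have h : ~ Q x w by move=> Qx; apply: ne5; exists x.
    move: h => /negP; rewrite -ltNge => /ltW; apply: le_trans.
    by rewrite mulrC -mulrA ler_wpM2l ?ler0n// ler_pdivlMr// mulrC l_q.
apply: (le_trans (pr_kept_le _ _ _)).
have o1 : pr (P n) (O C 1%N) <= theta.
  by apply: le_trans (pr_overflow_gt n0 _ C0) _ => //; rewrite powR1 mulr1.
have o2 := le_trans (pr_overflow_gt n0 K10 x1) K1P.
have o3 := le_trans (pr_overflow_gt n0 K20 x2) K2P.
apply: le_trans (lerD _ acc) _; last first.
  rewrite -(_ : theta + (theta + (theta + (theta + (size l)%:R * theta))) + theta
    = (5 + (size l)%:R) * theta); [exact: lexx|by ring].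
apply: le_trans (pr_le _ (measurable_attempt_set (G n) _) (measurableU _ _ mE1 mB2) sub) _.
apply: (le_trans (prU_le _ mE1 mB2)); apply: (lerD acc).
apply: (le_trans (prU_le _ (mO C 1%N) mB3)); apply: (lerD o1).
apply: (le_trans (prU_le _ (mO _ K1) mB4)); apply: (lerD o2).
by apply: (le_trans (prU_le _ (mO _ K2) mU)); apply: (lerD o3).
Unshelve. all: by end_near. Qed.

End Degrees.

(** [c] depends on [theta] through [C] but on neither [eta] nor [N], as dividing by it later
    requires. [N] is arbitrary because the number of edges grows linearly. *)
Lemma near_good_graph (alpha beta : sign) (l : seq (nat * nat)) (sp tp : Prop) (q : R) :
  0 < q ->
  (forall x, x \in l ->
     2 * q <= pr P0 (gamma @^-1` [set x.1]) * pr P0 (xi @^-1` [set x.2])) ->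
  (exists2 x, x \in l & (0 < x.2)%N) ->
  (sp -> exists x1 x2, [/\ x1 \in l, x2 \in l,
    (0 < x1.2)%N, (0 < x2.2)%N & select alpha x1 != select alpha x2]) ->
  (tp -> exists x1 x2, [/\ x1 \in l, x2 \in l,
    (0 < x1.1)%N, (0 < x2.1)%N & select beta x1 != select beta x2]) ->
  forall theta : R, 0 < theta -> exists2 c : R, 0 < c & forall eta N : R, 0 < eta ->
    \forall n \near \oo, pr (P n) (ecm_graph (G n) @^-1`
      (~` [set g | good_graph g alpha beta N eta c sp tp])) <= theta.
Proof.
move=> q0 l_q atom src_atoms tgt_atoms theta theta0.
have q2 : q <= 2.
  have [y yl _] := atom; apply: le_trans (_ : 2 * q <= 2); first by rewrite ler_peMl ?ler1n// ltW.
  apply: (le_trans (l_q y yl)); apply: (@le_trans _ _ 1); last by rewrite ler1n.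
  by rewrite mulr_ile1 ?pr_ge0// pr_le1//; exact: measurable_RV_preimage.
pose th := theta / 2 / (5 + (size l)%:R).
have s0 : 0 < 5 + (size l)%:R :> R by rewrite ltr_wpDr.
have th0 : 0 < th by rewrite !divr_gt0.
pose C := 4 * M / th + 1.
have C0 : 0 < C by rewrite ltr_wpDl// !mulr_ge0// invr_ge0 ltW.
have C_th : 4 * M / C <= th.
  rewrite ler_pdivrMr// /C mulrDr mulr1 [th * _]mulrC divfK ?gt_eqF//.
  by rewrite lerDl ltW.
pose x := q / 2 / (2 + C).
have x0 : 0 < x by rewrite !divr_gt0// ltr_wpDl.
exists (4^-1 * x ^+ 3) => [|eta N eta0]; first by rewrite mulr_gt0 ?invr_gt0// exprn_gt0.
(* The three bounds keep half of each atom, keep half of the stubs as edges, and absorb the factor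
   56. *)
pose e := Num.min (x / 2) (Num.min 2^-1 (eta / 56)).
have e0 : 0 < e.
  by rewrite lt_min (divr_gt0 x0)// lt_min (divr_gt0 eta0)// invr_gt0 ltr0n.
have [e1 e2 e3] : [/\ e <= x / 2, e <= 2^-1 & e <= eta / 56].
  by rewrite /e; split; rewrite !ge_min lexx ?orbT.
have [K1 [K2 good]] := near_good_degrees q0 C0 e0 l_q th0 C_th.
pose me : R := matching_error e K1 K2.
near=> n.
have n0 : (0 < n)%N by near: n; exact: nbhs_infty_gt.
have nR : 0 < n%:R :> R by rewrite ltr0n.
have nN : N <= q / 4 * n%:R.
  have : N / (q / 4) <= n%:R by near: n; exact: nbhs_infty_ger.
  by rewrite ler_pdivrMr ?divr_gt0// mulrC.
have n2 : 2 <= q / 2 * n%:R.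
  have : 2 / (q / 2) <= n%:R by near: n; exact: nbhs_infty_ger.
  by rewrite ler_pdivrMr ?divr_gt0// mulrC.
have ne : me / (q / 2 * n%:R) <= theta / 2.
  have : me / (q / 2) / (theta / 2) <= n%:R by near: n; exact: nbhs_infty_ger.
  rewrite [_ / (theta / 2) <= _]ler_pdivrMr ?divr_gt0// => h.
  by rewrite invfM mulrA ler_pdivrMr// [leRHS]mulrC.
have bad : pr (P n) (ecm_kept (G n) (n%:R `^ s) @^-1` (~` good_degrees l q C e K1 K2))
    <= (5 + (size l)%:R) * th by near: n.
have exc (r : bidegree (V n)) : good_degrees l q C e K1 K2 r -> (`|excess r| <= #|V n|)%N.
  move=> [h _ _ _ _]; rewrite -(ler_nat R); apply: (le_trans h).
  by rewrite -[leRHS]mul1r ler_wpM2r ?ler0n// ler_pdivrMr ?mul1r.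
pose H : set {set V n * V n} :=
  [set g | good_graph g alpha beta N (56 * e) (4^-1 * x ^+ 3) sp tp].
have match_bad (r : bidegree (V n)) (S : {set V n}) :
    good_degrees l q C e K1 K2 r -> #|S| = `|excess r|%N ->
    #|[set m in stub_bijections (balance r S) | ~~ `[< H (erased_edges (to_stub_map m)) >]]%SET|%:R
    <= #|stub_bijections (balance r S)|%:R * (theta / 2).
  move=> gr cS; have nV : n%:R = #|V n|%:R :> R by rewrite card_V.
  have e_x : 2 * e <= x by move: e1; rewrite ler_pdivlMr// mulrC.
  move: n2 nN ne; rewrite nV => n2 nN ne.
  apply: le_trans (good_degrees_bad_matchings q0 (ltW C0) e0 e2 e_x n2 atom src_atoms
    tgt_atoms gr cS nN) _.
  by rewrite ler_wpM2l.
have th2 : 0 <= theta / 2 by rewrite ltW// divr_gt0.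
have := pr_bad_graph (G_ecm n) th2 exc match_bad.
move=> h; apply: (@le_trans _ _ (pr (P n) (ecm_graph (G n) @^-1` (~` H)))).
  apply: pr_le; try exact: (ecm_graph_preimage_measurable (G_ecm n)).
  move=> w /= ng gg; apply: ng; case: gg => g1 g2 g3 g4 g5; split=> //.
    by apply: (le_trans g2); rewrite ler_wpM2r ?exprn_ge0// mulrC -ler_pdivlMr.
  by apply: (le_trans g3); rewrite ler_wpM2r ?exprn_ge0// mulrC -ler_pdivlMr.
apply: (le_trans h); apply: le_trans (lerD bad (lexx _)) _.
by rewrite /th mulrC divfK ?gt_eqF// -splitr.
Unshelve. all: by end_near. Qed.

End ManyVertices.

Section LimitingAtoms.
Context {R : realType}.
Context (d0 : measure_display) (Omega0 : measurableType d0) (P0 : probability Omega0 R).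
Variables gamma xi : {RV P0 >-> nat}.
Hypotheses (gamma_gt0 : (0 < mean P0 gamma)%E) (gamma_fin : (mean P0 gamma < +oo)%E).
Hypotheses (xi_gt0 : (0 < mean P0 xi)%E) (xi_fin : (mean P0 xi < +oo)%E).

Definition joint_atom (x : nat * nat) : R :=
  pr P0 (gamma @^-1` [set x.1]) * pr P0 (xi @^-1` [set x.2]).

(** For out-degrees, an atom of [gamma] is paired with two positive atoms of [xi]. For in-degrees,
    two atoms of [gamma] are paired with one positive atom of [xi], so that the vertices are sources
    of stubs. *)
Lemma source_atoms alpha : ~ concentrated_in_a_point (source_law P0 gamma xi alpha) ->
  exists x1 x2, [/\ 0 < joint_atom x1, 0 < joint_atom x2,
    (0 < x1.2)%N, (0 < x2.2)%N & select alpha x1 != select alpha x2].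
Proof.
case: alpha => spread.
  have [i _ pi] := positive_atom gamma_gt0.
  have [j [k [j0 k0 jk pj pk]]] := two_positive_atoms xi_gt0 xi_fin spread.
  by exists (i, j), (i, k); split=> //; exact: mulr_gt0.
have [i i0 pi] := positive_atom xi_gt0.
have [j [k [jk pj pk]]] := two_atoms spread.
by exists (j, i), (k, i); split=> //; exact: mulr_gt0.
Qed.

Lemma target_atoms beta : ~ concentrated_in_a_point (target_law P0 gamma xi beta) ->
  exists x1 x2, [/\ 0 < joint_atom x1, 0 < joint_atom x2,
    (0 < x1.1)%N, (0 < x2.1)%N & select beta x1 != select beta x2].
Proof.
case: beta => spread.
  have [i i0 pi] := positive_atom gamma_gt0.
  have [j [k [jk pj pk]]] := two_atoms spread.
  by exists (i, j), (i, k); split=> //; exact: mulr_gt0.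
have [i _ pi] := positive_atom xi_gt0.
have [j [k [j0 k0 jk pj pk]]] := two_positive_atoms gamma_gt0 gamma_fin spread.
by exists (j, i), (k, i); split=> //; exact: mulr_gt0.
Qed.

Lemma atoms_lower_bound (l : seq (nat * nat)) : (forall x, x \in l -> 0 < joint_atom x) ->
  exists2 q, 0 < q & forall x, x \in l -> 2 * q <= joint_atom x.
Proof.
elim: l => [_|y l IH pos]; first by exists 1.
have [q q0 qP] := IH (fun x xl => pos x (@mem_behead _ (y :: l) x xl)).
have y0 := pos y (mem_head y l).
exists (Num.min q (joint_atom y / 2)); first by rewrite lt_min q0 divr_gt0.
move=> x; rewrite inE => /orP[/eqP->|/qP].
  by rewrite mulrC -ler_pdivlMr// ge_min lexx orbT.
by apply: le_trans; rewrite ler_pM2l// ge_min lexx.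
Qed.

End LimitingAtoms.

Lemma cvg_in_probability0_pr (R : realType) (d : nat -> measure_display)
    (Omega : forall n, measurableType (d n)) (P : forall n, probability (Omega n) R)
    (X : forall n, Omega n -> R) :
  (forall eps n, measurable [set w | eps < `|X n w|]) ->
  (forall eps theta : R, 0 < eps -> 0 < theta ->
     \forall n \near \oo, pr (P n) [set w | eps < `|X n w|] <= theta) ->
  cvg_in_probability0 P X.
Proof.
move=> mX small eps eps0.
rewrite (_ : (fun n => _) = (fun n => (pr (P n) [set w | eps < `|X n w|])%:E)); last first.
  by apply/funext => n; rewrite prE.
apply: cvg_EFin; first by near=> n.
apply/cvgr0Pnorm_le => theta theta0; have := small eps theta eps0 theta0.
by apply: filterS => n; rewrite /= ger0_norm ?pr_ge0.
Unshelve. all: by end_near. Qed.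

Section GoodGraphs.
Context {R : realType} {V : finType}.
Variables (E : {set V * V}) (alpha beta : sign) (N eta c : R) (sp tp : Prop).
Hypotheses (eta0 : 0 <= eta) (c0 : 0 < c).
Hypothesis good : good_graph E alpha beta N eta c sp tp.

Lemma good_graph_kendall : 2 <= N -> `|kendall E alpha beta : R| <= 2 * eta.
Proof.
move=> N2; case: good => mN K _ _ _; rewrite kendallE.
move: mN K; set m : R := @GRing.natmul R 1 #|E|; set k := kendall_sum _ _ _ => mN K.
have m2 : 2 <= m by exact: le_trans mN.
have m0 : 0 < m by move: m2; lra.
have m1 : 0 < m - 1 by move: m2; lra.
rewrite normrM normfV (ger0_norm (ltW (mulr_gt0 m0 m1))) ler_pdivrMr ?mulr_gt0//.
apply: (le_trans K); rewrite (_ : 2 * eta * _ = eta * m * (2 * (m - 1))); last by ring.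
rewrite expr2 mulrA.
by rewrite ler_wpM2l ?mulr_ge0 ?(ltW m0)//; move: m2; lra.
Qed.

Lemma good_graph_spearman_average : 1 <= N -> sp -> tp ->
  `|spearman_average E alpha beta : R| <= eta / c.
Proof.
move=> N1 hs ht; case: good => mN _ S /(_ hs) V1 /(_ ht) V2; rewrite spearman_averageE.
move: mN S V1 V2; set m : R := @GRing.natmul R 1 #|E|; set S := spearman_sum _ _ _.
set V1 := spearman_sum _ _ _; set V2 := spearman_sum _ _ _ => mN Sle V1le V2le.
have m0 : 0 < m ^+ 3 by rewrite exprn_gt0// (lt_le_trans _ mN)// (lt_le_trans _ N1).
have cm0 : 0 < c * m ^+ 3 by rewrite mulr_gt0.
have prod : c * m ^+ 3 <= Num.sqrt V1 * Num.sqrt V2.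
  rewrite -[leLHS]sqr_sqrtr ?(ltW cm0)// expr2.
  by apply: ler_pM; rewrite ?sqrtr_ge0// ler_wsqrtr.
have prod0 := lt_le_trans cm0 prod.
rewrite normrM normfV (ger0_norm (ltW prod0)) ler_pdivrMr//.
apply: (le_trans Sle); apply: le_trans (ler_wpM2l (divr_ge0 eta0 (ltW c0)) prod).
by rewrite [leRHS]mulrA divfK ?gt_eqF.
Qed.

End GoodGraphs.

(** Taking 1/p = 1 - kappa + delta0 / 2 leaves half of delta0 below the acceptance exponent, and
    half above each of 1/a, 1/b and 1/2. *)
Lemma moment_exponent (R : realFieldType) (a b kappa delta0 : R) : 1 < a -> 1 < b ->
  kappa = Num.min (1 - a^-1) (Num.min (1 - b^-1) 2^-1) -> 0 < delta0 -> delta0 < kappa ->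
  exists p, [/\ 1 < p, p < 2, p < a & p < b] /\ p^-1 < 1 - kappa + delta0.
Proof.
move=> a1 b1 kE d0 dk; have a0 : 0 < a by exact: lt_trans a1.
have b0 : 0 < b by exact: lt_trans b1.
have [ka kb k2] : [/\ kappa <= 1 - a^-1, kappa <= 1 - b^-1 & kappa <= 2^-1].
  by rewrite kE !ge_min !lexx !orbT.
have y0 : 0 < 1 - kappa + delta0 / 2 by move: k2 d0; lra.
exists (1 - kappa + delta0 / 2)^-1; rewrite invrK; split; last by move: d0; lra.
by split; rewrite 1?(invf_cp1, invf_plt) ?posrE//; move: ka kb k2 d0 dk; lra.
Qed.

Unset Implicit Arguments.

Theorem theorem5p13 (R : realType)
  (d0 : measure_display) (Omega0 : measurableType d0)
  (P0 : probability Omega0 R) (gamma xi : {RV P0 >-> nat})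
  (a b : R) (Lm Lp : R -> R) (kappa delta0 : R)
  (mean_gt0 : (0 < mean P0 gamma)%E)
  (mean_eq : mean P0 gamma = mean P0 xi)
  (mean_fin : (mean P0 gamma < +oo)%E)
  (a_gt1 : 1 < a) (b_gt1 : 1 < b)
  (Lm_sv : slowly_varying Lm) (Lp_sv : slowly_varying Lp)
  (gamma_tail : forall x : R, 0 < x ->
     (P0 [set w | (x < (gamma w)%:R)%R] <= (x `^ (- a) * Lm x)%:E)%E)
  (xi_tail : forall x : R, 0 < x ->
     (P0 [set w | (x < (xi w)%:R)%R] <= (x `^ (- b) * Lp x)%:E)%E)
  (kappa_def : kappa = Num.min (1 - a^-1) (Num.min (1 - b^-1) 2^-1))
  (delta0_gt0 : 0 < delta0) (delta0_lt : delta0 < kappa)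
  (d : nat -> measure_display) (Omega : forall n, measurableType (d n))
  (P : forall n, probability (Omega n) R)
  (V : nat -> finType) (card_V : forall n, #|V n| = n)
  (G : forall n, ecm_data (P n) (V n))
  (G_ecm : forall n,
     is_ecm (G n) gamma xi (n%:R `^ (1 - kappa + delta0)))
  (alpha beta : sign) :
  [/\ cvg_in_probability0 P (fun n w =>
        spearman_uniform (ecm_graph (G n) w) alpha beta
          (fun e => ecm_U (G n) e w) (fun e => ecm_W (G n) e w)),
      cvg_in_probability0 P (fun n w =>
        kendall (ecm_graph (G n) w) alpha beta)
    & ~ concentrated_in_a_point (source_law P0 gamma xi alpha) ->
      ~ concentrated_in_a_point (target_law P0 gamma xi beta) ->
      cvg_in_probability0 P (fun n w =>
        spearman_average (ecm_graph (G n) w) alpha beta)].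

Proof.
have [p [[p1 p2 pa pb] ps]] := moment_exponent a_gt1 b_gt1 kappa_def delta0_gt0 delta0_lt.
have p0 : 0 < p by exact: lt_trans p1.
have s1 : 1 - kappa + delta0 < 1 by move: delta0_lt; lra.
have [Mg [Mg0 gM]] := tail_moment Lm_sv p0 pa gamma_tail.
have [Mx [Mx0 xM]] := tail_moment Lp_sv p0 pb xi_tail.
pose M := Num.max Mg Mx.
have M0 : 0 <= M by rewrite le_max Mg0.
have {}gM : (\int[P0]_w ((gamma w)%:R `^ p)%:E <= M%:E)%E.
  by apply: (le_trans gM); rewrite lee_fin le_max lexx.
have {}xM : (\int[P0]_w ((xi w)%:R `^ p)%:E <= M%:E)%E.
  by apply: (le_trans xM); rewrite lee_fin le_max lexx orbT.
have near_good := near_good_graph p1 p2 M0 gM xM mean_eq ps s1 card_V G_ecm.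
have xi_gt0 : (0 < mean P0 xi)%E by rewrite -mean_eq.
have xi_fin : (mean P0 xi < +oo)%E by rewrite -mean_eq.
have [i0 i0_gt0 pi0] := positive_atom mean_gt0.
have [j0 j0_gt0 pj0] := positive_atom xi_gt0.
(* Without the lower bounds, one joint atom with positive out-degree suffices to ensure many edges;
   concentrated limiting laws are thus included. *)
have small_sums (theta : R) : 0 < theta -> exists2 c : R, 0 < c & forall eta N : R, 0 < eta ->
    \forall n \near \oo, pr (P n) (ecm_graph (G n) @^-1`
      (~` [set g | good_graph g alpha beta N eta c False False])) <= theta.
  have [q q0 qP] := @atoms_lower_bound R _ _ P0 gamma xi [:: (i0, j0)]
    (fun x => ltac:(by rewrite inE => /eqP->; exact: mulr_gt0)).
  by apply: (near_good _ _ _ _ _ q q0 qP) => //; exists (i0, j0); rewrite ?mem_head.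
have mG n Q := @ecm_graph_preimage_measurable R _ _ P0 gamma xi _ _ _ _ (G n) _ (G_ecm n) Q.
split.
- apply: cvg_in_probability0_pr => [eps n|eps theta eps0 theta0].
    exact: (measurable_spearman_uniform_gt (G_ecm n)).
  have t2 : 0 < theta / 2 by rewrite divr_gt0.
  have t4 : 0 < theta / 4 by rewrite divr_gt0.
  have [c c0 good] := small_sums _ t2.
  have e8 : 0 < eps / 8 by rewrite divr_gt0.
  have e16 : 0 < (eps / 16) ^+ 2 by rewrite exprn_gt0// divr_gt0.
  pose N := (Num.trunc (8 / ((eps / 16) ^+ 2 * (theta / 4)))).+2.
  have N_small : 8 / ((eps / 16) ^+ 2 * N%:R) <= theta / 4.
    rewrite ler_pdivrMr ?mulr_gt0 ?ltr0n// mulrCA mulrA -ler_pdivrMl ?mulr_gt0//.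
    rewrite mulrC; apply: (le_trans (ltW (truncnS_gt _))).
    by rewrite ler_nat.
  near=> n.
  have bad : pr (P n) (ecm_graph (G n) @^-1`
      (~` [set g | good_graph g alpha beta N%:R (eps / 8) c False False])) <= theta / 2.
    by near: n; exact: good.
  (* The number of bins is chosen after n, fine enough for the number of potential edges. *)
  pose M' := Num.trunc (2 * #|{: V n * V n}|%:R ^+ 2 / (theta / 4)).
  have M_small : 2 * (#|{: V n * V n}|%:R ^+ 2 / M'.+1%:R) <= theta / 4.
    rewrite mulrA ler_pdivrMr ?ltr0n// -ler_pdivrMl// [leLHS]mulrC.
    exact: ltW (truncnS_gt _).
  pose H : set {set V n * V n} :=
    [set g | good_graph g alpha beta N%:R (eps / 8) c False False].
  have HP g : H g -> (N <= #|g|)%N /\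
      `|spearman_sum g (src_degree g alpha) (tgt_degree g beta)| <= eps / 8 * #|g|%:R ^+ 3.
    by case=> size _ S _ _; split=> //; rewrite -(ler_nat R).
  apply: le_trans (pr_spearman_uniform_gt (G_ecm n) M' eps0 _ HP) _ => //.
  apply: (le_trans (lerD bad (lerD M_small N_small))).
  by move: theta0; lra.
- apply: cvg_in_probability0_pr => [eps n|eps theta eps0 theta0].
    exact: (mG n [set g | eps < `|kendall g alpha beta|]).
  have e2 : 0 < eps / 2 by rewrite divr_gt0.
  have [c c0 good] := small_sums _ theta0.
  near=> n.
  have bad : pr (P n) (ecm_graph (G n) @^-1`
      (~` [set g | good_graph g alpha beta 2 (eps / 2) c False False])) <= theta.
    by near: n; exact: good.
  apply: le_trans bad; apply: pr_le => //.
    exact: (mG n [set g | eps < `|kendall g alpha beta|]).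
  move=> w /= big /good_graph_kendall-/(_ (ltW e2) (lexx _)).
  by rewrite mulrC divfK// leNgt big.
- move=> src_spread tgt_spread.
  have [s [s' [ps1 ps2 s2 s2' ss]]] :=
    source_atoms mean_gt0 xi_gt0 xi_fin src_spread.
  have [t [t' [pt1 pt2 t1 t1' tt]]] :=
    target_atoms mean_gt0 mean_fin xi_gt0 tgt_spread.
  have [q q0 qP] := @atoms_lower_bound R _ _ P0 gamma xi [:: s; s'; t; t']
    (fun x => ltac:(by rewrite !inE => /or4P[] /eqP->)).
  apply: cvg_in_probability0_pr => [eps n|eps theta eps0 theta0].
    exact: (mG n [set g | eps < `|spearman_average g alpha beta|]).
  have [|||c c0 good] := near_good alpha beta [:: s; s'; t; t'] True True q q0 qP
    _ _ _ theta theta0.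
  + by exists s; rewrite ?mem_head.
  + by move=> _; exists s, s'; rewrite !inE !eqxx !orbT.
  + by move=> _; exists t, t'; rewrite !inE !eqxx !orbT.
  (* The precision eps c turns into eps once divided by [c]. *)
  have ec : 0 < eps * c by rewrite mulr_gt0.
  near=> n.
  have bad : pr (P n) (ecm_graph (G n) @^-1`
      (~` [set g | good_graph g alpha beta 1 (eps * c) c True True])) <= theta.
    by near: n; exact: good.
  apply: le_trans bad; apply: pr_le => //.
    exact: (mG n [set g | eps < `|spearman_average g alpha beta|]).
  move=> w /= big /good_graph_spearman_average-/(_ (ltW ec) c0 (lexx _) I I).
  by rewrite mulfK ?gt_eqF// leNgt big.
Unshelve. all: by end_near. Qed.
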